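(* In guarded MTT, at mode $s$, let $A : U$. Then $\mathsf{El}(\mathsf{Str}(A))$ with the coalgebra structure $\mathsf{uncons}(x) := (\mathsf{head}_A(x), \mathsf{tail}_A(x)) : \mathsf{El}(A)\times\mathsf{El}(\mathsf{Str}(A))$ is a final coalgebra for the functor $X \mapsto \mathsf{El}(A) \times X$: for every type $B$ at mode $s$ and every $c : B \to \mathsf{El}(A)\times B$ there is $f : B \to \mathsf{El}(\mathsf{Str}(A))$ with $\mathsf{uncons}(f(x)) = (\pi_0(c(x)), f(\pi_1(c(x))))$ for all $x : B$, and every $g : B \to \mathsf{El}(\mathsf{Str}(A))$ with $\mathsf{uncons}(g(x)) = (\pi_0(c(x)), g(\pi_1(c(x))))$ for all $x : B$ is equal to $f$.
   Context: MTT over a mode theory $\mathcal{M}$ is a dependent type theory with, at each mode, $\Pi$, $\Sigma$, identity types, booleans and a Coquand-style universe $U$ with decoding $\mathsf{El}$; locks $\Gamma.\{\mu\}$ for each modality $\mu:n\to m$ (contexts at $m$ to contexts at $n$, with $\Gamma.\{1\}=\Gamma$, $\Gamma.\{\mu\}.\{\nu\}=\Gamma.\{\mu\circ\nu\}$), key substitutions for 2-cells $\alpha$ (action $(-)^\alpha$), modal types $\langle\mu\mid A\rangle$ with introduction $\mathsf{mod}_\mu$ and eliminator $\mathsf{let}_\nu\ \mathsf{mod}_\mu(x)\leftarrow M_0\ \mathsf{in}\ M_1$ ($\beta$, no $\eta$); there are canonical maps $\mathsf{comp}_{\mu,\nu} : \langle\mu\mid\langle\nu\mid A\rangle\rangle\to\langle\mu\circ\nu\mid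 A\rangle$ and $\langle 1\mid A\rangle\to A$. Guarded MTT is MTT over the poset-enriched mode theory $\mathcal{M}_g$ with modes $s,t$, 1-cells $\ell:t\to t$, $\gamma:t\to s$, $\delta:s\to t$, equations $\gamma\circ\delta=1_s$, $\gamma\circ\ell=\gamma$, 2-cells $\delta\circ\gamma\le 1_t$, $1_t\le\ell$; identity types replaced by extensional identity types $\mathsf{Eq}$ with equality reflection; and at mode $t$, Löb induction $\mathsf{löb} : (\triangleright A^{1\le\ell}\to A)\to A$ with $\mathsf{löb}(M)=M(\mathsf{next}(\mathsf{löb}(M)))$, where $\triangleright A:=\langle\ell\mid A\rangle$, $\mathsf{next}(x):=\mathsf{let}_1\ \mathsf{mod}_1(z)\leftarrow\mathsf{mod}_1(x)\ \mathsf{in}\ \mathsf{mod}_\ell(z^{1\le\ell})$. Write $\Delta X := \langle\delta\mid X\rangle$, $\Gamma X:=\langle\gamma\mid X\rangle$ (also on codes in $U$). For $A : U$ at mode $s$, define at mode $t$ (in context $A:U$ locked by $\gamma$; well-typed since $\gamma\circ\delta=1$) $\mathsf{Str}'(A) := \mathsf{löb}(\lambda X.\ \Delta A \times (\mathsf{let}_1\ \mathsf{mod}_\ell(Y)\leftarrow X\ \mathsf{in}\ \triangleright Y)) : U$, so that $\mathsf{Str}'(A) = \Delta A\times\triangleright\mathsf{Str}'(A)$, and $\mathsf{Str}(A) := \Gamma(\mathsf{Str}'(A)) : U$ at mode $s$. Define $\mathsf{head}_A(x) := \mathsf{let}_1\ \mathsf{mod}_\gamma(x')\leftarrow x\ \mathsf{in}$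 the image of $\mathsf{mod}_\gamma(\pi_0 x') : \langle\gamma\mid\langle\delta\mid\mathsf{El} A\rangle\rangle$ under $\mathsf{comp}_{\gamma,\delta}$ followed by $\langle 1\mid\mathsf{El}A\rangle\to\mathsf{El}A$; and $\mathsf{tail}_A(x) := \mathsf{let}_1\ \mathsf{mod}_\gamma(x')\leftarrow x\ \mathsf{in}\ \mathsf{comp}_{\gamma,\ell}(\mathsf{mod}_\gamma(\pi_1 x'))$, using $\gamma\circ\ell=\gamma$. *)

(* Defs.v *)
(* Guarded MTT, presented as a generalised algebraic theory with explicit
   substitutions and de Bruijn indices.  Raw syntax is indexed by modes; the
   judgements are inductively generated relations on raw syntax. *)

Set Implicit Arguments.

Inductive mode : Set := mode_s | mode_t.

Inductive hom : mode -> mode -> Set :=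
| one {m} : hom m m
| hcomp {o n m} (mu : hom n m) (nu : hom o n) : hom o m
| ell : hom mode_t mode_t
| gam : hom mode_t mode_s
| del : hom mode_s mode_t.

Infix "∘" := hcomp (at level 40, left associativity).

Reserved Notation "mu ⇒ nu" (at level 70, no associativity).

(* The 2-cells.  The mode theory is enriched in posets, so a 2-cell is a mere
   inequality, and 1-cells are taken modulo the antisymmetrisation [≈] below:
   an equation between 1-cells is given as a pair of inequalities. *)
Inductive cell : forall {n m}, hom n m -> hom n m -> Prop :=
| cell_refl n m (mu : hom n m) : mu ⇒ mu
| cell_trans n m (mu nu rho : hom n m) : mu ⇒ nu -> nu ⇒ rho -> mu ⇒ rho
| cell_comp o n m (mu mu' : hom n m) (nu nu' : hom o n) :
    mu ⇒ mu' -> nu ⇒ nu' -> mu ∘ nu ⇒ mu' ∘ nu'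
| cell_one_l n m (mu : hom n m) : one ∘ mu ⇒ mu
| cell_one_l' n m (mu : hom n m) : mu ⇒ one ∘ mu
| cell_one_r n m (mu : hom n m) : mu ∘ one ⇒ mu
| cell_one_r' n m (mu : hom n m) : mu ⇒ mu ∘ one
| cell_assoc p o n m (mu : hom n m) (nu : hom o n) (rho : hom p o) :
    (mu ∘ nu) ∘ rho ⇒ mu ∘ (nu ∘ rho)
| cell_assoc' p o n m (mu : hom n m) (nu : hom o n) (rho : hom p o) :
    mu ∘ (nu ∘ rho) ⇒ (mu ∘ nu) ∘ rho
| cell_gam_del : gam ∘ del ⇒ one
| cell_gam_del' : one ⇒ gam ∘ del
| cell_gam_ell : gam ∘ ell ⇒ gam
| cell_gam_ell' : gam ⇒ gam ∘ ell
| cell_del_gam : del ∘ gam ⇒ one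
| cell_one_ell : one ⇒ ell
where "mu ⇒ nu" := (cell mu nu).

Definition heq {n m} (mu nu : hom n m) : Prop := (mu ⇒ nu) /\ (nu ⇒ mu).
Notation "mu ≈ nu" := (heq mu nu) (at level 70, no associativity).

(* Every type and term former carries all the type arguments it has as an
   operation of the generalised algebraic theory (so [tapp], for instance,
   records domain and codomain): with equality reflection, [Pi] need not be
   injective in an inconsistent context, and an unannotated calculus would
   identify more terms.
   [lock G mu] is [Γ.{μ}] and [ext G mu A] is [Γ.(μ | A)]; [t ⊚ s] is [t] after
   [s]; [skey G mu nu : Γ.{ν} → Γ.{μ}] is the key of the 2-cell [μ ≤ ν], so that
   [A^{μ≤ν}] is [A⟦skey G mu nu⟧]; [var] is the last variable of
   [Γ.(μ | A).{μ}], the other variables being obtained by weakening and keys;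
   [tlet nu mu A B a b] is [let_ν mod_μ(x) ← a in b] with motive [B]. *)
Inductive ctx : mode -> Type :=
| emp {m} : ctx m
| lock {n m} (G : ctx m) (mu : hom n m) : ctx n
| ext {n m} (G : ctx m) (mu : hom n m) (A : ty n) : ctx m
with sub : mode -> Type :=
| sid {m} : sub m
| scomp {m} (t s : sub m) : sub m
| semp {m} : sub m
| swk {m} : sub m
| sext {n m} (mu : hom n m) (s : sub m) (A : ty n) (a : tm n) : sub m
| slock {n m} (mu : hom n m) (s : sub m) : sub n
| skey {n m} (G : ctx m) (mu nu : hom n m) : sub n
with ty : mode -> Type :=
| tysub {m} (A : ty m) (s : sub m) : ty m
| Pi {n m} (mu : hom n m) (A : ty n) (B : ty m) : ty m
| Sig {m} (A B : ty m) : ty m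
| Eq {m} (A : ty m) (a b : tm m) : ty m
| Bool {m} : ty m
| Univ {m} : ty m
| El {m} (a : tm m) : ty m
| Mod {n m} (mu : hom n m) (A : ty n) : ty m
with tm : mode -> Type :=
| tmsub {m} (a : tm m) (s : sub m) : tm m
| var {m} : tm m
| tlam {n m} (mu : hom n m) (A : ty n) (B : ty m) (b : tm m) : tm m
| tapp {n m} (mu : hom n m) (A : ty n) (B : ty m) (f : tm m) (a : tm n) : tm m
| tpair {m} (A B : ty m) (a b : tm m) : tm m
| tfst {m} (A B : ty m) (p : tm m) : tm m
| tsnd {m} (A B : ty m) (p : tm m) : tm m
| trefl {m} (A : ty m) (a : tm m) : tm m
| ttrue {m} : tm m
| tfalse {m} : tm m
| tif {m} (B : ty m) (a b c : tm m) : tm m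
| tcode {m} (A : ty m) : tm m
| tmod {n m} (mu : hom n m) (A : ty n) (a : tm n) : tm m
| tlet {o n m} (nu : hom n m) (mu : hom o n) (A : ty o) (B : ty m)
    (a : tm n) (b : tm m) : tm m
| tloeb (A : ty mode_t) (f : tm mode_t) : tm mode_t.

Notation "t ⊚ s" := (scomp t s) (at level 40, left associativity).
Notation "A ⟦ s ⟧" := (tysub A s) (at level 8, left associativity, format "A ⟦ s ⟧").
Notation "a ⟪ s ⟫" := (tmsub a s) (at level 8, left associativity, format "a ⟪ s ⟫").

(* For [s : Γ → Δ], the substitution [Γ.(μ | A[s.{μ}]) → Δ.(μ | A)]. *)
Definition lift {n m} (mu : hom n m) (A : ty n) (s : sub m) : sub m :=
  sext mu (s ⊚ swk) A var.

(* The substitution [Γ → Γ.(μ | A)] given by [Γ.{μ} ⊢ a : A]. *)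
Definition inst {n m} (mu : hom n m) (A : ty n) (a : tm n) : sub m :=
  sext mu sid A a.

Definition arr {m} (A B : ty m) : ty m := Pi one A B⟦swk⟧.
Definition app {m} (A B : ty m) (f a : tm m) : tm m := tapp one A B⟦swk⟧ f a.
Definition prod {m} (A B : ty m) : ty m := Sig A B⟦swk⟧.
Definition pair {m} (A B : ty m) (a b : tm m) : tm m := tpair A B⟦swk⟧ a b.
Definition fst {m} (A B : ty m) (p : tm m) : tm m := tfst A B⟦swk⟧ p.
Definition snd {m} (A B : ty m) (p : tm m) : tm m := tsnd A B⟦swk⟧ p.

(* The substitution [Γ.(ν∘μ | A) → Γ.(ν | ⟨μ | A⟩)] given by [mod_μ(x)]. *)
Definition smod {o n m} (nu : hom n m) (mu : hom o n) (A : ty o) : sub m :=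
  sext nu swk (Mod mu A)
    (tmod mu A⟦slock mu (slock nu swk)⟧ var).

(* [▷ (A^{1≤ℓ})] and [next(x)] for [A] a type and [x : A] in context [G]. *)
Definition later (G : ctx mode_t) (A : ty mode_t) : ty mode_t :=
  Mod ell A⟦skey G one ell⟧.

Definition next (G : ctx mode_t) (A : ty mode_t) (x : tm mode_t) : tm mode_t :=
  tlet one one A (later G A)⟦swk⟧ (tmod one A x)
    (tmod ell A⟦skey G one ell⟧⟦slock ell swk⟧
       var⟪skey (ext G (one ∘ one) A) one ell⟫).

Inductive level : Set := small | large.

Reserved Notation "'⊢c' G ≡ G'" (at level 75, G at level 69, no associativity).
Reserved Notation "'⊢c' G" (at level 75, G at level 69, no associativity).
Reserved Notation "G '⊢s' s ≡ s' ∶ D"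
  (at level 75, s at level 69, s' at level 69, D at level 69, no associativity).
Reserved Notation "G '⊢s' s ∶ D"
  (at level 75, s at level 69, D at level 69, no associativity).
Reserved Notation "G '⊢T' l A ≡ A'"
  (at level 75, l at level 0, A at level 69, A' at level 69, no associativity).
Reserved Notation "G '⊢T' l A"
  (at level 75, l at level 0, A at level 69, no associativity).
Reserved Notation "G '⊢t' a ≡ a' ∶ A"
  (at level 75, a at level 69, a' at level 69, A at level 69, no associativity).
Reserved Notation "G '⊢t' a ∶ A"
  (at level 75, a at level 69, A at level 69, no associativity).

(* Only equality judgements are generated; well-formedness is the diagonal
   ([Γ ⊢ a : A] is [Γ ⊢ a ≡ a : A]), so that each congruence rule is at the same
   time the formation rule of the operation concerned, and reflexivity is not a
   rule.  Types are stratified into small and large ones with implicit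
   cumulativity; terms and context entries are formed at large types, and
   [Univ] classifies the small types. *)
Inductive eq_ctx : forall {m}, ctx m -> ctx m -> Prop :=
| ec_sym m (G G' : ctx m) : ⊢c G ≡ G' -> ⊢c G' ≡ G
| ec_trans m (G G' G'' : ctx m) : ⊢c G ≡ G' -> ⊢c G' ≡ G'' -> ⊢c G ≡ G''
| ec_emp m : ⊢c (@emp m)
| ec_lock n m (G G' : ctx m) (mu mu' : hom n m) :
    ⊢c G ≡ G' -> mu ≈ mu' -> ⊢c lock G mu ≡ lock G' mu'
| ec_ext n m (G G' : ctx m) (mu mu' : hom n m) A A' :
    ⊢c G ≡ G' -> mu ≈ mu' -> lock G mu ⊢T large A ≡ A' ->
    ⊢c ext G mu A ≡ ext G' mu' A'
| ec_lock_one m (G : ctx m) : ⊢c G -> ⊢c lock G one ≡ G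
| ec_lock_comp o n m (G : ctx m) (mu : hom n m) (nu : hom o n) :
    ⊢c G -> ⊢c lock (lock G mu) nu ≡ lock G (mu ∘ nu)

with eq_sub : forall {m}, ctx m -> sub m -> sub m -> ctx m -> Prop :=
| es_sym m (G D : ctx m) s s' : G ⊢s s ≡ s' ∶ D -> G ⊢s s' ≡ s ∶ D
| es_trans m (G D : ctx m) s s' s'' :
    G ⊢s s ≡ s' ∶ D -> G ⊢s s' ≡ s'' ∶ D -> G ⊢s s ≡ s'' ∶ D
| es_conv m (G G' D D' : ctx m) s s' :
    G ⊢s s ≡ s' ∶ D -> ⊢c G ≡ G' -> ⊢c D ≡ D' -> G' ⊢s s ≡ s' ∶ D'
| es_id m (G : ctx m) : ⊢c G -> G ⊢s sid ∶ G
| es_comp m (G D E : ctx m) s s' t t' :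
    G ⊢s s ≡ s' ∶ D -> D ⊢s t ≡ t' ∶ E -> G ⊢s t ⊚ s ≡ t' ⊚ s' ∶ E
| es_emp m (G : ctx m) : ⊢c G -> G ⊢s semp ∶ emp
| es_wk n m (G : ctx m) (mu : hom n m) A :
    ⊢c G -> lock G mu ⊢T large A -> ext G mu A ⊢s swk ∶ G
| es_ext n m (G D : ctx m) (mu mu' : hom n m) s s' A A' a a' :
    ⊢c D -> mu ≈ mu' ->
    G ⊢s s ≡ s' ∶ D -> lock D mu ⊢T large A ≡ A' ->
    lock G mu ⊢t a ≡ a' ∶ A⟦slock mu s⟧ ->
    G ⊢s sext mu s A a ≡ sext mu' s' A' a' ∶ ext D mu A
| es_lock n m (G D : ctx m) (mu mu' : hom n m) s s' :
    G ⊢s s ≡ s' ∶ D -> mu ≈ mu' ->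
    lock G mu ⊢s slock mu s ≡ slock mu' s' ∶ lock D mu
| es_key n m (G G' : ctx m) (mu mu' nu nu' : hom n m) :
    ⊢c G ≡ G' -> mu ≈ mu' -> nu ≈ nu' -> mu ⇒ nu ->
    lock G nu ⊢s skey G mu nu ≡ skey G' mu' nu' ∶ lock G mu
| es_id_l m (G D : ctx m) s : G ⊢s s ∶ D -> G ⊢s sid ⊚ s ≡ s ∶ D
| es_id_r m (G D : ctx m) s : G ⊢s s ∶ D -> G ⊢s s ⊚ sid ≡ s ∶ D
| es_assoc m (G D E F : ctx m) s t u :
    G ⊢s s ∶ D -> D ⊢s t ∶ E -> E ⊢s u ∶ F ->
    G ⊢s (u ⊚ t) ⊚ s ≡ u ⊚ (t ⊚ s) ∶ F
| es_emp_eta m (G : ctx m) s : G ⊢s s ∶ emp -> G ⊢s s ≡ semp ∶ emp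
| es_wk_ext n m (G D : ctx m) (mu : hom n m) s A a :
    ⊢c D -> G ⊢s s ∶ D -> lock D mu ⊢T large A ->
    lock G mu ⊢t a ∶ A⟦slock mu s⟧ ->
    G ⊢s swk ⊚ sext mu s A a ≡ s ∶ D
| es_ext_eta n m (G D : ctx m) (mu : hom n m) s A :
    ⊢c D -> lock D mu ⊢T large A -> G ⊢s s ∶ ext D mu A ->
    G ⊢s s ≡ sext mu (swk ⊚ s) A var⟪slock mu s⟫ ∶ ext D mu A
| es_lock_id n m (G : ctx m) (mu : hom n m) :
    ⊢c G -> lock G mu ⊢s slock mu sid ≡ sid ∶ lock G mu
| es_lock_comp n m (G D E : ctx m) (mu : hom n m) s t :
    G ⊢s s ∶ D -> D ⊢s t ∶ E ->
    lock G mu ⊢s slock mu (t ⊚ s) ≡ slock mu t ⊚ slock mu s ∶ lock E mu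
| es_lock_one m (G D : ctx m) s : G ⊢s s ∶ D -> G ⊢s slock one s ≡ s ∶ D
| es_lock_lock o n m (G D : ctx m) (mu : hom n m) (nu : hom o n) s :
    G ⊢s s ∶ D ->
    lock G (mu ∘ nu) ⊢s slock nu (slock mu s) ≡ slock (mu ∘ nu) s
      ∶ lock D (mu ∘ nu)
| es_key_id n m (G : ctx m) (mu : hom n m) :
    ⊢c G -> lock G mu ⊢s skey G mu mu ≡ sid ∶ lock G mu
| es_key_comp n m (G : ctx m) (mu nu rho : hom n m) :
    ⊢c G -> mu ⇒ nu -> nu ⇒ rho ->
    lock G rho ⊢s skey G mu nu ⊚ skey G nu rho ≡ skey G mu rho ∶ lock G mu
| es_key_nat n m (G D : ctx m) (mu nu : hom n m) s :
    G ⊢s s ∶ D -> ⊢c G -> ⊢c D -> mu ⇒ nu ->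
    lock G nu ⊢s skey D mu nu ⊚ slock nu s ≡ slock mu s ⊚ skey G mu nu
      ∶ lock D mu
| es_key_whisker_r o n m (G : ctx m) (mu nu : hom n m) (rho : hom o n) :
    ⊢c G -> mu ⇒ nu ->
    lock G (nu ∘ rho) ⊢s slock rho (skey G mu nu) ≡ skey G (mu ∘ rho) (nu ∘ rho)
      ∶ lock G (mu ∘ rho)
| es_key_whisker_l o n m (G : ctx m) (mu : hom n m) (nu rho : hom o n) :
    ⊢c G -> nu ⇒ rho ->
    lock G (mu ∘ rho) ⊢s skey (lock G mu) nu rho ≡ skey G (mu ∘ nu) (mu ∘ rho)
      ∶ lock G (mu ∘ nu)

with eq_ty : level -> forall {m}, ctx m -> ty m -> ty m -> Prop :=
| eT_sym l m (G : ctx m) A A' : G ⊢T l A ≡ A' -> G ⊢T l A' ≡ A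
| eT_trans l m (G : ctx m) A A' A'' :
    G ⊢T l A ≡ A' -> G ⊢T l A' ≡ A'' -> G ⊢T l A ≡ A''
| eT_conv l m (G G' : ctx m) A A' :
    G ⊢T l A ≡ A' -> ⊢c G ≡ G' -> G' ⊢T l A ≡ A'
| eT_cumul m (G : ctx m) A A' : G ⊢T small A ≡ A' -> G ⊢T large A ≡ A'
| eT_sub l m (G D : ctx m) s s' A A' :
    D ⊢T l A ≡ A' -> G ⊢s s ≡ s' ∶ D -> G ⊢T l A⟦s⟧ ≡ A'⟦s'⟧
| eT_sub_id l m (G : ctx m) A : G ⊢T l A -> G ⊢T l A⟦sid⟧ ≡ A
| eT_sub_comp l m (G D E : ctx m) s t A :
    E ⊢T l A -> G ⊢s s ∶ D -> D ⊢s t ∶ E -> G ⊢T l A⟦t ⊚ s⟧ ≡ A⟦t⟧⟦s⟧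
| eT_Pi l n m (G : ctx m) (mu mu' : hom n m) A A' B B' :
    ⊢c G -> mu ≈ mu' ->
    lock G mu ⊢T l A ≡ A' -> ext G mu A ⊢T l B ≡ B' ->
    G ⊢T l Pi mu A B ≡ Pi mu' A' B'
| eT_Pi_sub l n m (G D : ctx m) (mu : hom n m) A B s :
    ⊢c D -> lock D mu ⊢T l A -> ext D mu A ⊢T l B -> G ⊢s s ∶ D ->
    G ⊢T l (Pi mu A B)⟦s⟧ ≡ Pi mu A⟦slock mu s⟧ B⟦lift mu A s⟧
| eT_Sig l m (G : ctx m) A A' B B' :
    ⊢c G -> G ⊢T l A ≡ A' -> ext G one A ⊢T l B ≡ B' ->
    G ⊢T l Sig A B ≡ Sig A' B'
| eT_Sig_sub l m (G D : ctx m) A B s :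
    ⊢c D -> D ⊢T l A -> ext D one A ⊢T l B -> G ⊢s s ∶ D ->
    G ⊢T l (Sig A B)⟦s⟧ ≡ Sig A⟦s⟧ B⟦lift one A s⟧
| eT_Eq l m (G : ctx m) A A' a a' b b' :
    G ⊢T l A ≡ A' -> G ⊢t a ≡ a' ∶ A -> G ⊢t b ≡ b' ∶ A ->
    G ⊢T l Eq A a b ≡ Eq A' a' b'
| eT_Eq_sub l m (G D : ctx m) A a b s :
    D ⊢T l A -> D ⊢t a ∶ A -> D ⊢t b ∶ A -> G ⊢s s ∶ D ->
    G ⊢T l (Eq A a b)⟦s⟧ ≡ Eq A⟦s⟧ a⟪s⟫ b⟪s⟫
| eT_Bool l m (G : ctx m) : ⊢c G -> G ⊢T l Bool
| eT_Bool_sub l m (G D : ctx m) s : G ⊢s s ∶ D -> G ⊢T l Bool⟦s⟧ ≡ Bool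
| eT_Univ m (G : ctx m) : ⊢c G -> G ⊢T large Univ
| eT_Univ_sub m (G D : ctx m) s : G ⊢s s ∶ D -> G ⊢T large Univ⟦s⟧ ≡ Univ
| eT_El m (G : ctx m) a a' : G ⊢t a ≡ a' ∶ Univ -> G ⊢T small El a ≡ El a'
| eT_El_sub m (G D : ctx m) a s :
    D ⊢t a ∶ Univ -> G ⊢s s ∶ D -> G ⊢T small (El a)⟦s⟧ ≡ El a⟪s⟫
| eT_El_code m (G : ctx m) A : G ⊢T small A -> G ⊢T small El (tcode A) ≡ A
| eT_Mod l n m (G : ctx m) (mu mu' : hom n m) A A' :
    ⊢c G -> mu ≈ mu' -> lock G mu ⊢T l A ≡ A' -> G ⊢T l Mod mu A ≡ Mod mu' A'
| eT_Mod_sub l n m (G D : ctx m) (mu : hom n m) A s :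
    ⊢c D -> lock D mu ⊢T l A -> G ⊢s s ∶ D ->
    G ⊢T l (Mod mu A)⟦s⟧ ≡ Mod mu A⟦slock mu s⟧

with eq_tm : forall {m}, ctx m -> tm m -> tm m -> ty m -> Prop :=
| et_sym m (G : ctx m) a a' A : G ⊢t a ≡ a' ∶ A -> G ⊢t a' ≡ a ∶ A
| et_trans m (G : ctx m) a a' a'' A :
    G ⊢t a ≡ a' ∶ A -> G ⊢t a' ≡ a'' ∶ A -> G ⊢t a ≡ a'' ∶ A
| et_conv m (G G' : ctx m) a a' A A' :
    G ⊢t a ≡ a' ∶ A -> ⊢c G ≡ G' -> G ⊢T large A ≡ A' -> G' ⊢t a ≡ a' ∶ A'
| et_sub m (G D : ctx m) a a' A s s' :
    D ⊢t a ≡ a' ∶ A -> G ⊢s s ≡ s' ∶ D -> G ⊢t a⟪s⟫ ≡ a'⟪s'⟫ ∶ A⟦s⟧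
| et_sub_id m (G : ctx m) a A : G ⊢t a ∶ A -> G ⊢t a⟪sid⟫ ≡ a ∶ A
| et_sub_comp m (G D E : ctx m) s t a A :
    E ⊢t a ∶ A -> G ⊢s s ∶ D -> D ⊢s t ∶ E ->
    G ⊢t a⟪t ⊚ s⟫ ≡ a⟪t⟫⟪s⟫ ∶ A⟦t ⊚ s⟧
| et_var n m (G : ctx m) (mu : hom n m) A :
    ⊢c G -> lock G mu ⊢T large A ->
    lock (ext G mu A) mu ⊢t var ∶ A⟦slock mu swk⟧
| et_var_ext n m (G D : ctx m) (mu : hom n m) s A a :
    ⊢c D -> G ⊢s s ∶ D -> lock D mu ⊢T large A ->
    lock G mu ⊢t a ∶ A⟦slock mu s⟧ ->
    lock G mu ⊢t var⟪slock mu (sext mu s A a)⟫ ≡ a ∶ A⟦slock mu s⟧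
| et_lam n m (G : ctx m) (mu mu' : hom n m) A A' B B' b b' :
    ⊢c G -> mu ≈ mu' ->
    lock G mu ⊢T large A ≡ A' -> ext G mu A ⊢T large B ≡ B' ->
    ext G mu A ⊢t b ≡ b' ∶ B ->
    G ⊢t tlam mu A B b ≡ tlam mu' A' B' b' ∶ Pi mu A B
| et_lam_sub n m (G D : ctx m) (mu : hom n m) A B b s :
    ⊢c D -> lock D mu ⊢T large A -> ext D mu A ⊢T large B ->
    ext D mu A ⊢t b ∶ B -> G ⊢s s ∶ D ->
    G ⊢t (tlam mu A B b)⟪s⟫
      ≡ tlam mu A⟦slock mu s⟧ B⟦lift mu A s⟧ b⟪lift mu A s⟫ ∶ (Pi mu A B)⟦s⟧
| et_app n m (G : ctx m) (mu mu' : hom n m) A A' B B' f f' a a' :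
    ⊢c G -> mu ≈ mu' ->
    lock G mu ⊢T large A ≡ A' -> ext G mu A ⊢T large B ≡ B' ->
    G ⊢t f ≡ f' ∶ Pi mu A B -> lock G mu ⊢t a ≡ a' ∶ A ->
    G ⊢t tapp mu A B f a ≡ tapp mu' A' B' f' a' ∶ B⟦inst mu A a⟧
| et_app_sub n m (G D : ctx m) (mu : hom n m) A B f a s :
    ⊢c D -> lock D mu ⊢T large A -> ext D mu A ⊢T large B ->
    D ⊢t f ∶ Pi mu A B -> lock D mu ⊢t a ∶ A -> G ⊢s s ∶ D ->
    G ⊢t (tapp mu A B f a)⟪s⟫
      ≡ tapp mu A⟦slock mu s⟧ B⟦lift mu A s⟧ f⟪s⟫ a⟪slock mu s⟫
      ∶ B⟦inst mu A a⟧⟦s⟧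
| et_Pi_beta n m (G : ctx m) (mu : hom n m) A B b a :
    ⊢c G -> lock G mu ⊢T large A -> ext G mu A ⊢T large B ->
    ext G mu A ⊢t b ∶ B -> lock G mu ⊢t a ∶ A ->
    G ⊢t tapp mu A B (tlam mu A B b) a ≡ b⟪inst mu A a⟫ ∶ B⟦inst mu A a⟧
| et_Pi_eta n m (G : ctx m) (mu : hom n m) A B f :
    ⊢c G -> lock G mu ⊢T large A -> ext G mu A ⊢T large B ->
    G ⊢t f ∶ Pi mu A B ->
    G ⊢t f
      ≡ tlam mu A B (tapp mu A⟦slock mu swk⟧ B⟦lift mu A swk⟧ f⟪swk⟫ var)
      ∶ Pi mu A B
| et_pair m (G : ctx m) A A' B B' a a' b b' :
    ⊢c G -> G ⊢T large A ≡ A' -> ext G one A ⊢T large B ≡ B' ->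
    G ⊢t a ≡ a' ∶ A -> G ⊢t b ≡ b' ∶ B⟦inst one A a⟧ ->
    G ⊢t tpair A B a b ≡ tpair A' B' a' b' ∶ Sig A B
| et_pair_sub m (G D : ctx m) A B a b s :
    ⊢c D -> D ⊢T large A -> ext D one A ⊢T large B ->
    D ⊢t a ∶ A -> D ⊢t b ∶ B⟦inst one A a⟧ -> G ⊢s s ∶ D ->
    G ⊢t (tpair A B a b)⟪s⟫ ≡ tpair A⟦s⟧ B⟦lift one A s⟧ a⟪s⟫ b⟪s⟫
      ∶ (Sig A B)⟦s⟧
| et_fst m (G : ctx m) A A' B B' p p' :
    ⊢c G -> G ⊢T large A ≡ A' -> ext G one A ⊢T large B ≡ B' ->
    G ⊢t p ≡ p' ∶ Sig A B -> G ⊢t tfst A B p ≡ tfst A' B' p' ∶ A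
| et_fst_sub m (G D : ctx m) A B p s :
    ⊢c D -> D ⊢T large A -> ext D one A ⊢T large B ->
    D ⊢t p ∶ Sig A B -> G ⊢s s ∶ D ->
    G ⊢t (tfst A B p)⟪s⟫ ≡ tfst A⟦s⟧ B⟦lift one A s⟧ p⟪s⟫ ∶ A⟦s⟧
| et_snd m (G : ctx m) A A' B B' p p' :
    ⊢c G -> G ⊢T large A ≡ A' -> ext G one A ⊢T large B ≡ B' ->
    G ⊢t p ≡ p' ∶ Sig A B ->
    G ⊢t tsnd A B p ≡ tsnd A' B' p' ∶ B⟦inst one A (tfst A B p)⟧
| et_snd_sub m (G D : ctx m) A B p s :
    ⊢c D -> D ⊢T large A -> ext D one A ⊢T large B ->
    D ⊢t p ∶ Sig A B -> G ⊢s s ∶ D ->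
    G ⊢t (tsnd A B p)⟪s⟫ ≡ tsnd A⟦s⟧ B⟦lift one A s⟧ p⟪s⟫
      ∶ B⟦inst one A (tfst A B p)⟧⟦s⟧
| et_Sig_beta1 m (G : ctx m) A B a b :
    ⊢c G -> G ⊢T large A -> ext G one A ⊢T large B ->
    G ⊢t a ∶ A -> G ⊢t b ∶ B⟦inst one A a⟧ ->
    G ⊢t tfst A B (tpair A B a b) ≡ a ∶ A
| et_Sig_beta2 m (G : ctx m) A B a b :
    ⊢c G -> G ⊢T large A -> ext G one A ⊢T large B ->
    G ⊢t a ∶ A -> G ⊢t b ∶ B⟦inst one A a⟧ ->
    G ⊢t tsnd A B (tpair A B a b) ≡ b ∶ B⟦inst one A a⟧
| et_Sig_eta m (G : ctx m) A B p :
    ⊢c G -> G ⊢T large A -> ext G one A ⊢T large B ->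
    G ⊢t p ∶ Sig A B ->
    G ⊢t p ≡ tpair A B (tfst A B p) (tsnd A B p) ∶ Sig A B
| et_refl m (G : ctx m) A A' a a' :
    G ⊢T large A ≡ A' -> G ⊢t a ≡ a' ∶ A ->
    G ⊢t trefl A a ≡ trefl A' a' ∶ Eq A a a
| et_refl_sub m (G D : ctx m) A a s :
    D ⊢T large A -> D ⊢t a ∶ A -> G ⊢s s ∶ D ->
    G ⊢t (trefl A a)⟪s⟫ ≡ trefl A⟦s⟧ a⟪s⟫ ∶ (Eq A a a)⟦s⟧
| et_reflection m (G : ctx m) A a b p :
    G ⊢T large A -> G ⊢t a ∶ A -> G ⊢t b ∶ A ->
    G ⊢t p ∶ Eq A a b -> G ⊢t a ≡ b ∶ A
| et_Eq_eta m (G : ctx m) A a b p :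
    G ⊢T large A -> G ⊢t a ∶ A -> G ⊢t b ∶ A ->
    G ⊢t p ∶ Eq A a b -> G ⊢t p ≡ trefl A a ∶ Eq A a b
| et_true m (G : ctx m) : ⊢c G -> G ⊢t ttrue ∶ Bool
| et_true_sub m (G D : ctx m) s : G ⊢s s ∶ D -> G ⊢t ttrue⟪s⟫ ≡ ttrue ∶ Bool
| et_false m (G : ctx m) : ⊢c G -> G ⊢t tfalse ∶ Bool
| et_false_sub m (G D : ctx m) s : G ⊢s s ∶ D -> G ⊢t tfalse⟪s⟫ ≡ tfalse ∶ Bool
| et_if m (G : ctx m) B B' a a' b b' c c' :
    ⊢c G -> ext G one Bool ⊢T large B ≡ B' ->
    G ⊢t a ≡ a' ∶ Bool ->
    G ⊢t b ≡ b' ∶ B⟦inst one Bool ttrue⟧ ->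
    G ⊢t c ≡ c' ∶ B⟦inst one Bool tfalse⟧ ->
    G ⊢t tif B a b c ≡ tif B' a' b' c' ∶ B⟦inst one Bool a⟧
| et_if_sub m (G D : ctx m) B a b c s :
    ⊢c D -> ext D one Bool ⊢T large B ->
    D ⊢t a ∶ Bool ->
    D ⊢t b ∶ B⟦inst one Bool ttrue⟧ ->
    D ⊢t c ∶ B⟦inst one Bool tfalse⟧ ->
    G ⊢s s ∶ D ->
    G ⊢t (tif B a b c)⟪s⟫ ≡ tif B⟦lift one Bool s⟧ a⟪s⟫ b⟪s⟫ c⟪s⟫
      ∶ B⟦inst one Bool a⟧⟦s⟧
| et_Bool_beta1 m (G : ctx m) B b c :
    ⊢c G -> ext G one Bool ⊢T large B ->
    G ⊢t b ∶ B⟦inst one Bool ttrue⟧ ->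
    G ⊢t c ∶ B⟦inst one Bool tfalse⟧ ->
    G ⊢t tif B ttrue b c ≡ b ∶ B⟦inst one Bool ttrue⟧
| et_Bool_beta2 m (G : ctx m) B b c :
    ⊢c G -> ext G one Bool ⊢T large B ->
    G ⊢t b ∶ B⟦inst one Bool ttrue⟧ ->
    G ⊢t c ∶ B⟦inst one Bool tfalse⟧ ->
    G ⊢t tif B tfalse b c ≡ c ∶ B⟦inst one Bool tfalse⟧
| et_code m (G : ctx m) A A' :
    G ⊢T small A ≡ A' -> G ⊢t tcode A ≡ tcode A' ∶ Univ
| et_code_sub m (G D : ctx m) A s :
    D ⊢T small A -> G ⊢s s ∶ D -> G ⊢t (tcode A)⟪s⟫ ≡ tcode A⟦s⟧ ∶ Univ
| et_code_El m (G : ctx m) a : G ⊢t a ∶ Univ -> G ⊢t tcode (El a) ≡ a ∶ Univ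
| et_mod n m (G : ctx m) (mu mu' : hom n m) A A' a a' :
    ⊢c G -> mu ≈ mu' ->
    lock G mu ⊢T large A ≡ A' -> lock G mu ⊢t a ≡ a' ∶ A ->
    G ⊢t tmod mu A a ≡ tmod mu' A' a' ∶ Mod mu A
| et_mod_sub n m (G D : ctx m) (mu : hom n m) A a s :
    ⊢c D -> lock D mu ⊢T large A -> lock D mu ⊢t a ∶ A -> G ⊢s s ∶ D ->
    G ⊢t (tmod mu A a)⟪s⟫ ≡ tmod mu A⟦slock mu s⟧ a⟪slock mu s⟫
      ∶ (Mod mu A)⟦s⟧
| et_let o n m (G : ctx m) (nu nu' : hom n m) (mu mu' : hom o n)
    A A' B B' a a' b b' :
    ⊢c G -> nu ≈ nu' -> mu ≈ mu' ->
    lock (lock G nu) mu ⊢T large A ≡ A' ->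
    ext G nu (Mod mu A) ⊢T large B ≡ B' ->
    lock G nu ⊢t a ≡ a' ∶ Mod mu A ->
    ext G (nu ∘ mu) A ⊢t b ≡ b' ∶ B⟦smod nu mu A⟧ ->
    G ⊢t tlet nu mu A B a b ≡ tlet nu' mu' A' B' a' b'
      ∶ B⟦inst nu (Mod mu A) a⟧
| et_let_sub o n m (G D : ctx m) (nu : hom n m) (mu : hom o n) A B a b s :
    ⊢c D ->
    lock (lock D nu) mu ⊢T large A ->
    ext D nu (Mod mu A) ⊢T large B ->
    lock D nu ⊢t a ∶ Mod mu A ->
    ext D (nu ∘ mu) A ⊢t b ∶ B⟦smod nu mu A⟧ ->
    G ⊢s s ∶ D ->
    G ⊢t (tlet nu mu A B a b)⟪s⟫
      ≡ tlet nu mu A⟦slock mu (slock nu s)⟧ B⟦lift nu (Mod mu A) s⟧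
          a⟪slock nu s⟫ b⟪lift (nu ∘ mu) A s⟫
      ∶ B⟦inst nu (Mod mu A) a⟧⟦s⟧
| et_Mod_beta o n m (G : ctx m) (nu : hom n m) (mu : hom o n) A B a b :
    ⊢c G ->
    lock (lock G nu) mu ⊢T large A ->
    ext G nu (Mod mu A) ⊢T large B ->
    lock (lock G nu) mu ⊢t a ∶ A ->
    ext G (nu ∘ mu) A ⊢t b ∶ B⟦smod nu mu A⟧ ->
    G ⊢t tlet nu mu A B (tmod mu A a) b ≡ b⟪inst (nu ∘ mu) A a⟫
      ∶ B⟦inst nu (Mod mu A) (tmod mu A a)⟧
| et_loeb (G : ctx mode_t) A A' f f' :
    ⊢c G -> G ⊢T large A ≡ A' -> G ⊢t f ≡ f' ∶ arr (later G A) A ->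
    G ⊢t tloeb A f ≡ tloeb A' f' ∶ A
| et_loeb_sub (G D : ctx mode_t) A f s :
    ⊢c D -> D ⊢T large A -> D ⊢t f ∶ arr (later D A) A -> G ⊢s s ∶ D ->
    G ⊢t (tloeb A f)⟪s⟫ ≡ tloeb A⟦s⟧ f⟪s⟫ ∶ A⟦s⟧
| et_loeb_unfold (G : ctx mode_t) A f :
    ⊢c G -> G ⊢T large A -> G ⊢t f ∶ arr (later G A) A ->
    G ⊢t tloeb A f ≡ app (later G A) A f (next G A (tloeb A f)) ∶ A

where "'⊢c' G ≡ G'" := (eq_ctx G G')
and "'⊢c' G" := (eq_ctx G G)
and "G '⊢s' s ≡ s' ∶ D" := (eq_sub G s s' D)
and "G '⊢s' s ∶ D" := (eq_sub G s s D)
and "G '⊢T' l A ≡ A'" := (eq_ty l G A A')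
and "G '⊢T' l A" := (eq_ty l G A A)
and "G '⊢t' a ≡ a' ∶ A" := (eq_tm G a a' A)
and "G '⊢t' a ∶ A" := (eq_tm G a a A).

(* [comp_{μ,ν}(x) = let_1 mod_μ(y) ← x in let_μ mod_ν(z) ← y in mod_{μ∘ν}(z)] *)
Definition comp_map {o n m} (mu : hom n m) (nu : hom o n) (A : ty o) (x : tm m)
  : tm m :=
  let A1 := A⟦slock nu (slock mu swk)⟧ in
  tlet one mu (Mod nu A) (Mod (mu ∘ nu) A)⟦swk⟧ x
    (tlet mu nu A1 (Mod (mu ∘ nu) A1)⟦swk⟧ var
       (tmod (mu ∘ nu) A1⟦slock (mu ∘ nu) swk⟧ var)).

(* [⟨1 | A⟩ → A] *)
Definition triv_map {m} (A : ty m) (x : tm m) : tm m :=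
  tlet one one A A⟦swk⟧ x var.

(* [f : B → C] and [Γ, x : B ⊢ d (f x) ≡ (π₀ (c x), f (π₁ (c x))) : A × C].
   By equality reflection, judgemental equality and inhabitation of [Eq] agree. *)
Definition coalgebra_hom {m} (G : ctx m) (A B : ty m) (c : tm m) (C : ty m)
  (d f : tm m) : Prop :=
  G ⊢t f ∶ arr B C /\
  let A' := A⟦swk⟧ in let B' := B⟦swk⟧ in let C' := C⟦swk⟧ in
  let c' := c⟪swk⟫ in let d' := d⟪swk⟫ in let f' := f⟪swk⟫ in
  let cx := app B' (prod A' B') c' var in
  ext G one B ⊢t
    app C' (prod A' C') d' (app B' C' f' var)
    ≡ pair A' C' (fst A' B' cx) (app B' C' f' (snd A' B' cx))
    ∶ prod A' C'.

(* [d : C → A × C] is a final coalgebra for [X ↦ A × X]. *)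
Definition final_coalgebra {m} (G : ctx m) (A C : ty m) (d : tm m) : Prop :=
  G ⊢T large C /\
  G ⊢t d ∶ arr C (prod A C) /\
  forall (B : ty m) (c : tm m),
    G ⊢T large B ->
    G ⊢t c ∶ arr B (prod A B) ->
    exists f : tm m,
      coalgebra_hom G A B c C d f /\
      forall g : tm m, coalgebra_hom G A B c C d g -> G ⊢t g ≡ f ∶ arr B C.

Definition code_prod {m} (a b : tm m) : tm m := tcode (prod (El a) (El b)).
Definition code_mod {n m} (mu : hom n m) (a : tm n) : tm m :=
  tcode (Mod mu (El a)).

(* [λ X. Δ A × (let_1 mod_ℓ(Y) ← X in ▷ Y)] in context [Γ.{γ}]; in [Δ A] the
   code [A] lives in [Γ.{γ}.{δ} = Γ]. *)
Definition Str'_step (G : ctx mode_s) (A : tm mode_s) : tm mode_t :=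
  tlam one (later (lock G gam) Univ) Univ⟦swk⟧
    (code_prod (code_mod del A)⟪swk⟫
       (tlet one ell Univ Univ var (code_mod ell var))).

Definition Str' (G : ctx mode_s) (A : tm mode_s) : tm mode_t :=
  tloeb Univ (Str'_step G A).

Definition Str (G : ctx mode_s) (A : tm mode_s) : tm mode_s :=
  code_mod gam (Str' G A).

(* For [head_A(x)] and [tail_A(x)], with [x : El (Str A)] in context [Γ]: the
   variable [x'] bound by the eliminator has type [El (Str' A)], which unfolds to
   [Δ A × ▷ (Str' A)].  Below, [A'] and [T] are [El A] and [(El (Str' A))^{1≤ℓ}],
   weakened to the context extended by [x']. *)
Definition wk_Str' (G : ctx mode_s) (A : tm mode_s) : ty mode_t :=
  (El (Str' G A))⟦skey (lock G gam) one ell⟧⟦slock ell (slock gam swk)⟧.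

Definition head (G : ctx mode_s) (A x : tm mode_s) : tm mode_s :=
  let A' := (El A)⟦swk⟧ in
  let T := wk_Str' G A in
  tlet one gam (El (Str' G A)) (El A)⟦swk⟧ x
    (triv_map A'
       (comp_map gam del A'
          (tmod gam (Mod del A') (fst (Mod del A') (Mod ell T) var)))).

Definition tail (G : ctx mode_s) (A x : tm mode_s) : tm mode_s :=
  let A' := (El A)⟦swk⟧ in
  let T := wk_Str' G A in
  tlet one gam (El (Str' G A)) (El (Str G A))⟦swk⟧ x
    (comp_map gam ell T
       (tmod gam (Mod ell T) (snd (Mod del A') (Mod ell T) var))).

Definition uncons (G : ctx mode_s) (A : tm mode_s) : tm mode_s :=
  let S := El (Str G A) in
  let G' := ext G one S in
  let A' := A⟪swk⟫ in
  tlam one S (prod (El A) S)⟦swk⟧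
    (pair (El A') (El (Str G' A')) (head G' A' var) (tail G' A' var)).

(* Main.v *)
(* Terms, types, substitutions and contexts are taken modulo judgemental
   equality, together with the contexts and types over which they live, so that
   conversion becomes rewriting with equality.

   Any two 1-cells into the mode s with the same source are equal, so all keys
   between the contexts Γ and L = Γ.{γ} are identities, and L.{δ} = Γ, L.{ℓ} = L.
   For S = El (Str' A) this gives S = ⟨δ | A⟩ × ⟨ℓ | S⟩ over L.

   Existence: Löb induction at (δ | B) → S yields q with
   q b = (mod_δ (π₀ (c b)), mod_ℓ (q (π₁ (c b)))), and f b = mod_γ (q b).

   Uniqueness: let ε z = let_δ mod_γ(y) ← z in y^{δγ≤1}.  Modalities have no η
   rule, but dependent elimination into Eq followed by reflection shows that two
   terms natural in x : ⟨μ | A⟩ agree as soon as they agree on the mod_μ(a).  Hence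
   mod_γ (ε z) = z, π₀ (ε z) = mod_δ (head z) and π₁ (ε z) = mod_ℓ (ε (tail z)).
   If g is a coalgebra morphism, then λ b. ε (g b) satisfies the equation of q, the
   fixed point of which is unique by Löb induction at an Eq type, and
   g b = mod_γ (ε (g b)). *)

From Stdlib Require Import FunctionalExtensionality PropExtensionality ProofIrrelevance
  ClassicalEpsilon.
Require Import Defs.

Set Implicit Arguments.
Unset Strict Implicit.

(** * Quotients of the raw syntax *)

(** The obstacle is conversion. Substitutions and locks are explicit, every former records its
    types, and contexts such as Γ.{γ}.{δ} and Γ agree only judgementally, so that on raw syntax each
    step would need a transport. In the quotient these agreements are equations of Rocq. The price
    is paid at both ends: each former must respect the relation, which is its congruence rule, and
    the raw [Str'], [head], [tail] and [uncons] must be located in the classes computed with.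
    Operations on classes are total, with unspecified values on ill-typed arguments; typing is
    therefore a separate predicate, and equations between classes carry no type index. Keys are
    identities over Γ and over L, but not over an arbitrary context of mode t mapping to L, and
    eliminations extend the context. Hence every equation about streams is proved at all stages σ :
    Δ → L or σ : Ξ → Γ, with naturality in the stage. This is also what allows a statement about all
    arguments to be reduced to one about a generic variable. *)

Class per {X : Type} (R : X -> X -> Prop) : Prop := {
  per_sym : forall x y, R x y -> R y x;
  per_trans : forall x y z, R x y -> R y z -> R x z;
  per_inh : exists x, R x x }.

Arguments per_sym {X R _ x y}.
Arguments per_trans {X R _ x y z}.

(** The relation is reflexive only on well-formed syntax, so a member of a class is automatically
    well formed and ill-formed syntax lies in no class. *)
Definition quot {X : Type} (R : X -> X -> Prop) : Type :=
  {P : X -> Prop | exists x, R x x /\ P = R x}.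

Definition mem {X : Type} {R : X -> X -> Prop} (x : X) (q : quot R) : Prop :=
  proj1_sig q x.
Notation "x ∈ q" := (mem x q) (at level 70, no associativity).

Section Quotients.
Context {X : Type} {R : X -> X -> Prop} {P : per R}.

Lemma mem_rel (q : quot R) x y : x ∈ q -> y ∈ q -> R x y.
Proof.
  destruct q as [Q [z [Hz ->]]]; cbn; intros H1 H2.
  exact (per_trans (per_sym H1) H2).
Qed.

Lemma mem_conv (q : quot R) x y : x ∈ q -> R x y -> y ∈ q.
Proof.
  destruct q as [Q [z [Hz ->]]]; cbn; intros H1 H2. exact (per_trans H1 H2).
Qed.

Lemma mem_eq (p q : quot R) x y : x ∈ p -> y ∈ q -> R x y -> p = q.
Proof.
  intros Hp Hq H. apply eq_sig_hprop; [intros; apply proof_irrelevance|].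
  apply functional_extensionality; intros z; apply propositional_extensionality.
  split; intros Hz.
  - apply (mem_conv Hq). exact (per_trans (per_sym H) (mem_rel Hp Hz)).
  - apply (mem_conv Hp). exact (per_trans H (mem_rel Hq Hz)).
Qed.

Lemma ex_class x : R x x -> exists q : quot R, x ∈ q.
Proof.
  intros H.
  exists (exist _ (R x) (ex_intro _ x (Logic.conj H eq_refl))). exact H.
Qed.

Lemma ex_mem (q : quot R) : exists x, x ∈ q.
Proof. destruct q as [Q [z [Hz ->]]]; exists z; exact Hz. Qed.

Lemma inhabited_quot : inhabited (quot R).
Proof.
  destruct per_inh as [x H]; destruct (ex_class H) as [q _]; exact (inhabits q).
Qed.

(* Unspecified when the elements of [A] do not all lie in one class. *)
Definition the (A : X -> Prop) : quot R :=
  epsilon inhabited_quot (fun q => exists x, A x /\ x ∈ q).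

(** For an operation on classes, [A] collects the raw results over all representatives of the
    arguments; the second premise is then the congruence rule of the raw former. *)
Lemma the_spec (A : X -> Prop) x :
  A x -> (forall y, A y -> R x y) -> x ∈ the A.
Proof.
  intros Hx HA.
  destruct (ex_class (HA x Hx)) as [q Hq].
  destruct (epsilon_spec inhabited_quot (fun q => exists x, A x /\ x ∈ q)) as [y [Hy Hm]];
    [now exists q, x|].
  apply (mem_conv Hm). exact (per_sym (HA y Hy)).
Qed.
End Quotients.

(* Each representative carries its contexts and type. *)
Definition rsub {m} (x y : ctx m * ctx m * sub m) : Prop :=
  match x, y with (G, D, s), (G', D', s') =>
    ⊢c G ≡ G' /\ ⊢c D ≡ D' /\ G ⊢s s ≡ s' ∶ D end.
Definition rty {m} (x y : ctx m * ty m) : Prop :=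
  match x, y with (G, A), (G', A') => ⊢c G ≡ G' /\ G ⊢T large A ≡ A' end.
Definition rtm {m} (x y : ctx m * ty m * tm m) : Prop :=
  match x, y with (G, A, a), (G', A', a') =>
    ⊢c G ≡ G' /\ G ⊢T large A ≡ A' /\ G ⊢t a ≡ a' ∶ A end.

#[export] Instance per_hom n m : per (@heq n m).
Proof.
  constructor.
  - intros x y [? ?]; split; assumption.
  - intros x y z [? ?] [? ?]; split; eapply cell_trans; eassumption.
  - assert (H : inhabited (hom n m)) by
      (destruct n, m; constructor; [exact one | exact del | exact gam | exact one]).
    destruct H as [x]; exists x; split; apply cell_refl.
Qed.

#[export] Instance per_ctx m : per (@eq_ctx m).
Proof.
  constructor; [apply ec_sym | apply ec_trans | exists emp; apply ec_emp].
Qed.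

#[export] Instance per_sub m : per (@rsub m).
Proof.
  constructor.
  - intros [[G D] s] [[G' D'] s'] (H1 & H2 & H3); split; [|split];
      [now apply ec_sym .. |]. eapply es_conv; [apply es_sym|..]; eassumption.
  - intros [[G D] s] [[G' D'] s'] [[G'' D''] s''] (H1 & H2 & H3) (K1 & K2 & K3).
    split; [|split]; [eapply ec_trans; eassumption .. |].
    eapply es_trans; [eassumption|].
    eapply es_conv; [eassumption|now apply ec_sym ..].
  - exists (emp, emp, sid); repeat split; try apply ec_emp. apply es_id, ec_emp.
Qed.

#[export] Instance per_ty m : per (@rty m).
Proof.
  constructor.
  - intros [G A] [G' A'] (H1 & H2); split;
      [now apply ec_sym|]. eapply eT_conv; [apply eT_sym|]; eassumption.
  - intros [G A] [G' A'] [G'' A''] (H1 & H2) (K1 & K2).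
    split; [eapply ec_trans; eassumption|].
    eapply eT_trans; [eassumption|].
    eapply eT_conv; [eassumption|now apply ec_sym].
  - exists (emp, Bool); repeat split; [|apply eT_Bool]; apply ec_emp.
Qed.

#[export] Instance per_tm m : per (@rtm m).
Proof.
  constructor.
  - intros [[G A] a] [[G' A'] a'] (H1 & H2 & H3); split; [|split];
      [now apply ec_sym| |].
    + eapply eT_conv; [apply eT_sym|]; eassumption.
    + eapply et_conv; [apply et_sym|..]; eassumption.
  - intros [[G A] a] [[G' A'] a'] [[G'' A''] a''] (H1 & H2 & H3) (K1 & K2 & K3).
    assert (H1' := ec_sym H1).
    split; [|split]; [eapply ec_trans; eassumption | |].
    + eapply eT_trans; [eassumption|]. eapply eT_conv; eassumption.
    + eapply et_trans; [eassumption|].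
      eapply et_conv; [eassumption ..|]. eapply eT_conv; [apply eT_sym|]; eassumption.
  - exists (emp, Bool, ttrue); repeat split; [|apply eT_Bool|apply et_true]; apply ec_emp.
Qed.

Definition Hom n m := quot (@heq n m).
Definition Ctx m := quot (@eq_ctx m).
Definition Sub m := quot (@rsub m).
Definition Ty m := quot (@rty m).
Definition Tm m := quot (@rtm m).

Definition TyIn {m} (Γ : Ctx m) (T : Ty m) : Prop :=
  exists G A, G ∈ Γ /\ (G, A) ∈ T.
Definition TmIn {m} (Γ : Ctx m) (T : Ty m) (t : Tm m) : Prop :=
  exists G A a, G ∈ Γ /\ (G, A) ∈ T /\ (G, A, a) ∈ t.
Definition SubIn {m} (Γ Δ : Ctx m) (σ : Sub m) : Prop :=
  exists G D s, G ∈ Γ /\ D ∈ Δ /\ (G, D, s) ∈ σ.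

Section Reps.
Context {m : mode}.
Implicit Types (Γ Δ : Ctx m) (T : Ty m) (t : Tm m) (σ : Sub m).

Lemma ctx_ok Γ G : G ∈ Γ -> ⊢c G.
Proof. intros H; exact (mem_rel H H). Qed.
Lemma ctx_eq Γ G G' : G ∈ Γ -> G' ∈ Γ -> ⊢c G ≡ G'.
Proof. apply mem_rel. Qed.

(** Conversion carries a representative to any prescribed member of the context class. Several
    arguments can thus be represented over the same raw contexts, as the raw rules demand. *)
Lemma ty_at Γ T G : TyIn Γ T -> G ∈ Γ -> exists A, (G, A) ∈ T.
Proof.
  intros (G' & A & H1 & H2) H; exists A. apply (mem_conv H2).
  split; [exact (ctx_eq H1 H) | exact (proj2 (mem_rel H2 H2))].
Qed.

Lemma sub_at Γ Δ σ G D : SubIn Γ Δ σ -> G ∈ Γ -> D ∈ Δ -> exists s, (G, D, s) ∈ σ.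
Proof.
  intros (G' & D' & s & H1 & H2 & H3) H K; exists s. apply (mem_conv H3).
  split; [exact (ctx_eq H1 H) | split; [exact (ctx_eq H2 K)|]].
  exact (proj2 (proj2 (mem_rel H3 H3))).
Qed.

Lemma tm_at Γ T t G A : TmIn Γ T t -> G ∈ Γ -> (G, A) ∈ T -> exists a, (G, A, a) ∈ t.
Proof.
  intros (G' & A' & a & H1 & H2 & H3) H K; exists a. apply (mem_conv H3).
  destruct (mem_rel H2 K) as [E1 E2].
  split; [exact E1 | split; [exact E2|]].
  exact (proj2 (proj2 (mem_rel H3 H3))).
Qed.

Lemma TmIn_TyIn Γ T t : TmIn Γ T t -> TyIn Γ T.
Proof. intros (G & A & a & H1 & H2 & H3); now exists G, A. Qed.

Lemma TyIn_intro Γ T G A : G ∈ Γ -> (G, A) ∈ T -> TyIn Γ T.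
Proof. intros; now exists G, A. Qed.
Lemma TmIn_intro Γ T t G A a : G ∈ Γ -> (G, A) ∈ T -> (G, A, a) ∈ t -> TmIn Γ T t.
Proof. intros; now exists G, A, a. Qed.
Lemma SubIn_intro Γ Δ σ G D s : G ∈ Γ -> D ∈ Δ -> (G, D, s) ∈ σ -> SubIn Γ Δ σ.
Proof. intros; now exists G, D, s. Qed.
End Reps.

Lemma ty_mem {m} (G : ctx m) A (T : Ty m) : (G, A) ∈ T -> G ⊢T large A.
Proof. intros H; exact (proj2 (mem_rel H H)). Qed.
Lemma tm_mem {m} (G : ctx m) A a (t : Tm m) : (G, A, a) ∈ t -> G ⊢t a ∶ A.
Proof. intros H; exact (proj2 (proj2 (mem_rel H H))). Qed.
Lemma sub_mem {m} (G D : ctx m) s (σ : Sub m) : (G, D, s) ∈ σ -> G ⊢s s ∶ D.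
Proof. intros H; exact (proj2 (proj2 (mem_rel H H))). Qed.
Lemma hom_refl {n m} (mu : hom n m) : mu ≈ mu.
Proof. split; apply cell_refl. Qed.
Lemma hom_rel {n m} (μ : Hom n m) mu mu' : mu ∈ μ -> mu' ∈ μ -> mu ≈ mu'.
Proof. apply mem_rel. Qed.

Lemma inst_cong n m (G : ctx m) (mu mu' : hom n m) A A' a a' :
  ⊢c G -> mu ≈ mu' -> lock G mu ⊢T large A ≡ A' -> lock G mu ⊢t a ≡ a' ∶ A ->
  G ⊢s inst mu A a ≡ inst mu' A' a' ∶ ext G mu A.
Proof.
  intros HG Hmu HA Ha.
  assert (lock G mu ⊢T large A) by (eapply eT_trans; [|apply eT_sym]; eassumption).
  apply es_ext; auto; [now apply es_id|].
  eapply et_conv; [eassumption | apply ec_lock; auto; apply hom_refl |].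
  apply eT_sym. eapply eT_trans; [eapply eT_sub; [eassumption | now apply es_lock_id]|].
  now apply eT_sub_id.
Qed.

(** * Operations on classes *)

(** Two members of one class become a judgemental equality. Together with [spec_start] below this
    reduces each [_spec] lemma to a congruence rule. *)
Ltac relate :=
  repeat match goal with
  | H1 : mem _ ?q, H2 : mem _ ?q |- _ => apply (mem_rel H1) in H2; cbn [rsub rty rtm] in H2
  end;
  repeat match goal with H : _ /\ _ |- _ =>
    lazymatch type of H with heq _ _ => fail | _ => destruct H end end.

Ltac spec_start :=
  intros; apply the_spec;
  [ repeat eexists; eassumption
  | let x := fresh "x" in let Hx := fresh "Hx" in intros x Hx;
    repeat match type of Hx with
    | ex _ => let y := fresh in destruct Hx as [y Hx]
    end;
    let E := fresh "E" in destruct Hx as [E Hx]; subst x;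
    repeat match type of Hx with
    | _ /\ _ => let y := fresh in destruct Hx as [y Hx]
    end ].

Definition h1 {m} : Hom m m := the (fun x => x = one /\ True).
Definition hc {o n m} (μ : Hom n m) (ν : Hom o n) : Hom o m :=
  the (fun x => exists mu nu, x = mu ∘ nu /\ mu ∈ μ /\ nu ∈ ν).
Definition hℓ : Hom mode_t mode_t := the (fun x => x = ell /\ True).
Definition hγ : Hom mode_t mode_s := the (fun x => x = gam /\ True).
Definition hδ : Hom mode_s mode_t := the (fun x => x = del /\ True).
Infix "·" := hc (at level 40, left associativity).

Lemma one_spec {m} : one ∈ @h1 m.
Proof. apply the_spec; [auto | intros y [-> _]; apply hom_refl]. Qed.
Lemma ell_spec : ell ∈ hℓ.
Proof. apply the_spec; [auto | intros y [-> _]; apply hom_refl]. Qed.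
Lemma gam_spec : gam ∈ hγ.
Proof. apply the_spec; [auto | intros y [-> _]; apply hom_refl]. Qed.
Lemma del_spec : del ∈ hδ.
Proof. apply the_spec; [auto | intros y [-> _]; apply hom_refl]. Qed.
Lemma hc_spec {o n m} (μ : Hom n m) (ν : Hom o n) mu nu :
  mu ∈ μ -> nu ∈ ν -> mu ∘ nu ∈ μ · ν.
Proof.
  spec_start. relate.
  split; apply cell_comp; match goal with K : _ ≈ _ |- _ => apply K end.
Qed.

Definition lk {n m} (Γ : Ctx m) (μ : Hom n m) : Ctx n :=
  the (fun x => exists G mu, x = lock G mu /\ G ∈ Γ /\ mu ∈ μ).
Lemma lk_spec {n m} (Γ : Ctx m) (μ : Hom n m) G mu :
  G ∈ Γ -> mu ∈ μ -> lock G mu ∈ lk Γ μ.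
Proof. spec_start. relate. apply ec_lock; auto. Qed.

Definition ex {n m} (Γ : Ctx m) (μ : Hom n m) (A : Ty n) : Ctx m :=
  the (fun x => exists G mu A0,
    x = ext G mu A0 /\ G ∈ Γ /\ mu ∈ μ /\ (lock G mu, A0) ∈ A).
Lemma ex_spec {n m} (Γ : Ctx m) (μ : Hom n m) A G mu A0 :
  G ∈ Γ -> mu ∈ μ -> (lock G mu, A0) ∈ A -> ext G mu A0 ∈ ex Γ μ A.
Proof. spec_start. relate. apply ec_ext; auto. Qed.

Definition ids {m} (Γ : Ctx m) : Sub m :=
  the (fun x => exists G, x = (G, G, sid) /\ G ∈ Γ).
Lemma ids_spec {m} (Γ : Ctx m) G : G ∈ Γ -> (G, G, sid) ∈ ids Γ.
Proof.
  spec_start. assert (HG := ctx_ok H). relate. repeat split; auto. now apply es_id.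
Qed.

Definition cmp {m} (τ σ : Sub m) : Sub m :=
  the (fun x => exists G D E t s,
    x = (G, E, t ⊚ s) /\ (D, E, t) ∈ τ /\ (G, D, s) ∈ σ).
Infix "•" := cmp (at level 40, left associativity).
Lemma cmp_spec {m} (τ σ : Sub m) G D E t s :
  (D, E, t) ∈ τ -> (G, D, s) ∈ σ -> (G, E, t ⊚ s) ∈ τ • σ.
Proof. spec_start. relate. repeat split; auto. eapply es_comp; eassumption. Qed.

Definition wk {n m} (Γ : Ctx m) (μ : Hom n m) (A : Ty n) : Sub m :=
  the (fun x => exists G mu A0, x = (ext G mu A0, G, swk) /\
    G ∈ Γ /\ mu ∈ μ /\ (lock G mu, A0) ∈ A).
Lemma wk_spec {n m} (Γ : Ctx m) (μ : Hom n m) A G mu A0 :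
  G ∈ Γ -> mu ∈ μ -> (lock G mu, A0) ∈ A -> (ext G mu A0, G, swk) ∈ wk Γ μ A.
Proof.
  spec_start. assert (HG := ctx_ok H). assert (HA := ty_mem H1). relate.
  repeat split; auto; [now apply ec_ext | now apply es_wk].
Qed.

Definition sx {n m} (μ : Hom n m) (σ : Sub m) (A : Ty n) (a : Tm n) : Sub m :=
  the (fun x => exists G D mu s A0 a0, x = (G, ext D mu A0, sext mu s A0 a0) /\
    mu ∈ μ /\ (G, D, s) ∈ σ /\ (lock D mu, A0) ∈ A /\
    (lock G mu, A0⟦slock mu s⟧, a0) ∈ a).
Lemma sx_spec {n m} (μ : Hom n m) σ A a G D mu s A0 a0 :
  mu ∈ μ -> (G, D, s) ∈ σ -> (lock D mu, A0) ∈ A ->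
  (lock G mu, A0⟦slock mu s⟧, a0) ∈ a ->
  (G, ext D mu A0, sext mu s A0 a0) ∈ sx μ σ A a.
Proof.
  spec_start. destruct (mem_rel H0 H0) as (K1 & K2 & K3). relate.
  repeat split; auto; [now apply ec_ext | now apply es_ext].
Qed.

Definition sl {n m} (μ : Hom n m) (σ : Sub m) : Sub n :=
  the (fun x => exists G D mu s, x = (lock G mu, lock D mu, slock mu s) /\
    mu ∈ μ /\ (G, D, s) ∈ σ).
Lemma sl_spec {n m} (μ : Hom n m) σ G D mu s :
  mu ∈ μ -> (G, D, s) ∈ σ -> (lock G mu, lock D mu, slock mu s) ∈ sl μ σ.
Proof.
  spec_start. relate. repeat split; [(apply ec_lock; assumption) .. | apply es_lock; assumption].
Qed.

Definition le {n m} (μ ν : Hom n m) : Prop :=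
  exists mu nu, mu ∈ μ /\ nu ∈ ν /\ mu ⇒ nu.
Lemma le_at {n m} (μ ν : Hom n m) mu nu : le μ ν -> mu ∈ μ -> nu ∈ ν -> mu ⇒ nu.
Proof.
  intros (mu' & nu' & H1 & H2 & H) K1 K2.
  exact (cell_trans (proj2 (hom_rel H1 K1)) (cell_trans H (proj1 (hom_rel H2 K2)))).
Qed.

Definition ky {n m} (Γ : Ctx m) (μ ν : Hom n m) : Sub n :=
  the (fun x => exists G mu nu, x = (lock G nu, lock G mu, skey G mu nu) /\
    G ∈ Γ /\ mu ∈ μ /\ nu ∈ ν).
Lemma ky_spec {n m} (Γ : Ctx m) (μ ν : Hom n m) G mu nu :
  le μ ν -> G ∈ Γ -> mu ∈ μ -> nu ∈ ν ->
  (lock G nu, lock G mu, skey G mu nu) ∈ ky Γ μ ν.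
Proof.
  spec_start. pose proof (le_at H H1 H2). relate.
  repeat split; [(apply ec_lock; assumption) .. | apply es_key; assumption].
Qed.

Definition Tsub {m} (T : Ty m) (σ : Sub m) : Ty m :=
  the (fun x => exists G D A s, x = (G, A⟦s⟧) /\ (D, A) ∈ T /\ (G, D, s) ∈ σ).
Notation "T ⌞ σ ⌟" := (Tsub T σ) (at level 8, left associativity, format "T ⌞ σ ⌟").
Lemma Tsub_spec {m} (T : Ty m) σ G D A s :
  (D, A) ∈ T -> (G, D, s) ∈ σ -> (G, A⟦s⟧) ∈ T⌞σ⌟.
Proof. spec_start. relate. split; auto. eapply eT_sub; eassumption. Qed.

Definition Msub {m} (t : Tm m) (σ : Sub m) : Tm m :=
  the (fun x => exists G D A a s,
    x = (G, A⟦s⟧, a⟪s⟫) /\ (D, A, a) ∈ t /\ (G, D, s) ∈ σ).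
Notation "t ⌜ σ ⌝" := (Msub t σ) (at level 8, left associativity, format "t ⌜ σ ⌝").
Lemma Msub_spec {m} (t : Tm m) σ G D A a s :
  (D, A, a) ∈ t -> (G, D, s) ∈ σ -> (G, A⟦s⟧, a⟪s⟫) ∈ t⌜σ⌝.
Proof.
  spec_start. relate. repeat split; auto;
    [eapply eT_sub | eapply et_sub]; eassumption.
Qed.

Definition var' {n m} (Γ : Ctx m) (μ : Hom n m) (A : Ty n) : Tm n :=
  the (fun x => exists G mu A0,
    x = (lock (ext G mu A0) mu, A0⟦slock mu swk⟧, var) /\
    G ∈ Γ /\ mu ∈ μ /\ (lock G mu, A0) ∈ A).
Lemma var_spec {n m} (Γ : Ctx m) (μ : Hom n m) A G mu A0 :
  G ∈ Γ -> mu ∈ μ -> (lock G mu, A0) ∈ A ->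
  (lock (ext G mu A0) mu, A0⟦slock mu swk⟧, var) ∈ var' Γ μ A.
Proof.
  spec_start. assert (HG := ctx_ok H). assert (HA := ty_mem H1). relate.
  repeat split.
  - apply ec_lock; [apply ec_ext|]; auto.
  - eapply eT_sub; [eassumption|]. apply es_lock; [now apply es_wk | auto].
  - now apply et_var.
Qed.

Definition TPi {n m} (Γ : Ctx m) (μ : Hom n m) (A : Ty n) (B : Ty m) : Ty m :=
  the (fun x => exists G mu A0 B0, x = (G, Pi mu A0 B0) /\
    G ∈ Γ /\ mu ∈ μ /\ (lock G mu, A0) ∈ A /\ (ext G mu A0, B0) ∈ B).
Lemma Pi_spec {n m} (Γ : Ctx m) (μ : Hom n m) A B G mu A0 B0 :
  G ∈ Γ -> mu ∈ μ -> (lock G mu, A0) ∈ A -> (ext G mu A0, B0) ∈ B ->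
  (G, Pi mu A0 B0) ∈ TPi Γ μ A B.
Proof.
  spec_start. assert (HG := ctx_ok H). relate. split; auto. now apply eT_Pi.
Qed.

Definition TSig {m} (Γ : Ctx m) (A B : Ty m) : Ty m :=
  the (fun x => exists G A0 B0, x = (G, Sig A0 B0) /\
    G ∈ Γ /\ (G, A0) ∈ A /\ (ext G one A0, B0) ∈ B).
Lemma Sig_spec {m} (Γ : Ctx m) (A B : Ty m) G A0 B0 :
  G ∈ Γ -> (G, A0) ∈ A -> (ext G one A0, B0) ∈ B -> (G, Sig A0 B0) ∈ TSig Γ A B.
Proof.
  spec_start. assert (HG := ctx_ok H). relate. split; auto. now apply eT_Sig.
Qed.

Definition TEq {m} (A : Ty m) (a b : Tm m) : Ty m :=
  the (fun x => exists G A0 a0 b0, x = (G, Eq A0 a0 b0) /\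
    (G, A0) ∈ A /\ (G, A0, a0) ∈ a /\ (G, A0, b0) ∈ b).
Lemma Eq_spec {m} (A : Ty m) a b G A0 a0 b0 :
  (G, A0) ∈ A -> (G, A0, a0) ∈ a -> (G, A0, b0) ∈ b -> (G, Eq A0 a0 b0) ∈ TEq A a b.
Proof. spec_start. relate. split; auto. now apply eT_Eq. Qed.

Definition TU {m} (Γ : Ctx m) : Ty m :=
  the (fun x => exists G, x = (G, Univ) /\ G ∈ Γ).
Lemma U_spec {m} (Γ : Ctx m) G : G ∈ Γ -> (G, Univ) ∈ TU Γ.
Proof.
  spec_start. assert (HG := ctx_ok H). relate. split; auto. now apply eT_Univ.
Qed.

Definition TEl {m} (a : Tm m) : Ty m :=
  the (fun x => exists G a0, x = (G, El a0) /\ (G, Univ, a0) ∈ a).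
Lemma El_spec {m} (a : Tm m) G a0 : (G, Univ, a0) ∈ a -> (G, El a0) ∈ TEl a.
Proof. spec_start. relate. split; auto. now apply eT_cumul, eT_El. Qed.

Definition TMod {n m} (Γ : Ctx m) (μ : Hom n m) (A : Ty n) : Ty m :=
  the (fun x => exists G mu A0, x = (G, Mod mu A0) /\
    G ∈ Γ /\ mu ∈ μ /\ (lock G mu, A0) ∈ A).
Lemma Mod_spec {n m} (Γ : Ctx m) (μ : Hom n m) A G mu A0 :
  G ∈ Γ -> mu ∈ μ -> (lock G mu, A0) ∈ A -> (G, Mod mu A0) ∈ TMod Γ μ A.
Proof.
  spec_start. assert (HG := ctx_ok H). relate. split; auto. now apply eT_Mod.
Qed.

Definition lam {n m} (Γ : Ctx m) (μ : Hom n m) (A : Ty n) (B : Ty m) (b : Tm m) : Tm m :=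
  the (fun x => exists G mu A0 B0 b0, x = (G, Pi mu A0 B0, tlam mu A0 B0 b0) /\
    G ∈ Γ /\ mu ∈ μ /\ (lock G mu, A0) ∈ A /\ (ext G mu A0, B0) ∈ B /\
    (ext G mu A0, B0, b0) ∈ b).
Lemma lam_spec {n m} (Γ : Ctx m) (μ : Hom n m) A B b G mu A0 B0 b0 :
  G ∈ Γ -> mu ∈ μ -> (lock G mu, A0) ∈ A -> (ext G mu A0, B0) ∈ B ->
  (ext G mu A0, B0, b0) ∈ b ->
  (G, Pi mu A0 B0, tlam mu A0 B0 b0) ∈ lam Γ μ A B b.
Proof.
  spec_start. assert (HG := ctx_ok H). relate. repeat split; auto;
    [now apply eT_Pi | now apply et_lam].
Qed.

Definition app' {n m} (Γ : Ctx m) (μ : Hom n m) (A : Ty n) (B : Ty m) (f : Tm m) (a : Tm n)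
  : Tm m :=
  the (fun x => exists G mu A0 B0 f0 a0,
    x = (G, B0⟦inst mu A0 a0⟧, tapp mu A0 B0 f0 a0) /\
    G ∈ Γ /\ mu ∈ μ /\ (lock G mu, A0) ∈ A /\ (ext G mu A0, B0) ∈ B /\
    (G, Pi mu A0 B0, f0) ∈ f /\ (lock G mu, A0, a0) ∈ a).
Lemma app_spec {n m} (Γ : Ctx m) (μ : Hom n m) A B f a G mu A0 B0 f0 a0 :
  G ∈ Γ -> mu ∈ μ -> (lock G mu, A0) ∈ A -> (ext G mu A0, B0) ∈ B ->
  (G, Pi mu A0 B0, f0) ∈ f -> (lock G mu, A0, a0) ∈ a ->
  (G, B0⟦inst mu A0 a0⟧, tapp mu A0 B0 f0 a0) ∈ app' Γ μ A B f a.
Proof.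
  spec_start. assert (HG := ctx_ok H). relate. repeat split; auto.
  - eapply eT_sub; [eassumption | now apply inst_cong].
  - now apply et_app.
Qed.

Definition pair' {m} (Γ : Ctx m) (A B : Ty m) (a b : Tm m) : Tm m :=
  the (fun x => exists G A0 B0 a0 b0, x = (G, Sig A0 B0, tpair A0 B0 a0 b0) /\
    G ∈ Γ /\ (G, A0) ∈ A /\ (ext G one A0, B0) ∈ B /\
    (G, A0, a0) ∈ a /\ (G, B0⟦inst one A0 a0⟧, b0) ∈ b).
Lemma pair_spec {m} (Γ : Ctx m) (A B : Ty m) a b G A0 B0 a0 b0 :
  G ∈ Γ -> (G, A0) ∈ A -> (ext G one A0, B0) ∈ B ->
  (G, A0, a0) ∈ a -> (G, B0⟦inst one A0 a0⟧, b0) ∈ b ->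
  (G, Sig A0 B0, tpair A0 B0 a0 b0) ∈ pair' Γ A B a b.
Proof.
  spec_start. assert (HG := ctx_ok H). relate. repeat split; auto;
    [now apply eT_Sig | now apply et_pair].
Qed.

Definition fst' {m} (Γ : Ctx m) (A B : Ty m) (p : Tm m) : Tm m :=
  the (fun x => exists G A0 B0 p0, x = (G, A0, tfst A0 B0 p0) /\
    G ∈ Γ /\ (G, A0) ∈ A /\ (ext G one A0, B0) ∈ B /\ (G, Sig A0 B0, p0) ∈ p).
Lemma fst_spec {m} (Γ : Ctx m) (A B : Ty m) p G A0 B0 p0 :
  G ∈ Γ -> (G, A0) ∈ A -> (ext G one A0, B0) ∈ B -> (G, Sig A0 B0, p0) ∈ p ->
  (G, A0, tfst A0 B0 p0) ∈ fst' Γ A B p.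
Proof.
  spec_start. assert (HG := ctx_ok H). relate. repeat split; auto. now apply et_fst.
Qed.

Lemma inst_one_cong m (G : ctx m) A A' a a' :
  ⊢c G -> G ⊢T large A ≡ A' -> G ⊢t a ≡ a' ∶ A ->
  G ⊢s inst one A a ≡ inst one A' a' ∶ ext G one A.
Proof.
  intros HG HA Ha. assert (E := ec_sym (ec_lock_one HG)).
  apply inst_cong; auto; [apply hom_refl | eapply eT_conv; eassumption |].
  eapply et_conv; [eassumption..|]. eapply eT_trans; [|apply eT_sym]; eassumption.
Qed.

Definition snd' {m} (Γ : Ctx m) (A B : Ty m) (p : Tm m) : Tm m :=
  the (fun x => exists G A0 B0 p0,
    x = (G, B0⟦inst one A0 (tfst A0 B0 p0)⟧, tsnd A0 B0 p0) /\
    G ∈ Γ /\ (G, A0) ∈ A /\ (ext G one A0, B0) ∈ B /\ (G, Sig A0 B0, p0) ∈ p).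
Lemma snd_spec {m} (Γ : Ctx m) (A B : Ty m) p G A0 B0 p0 :
  G ∈ Γ -> (G, A0) ∈ A -> (ext G one A0, B0) ∈ B -> (G, Sig A0 B0, p0) ∈ p ->
  (G, B0⟦inst one A0 (tfst A0 B0 p0)⟧, tsnd A0 B0 p0) ∈ snd' Γ A B p.
Proof.
  spec_start. assert (HG := ctx_ok H). relate. repeat split; auto.
  - eapply eT_sub; [eassumption|]. apply inst_one_cong; auto. now apply et_fst.
  - now apply et_snd.
Qed.

Definition refl' {m} (A : Ty m) (a : Tm m) : Tm m :=
  the (fun x => exists G A0 a0, x = (G, Eq A0 a0 a0, trefl A0 a0) /\
    (G, A0) ∈ A /\ (G, A0, a0) ∈ a).
Lemma refl_spec {m} (A : Ty m) a G A0 a0 :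
  (G, A0) ∈ A -> (G, A0, a0) ∈ a -> (G, Eq A0 a0 a0, trefl A0 a0) ∈ refl' A a.
Proof.
  spec_start. relate. repeat split; auto; [now apply eT_Eq | now apply et_refl].
Qed.

Definition mod {n m} (Γ : Ctx m) (μ : Hom n m) (A : Ty n) (a : Tm n) : Tm m :=
  the (fun x => exists G mu A0 a0, x = (G, Mod mu A0, tmod mu A0 a0) /\
    G ∈ Γ /\ mu ∈ μ /\ (lock G mu, A0) ∈ A /\ (lock G mu, A0, a0) ∈ a).
Lemma mod_spec {n m} (Γ : Ctx m) (μ : Hom n m) A a G mu A0 a0 :
  G ∈ Γ -> mu ∈ μ -> (lock G mu, A0) ∈ A -> (lock G mu, A0, a0) ∈ a ->
  (G, Mod mu A0, tmod mu A0 a0) ∈ mod Γ μ A a.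
Proof.
  spec_start. assert (HG := ctx_ok H). relate. repeat split; auto;
    [now apply eT_Mod | now apply et_mod].
Qed.

Definition let' {o n m} (Γ : Ctx m) (ν : Hom n m) (μ : Hom o n) (A : Ty o) (B : Ty m)
  (a : Tm n) (b : Tm m) : Tm m :=
  the (fun x => exists G nu mu A0 B0 a0 b0,
    x = (G, B0⟦inst nu (Mod mu A0) a0⟧, tlet nu mu A0 B0 a0 b0) /\
    G ∈ Γ /\ nu ∈ ν /\ mu ∈ μ /\ (lock (lock G nu) mu, A0) ∈ A /\
    (ext G nu (Mod mu A0), B0) ∈ B /\ (lock G nu, Mod mu A0, a0) ∈ a /\
    (ext G (nu ∘ mu) A0, B0⟦smod nu mu A0⟧, b0) ∈ b).
Lemma let_spec {o n m} (Γ : Ctx m) (ν : Hom n m) (μ : Hom o n) A B a b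
  G nu mu A0 B0 a0 b0 :
  G ∈ Γ -> nu ∈ ν -> mu ∈ μ -> (lock (lock G nu) mu, A0) ∈ A ->
  (ext G nu (Mod mu A0), B0) ∈ B -> (lock G nu, Mod mu A0, a0) ∈ a ->
  (ext G (nu ∘ mu) A0, B0⟦smod nu mu A0⟧, b0) ∈ b ->
  (G, B0⟦inst nu (Mod mu A0) a0⟧, tlet nu mu A0 B0 a0 b0) ∈ let' Γ ν μ A B a b.
Proof.
  spec_start. assert (HG := ctx_ok H). relate.
  repeat split; auto.
  - eapply eT_sub; [eassumption|]. apply inst_cong; auto.
  - now apply et_let.
Qed.

(** A class of types records only equality of large types, whereas [tcode] requires a small one.
    Products and modal types of codes are therefore formed directly on codes, where smallness comes
    from [eT_El]. *)
Definition cprod {m} (Γ : Ctx m) (a b : Tm m) : Tm m :=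
  the (fun x => exists G a0 b0, x = (G, Univ, code_prod a0 b0) /\
    G ∈ Γ /\ (G, Univ, a0) ∈ a /\ (G, Univ, b0) ∈ b).
Lemma small_wk m (G : ctx m) A b b' :
  ⊢c G -> G ⊢T large A -> G ⊢t b ≡ b' ∶ Univ ->
  ext G one A ⊢T small (El b)⟦swk⟧ ≡ (El b')⟦swk⟧.
Proof.
  intros HG HA Hb. eapply eT_sub; [apply eT_El; eassumption|].
  apply es_wk; auto. eapply eT_conv; [eassumption | now apply ec_sym, ec_lock_one].
Qed.
Lemma cprod_spec {m} (Γ : Ctx m) a b G a0 b0 :
  G ∈ Γ -> (G, Univ, a0) ∈ a -> (G, Univ, b0) ∈ b ->
  (G, Univ, code_prod a0 b0) ∈ cprod Γ a b.
Proof.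
  spec_start. assert (HG := ctx_ok H). assert (Ha := tm_mem H0). relate.
  repeat split; auto.
  apply et_code, eT_Sig; auto; [now apply eT_El|].
  apply small_wk; auto. now apply eT_cumul, eT_El.
Qed.

Definition cmod {n m} (Γ : Ctx m) (μ : Hom n m) (a : Tm n) : Tm m :=
  the (fun x => exists G mu a0, x = (G, Univ, code_mod mu a0) /\
    G ∈ Γ /\ mu ∈ μ /\ (lock G mu, Univ, a0) ∈ a).
Lemma cmod_spec {n m} (Γ : Ctx m) (μ : Hom n m) a G mu a0 :
  G ∈ Γ -> mu ∈ μ -> (lock G mu, Univ, a0) ∈ a ->
  (G, Univ, code_mod mu a0) ∈ cmod Γ μ a.
Proof.
  spec_start. assert (HG := ctx_ok H). relate. repeat split; auto; [now apply eT_Univ|].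
  apply et_code, eT_Mod; auto. now apply eT_El.
Qed.

(** * Substitutions *)

Create HintDb rep.
#[export] Hint Resolve one_spec ell_spec gam_spec del_spec hc_spec lk_spec ex_spec ids_spec cmp_spec
  wk_spec sl_spec ky_spec Tsub_spec Msub_spec var_spec Pi_spec Sig_spec Eq_spec U_spec
  El_spec Mod_spec lam_spec app_spec pair_spec fst_spec snd_spec refl_spec mod_spec
  let_spec cprod_spec cmod_spec : rep.
Create HintDb raw.
#[export] Hint Resolve ctx_ok ty_mem tm_mem sub_mem hom_refl le_at : raw.

Ltac rep := solve [eauto 12 with rep].
(** Transfer of a raw law: [pick] fixes raw contexts and 1-cells, [reps] chooses representatives of
    the typed arguments over them, and [by_rep] turns the equation of classes into the law for these
    representatives. *)
Ltac pick q := destruct (ex_mem q) as [? ?].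
Ltac reps := repeat match goal with
  | H : TyIn ?Γ _ |- _ =>
      let E := fresh in eassert (E : _ ∈ Γ) by rep;
      destruct (ty_at H E) as [? ?]; clear E H
  | H : SubIn ?Γ ?Δ _ |- _ =>
      let E := fresh in eassert (E : _ ∈ Γ) by rep;
      let F := fresh in eassert (F : _ ∈ Δ) by rep;
      destruct (sub_at H E F) as [? ?]; clear E F H
  | H : TmIn ?Γ ?T _ |- _ =>
      let E := fresh in eassert (E : _ ∈ Γ) by rep;
      let F := fresh in
      lazymatch type of E with ?G ∈ _ => eassert (F : (G, _) ∈ T) by rep end;
      destruct (tm_at H E F) as [? ?]; clear E F H
  end.
Ltac by_rep := eapply mem_eq; [rep | rep |].
Ltac raw := eauto 6 with raw.

Lemma h_assoc {p o n m} (μ : Hom n m) (ν : Hom o n) (ρ : Hom p o) :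
  μ · ν · ρ = μ · (ν · ρ).
Proof. pick μ; pick ν; pick ρ. by_rep. split; constructor. Qed.
Lemma h_1l {n m} (μ : Hom n m) : h1 · μ = μ.
Proof. pick μ. by_rep. split; constructor. Qed.
Lemma h_1r {n m} (μ : Hom n m) : μ · h1 = μ.
Proof. pick μ. by_rep. split; constructor. Qed.
Lemma h_gd : hγ · hδ = h1.
Proof. by_rep. split; constructor. Qed.
Lemma h_gl : hγ · hℓ = hγ.
Proof. by_rep. split; constructor. Qed.

Lemma le_intro {n m} (μ ν : Hom n m) mu nu : mu ∈ μ -> nu ∈ ν -> mu ⇒ nu -> le μ ν.
Proof. intros; exists mu, nu; auto. Qed.
Lemma le_refl {n m} (μ : Hom n m) : le μ μ.
Proof. pick μ. eapply le_intro; [rep | rep | constructor]. Qed.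
Lemma le_trans {n m} (μ ν ρ : Hom n m) : le μ ν -> le ν ρ -> le μ ρ.
Proof.
  intros H K. pick μ; pick ν; pick ρ. eapply le_intro; [rep | rep |].
  eapply cell_trans; [eapply (le_at H) | eapply (le_at K)]; eassumption.
Qed.
Lemma le_hc {o n m} (μ μ' : Hom n m) (ν ν' : Hom o n) :
  le μ μ' -> le ν ν' -> le (μ · ν) (μ' · ν').
Proof.
  intros H K. pick μ; pick ν; pick μ'; pick ν'. eapply le_intro; [rep | rep |].
  apply cell_comp; [eapply (le_at H) | eapply (le_at K)]; eassumption.
Qed.
Lemma le_dg : le (hδ · hγ) h1.
Proof. eapply le_intro; [rep | rep | constructor]. Qed.
Lemma le_1l : le h1 hℓ.
Proof. eapply le_intro; [rep | rep | constructor]. Qed.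

Definition to_s (n : mode) : hom n mode_s :=
  match n with mode_s => one | mode_t => gam end.

Lemma heq_trans {n m} (x y z : hom n m) : x ≈ y -> y ≈ z -> x ≈ z.
Proof. apply per_trans. Qed.

Lemma heq_comp {o n m} (mu mu' : hom n m) (nu nu' : hom o n) :
  mu ≈ mu' -> nu ≈ nu' -> mu ∘ nu ≈ mu' ∘ nu'.
Proof. intros [? ?] [? ?]; split; apply cell_comp; assumption. Qed.

(** The equation γδ = 1 absorbs [del], γℓ = γ absorbs [ell], and composites follow by induction. In
    other words, the mode s is terminal in the category of modes and 1-cells. *)
Lemma to_s_comp {n m} (mu : hom n m) : to_s m ∘ mu ≈ to_s n.
Proof.
  induction mu; cbn.
  - split; constructor.
  - eapply heq_trans; [split; [apply cell_assoc' | apply cell_assoc]|].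
    eapply heq_trans; [|eassumption].
    apply heq_comp; [assumption | apply hom_refl].
  - split; constructor.
  - split; constructor.
  - split; constructor.
Qed.

(* Makes all keys over a context of mode s, and over its locks, trivial. *)
Lemma hom_s {n} (μ ν : Hom n mode_s) : μ = ν.
Proof.
  pick μ; pick ν. by_rep. apply heq_trans with (to_s n).
  - eapply heq_trans; [|exact (to_s_comp x)]. split; constructor.
  - apply per_sym. eapply heq_trans; [|exact (to_s_comp x0)]. split; constructor.
Qed.

Lemma lk_lk {o n m} (Γ : Ctx m) (μ : Hom n m) (ν : Hom o n) :
  lk (lk Γ μ) ν = lk Γ (μ · ν).
Proof. pick μ; pick ν; pick Γ. by_rep. apply ec_lock_comp; raw. Qed.
Lemma lk_1 {m} (Γ : Ctx m) : lk Γ h1 = Γ.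
Proof. pick Γ. by_rep. apply ec_lock_one; raw. Qed.

Lemma ty_one {m} (G : ctx m) A (T : Ty m) : ⊢c G -> (G, A) ∈ T -> (lock G one, A) ∈ T.
Proof.
  intros HG H. apply (mem_conv H); split; [now apply ec_sym, ec_lock_one | raw].
Qed.
Lemma tm_one {m} (G : ctx m) A a (t : Tm m) :
  ⊢c G -> (G, A, a) ∈ t -> (lock G one, A, a) ∈ t.
Proof.
  intros HG H. apply (mem_conv H); split; [now apply ec_sym, ec_lock_one |].
  exact (proj2 (mem_rel H H)).
Qed.

Lemma tm_conv {m} (G : ctx m) A A' a (T : Ty m) (t : Tm m) :
  (G, A, a) ∈ t -> (G, A) ∈ T -> (G, A') ∈ T -> (G, A', a) ∈ t.
Proof.
  intros H K L. apply (mem_conv H). destruct (mem_rel K L). repeat split; raw.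
Qed.

(** The class operations often give the two sides of a raw law syntactically different types; a
    class [T] containing both supplies the conversion. *)
Lemma tm_eq {m} (G : ctx m) A A' a a' (T : Ty m) (t t' : Tm m) :
  (G, A, a) ∈ t -> (G, A', a') ∈ t' -> (G, A) ∈ T -> (G, A') ∈ T ->
  G ⊢t a ≡ a' ∶ A -> t = t'.
Proof.
  intros H H' K K' E. apply (mem_eq H (tm_conv H' K' K)).
  destruct (mem_rel K K). repeat split; auto.
Qed.

Lemma tm_eq_rel {m} (G : ctx m) A a a' (t : Tm m) :
  (G, A, a) ∈ t -> (G, A, a') ∈ t -> G ⊢t a ≡ a' ∶ A.
Proof. intros H K; exact (proj2 (proj2 (mem_rel H K))). Qed.

(** The rule for [sext] insists on the type [A0⟦slock mu s⟧]; here any representative of the same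
    class of types will do. *)
Lemma sx_spec' {n m} (μ : Hom n m) σ A a G D mu s A0 A1 a0 :
  mu ∈ μ -> (G, D, s) ∈ σ -> (lock D mu, A0) ∈ A ->
  (lock G mu, A1, a0) ∈ a -> (lock G mu, A1) ∈ A⌞sl μ σ⌟ ->
  (G, ext D mu A0, sext mu s A0 a0) ∈ sx μ σ A a.
Proof.
  intros Hmu Hs HA Ha HT. apply sx_spec; auto.
  apply (tm_conv Ha HT). rep.
Qed.
#[export] Hint Resolve sx_spec' : rep.

Section Substitutions.
Context {m : mode}.
Implicit Types (Γ Δ Θ : Ctx m) (σ τ υ : Sub m).

Lemma ids_in Γ : SubIn Γ Γ (ids Γ).
Proof. pick Γ. eapply SubIn_intro; rep. Qed.
Lemma cmp_in Γ Δ Θ σ τ : SubIn Γ Δ σ -> SubIn Δ Θ τ -> SubIn Γ Θ (τ • σ).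
Proof. intros. pick Γ; pick Δ; pick Θ; reps. eapply SubIn_intro; rep. Qed.
Lemma id_l Γ Δ σ : SubIn Γ Δ σ -> ids Δ • σ = σ.
Proof. intros. pick Γ; pick Δ; reps. by_rep. repeat split; raw. apply es_id_l; raw. Qed.
Lemma id_r Γ Δ σ : SubIn Γ Δ σ -> σ • ids Γ = σ.
Proof. intros. pick Γ; pick Δ; reps. by_rep. repeat split; raw. apply es_id_r; raw. Qed.
Lemma cmp_assoc Γ Δ Θ Ξ σ τ υ :
  SubIn Γ Δ σ -> SubIn Δ Θ τ -> SubIn Θ Ξ υ -> (υ • τ) • σ = υ • (τ • σ).
Proof.
  intros. pick Γ; pick Δ; pick Θ; pick Ξ; reps. by_rep. repeat split; raw.
  eapply es_assoc; raw.
Qed.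

Lemma Tsub_in Γ Δ T σ : TyIn Δ T -> SubIn Γ Δ σ -> TyIn Γ T⌞σ⌟.
Proof. intros. pick Γ; pick Δ; reps. eapply TyIn_intro; rep. Qed.
Lemma Tsub_id Γ T : TyIn Γ T -> T⌞ids Γ⌟ = T.
Proof. intros. pick Γ; reps. by_rep. repeat split; raw. apply eT_sub_id; raw. Qed.
Lemma Tsub_cmp Γ Δ Θ T σ τ :
  TyIn Θ T -> SubIn Γ Δ σ -> SubIn Δ Θ τ -> T⌞τ⌟⌞σ⌟ = T⌞τ • σ⌟.
Proof.
  intros. pick Γ; pick Δ; pick Θ; reps. by_rep. repeat split; raw.
  apply eT_sym. eapply eT_sub_comp; raw.
Qed.

Lemma Msub_in Γ Δ T t σ : TmIn Δ T t -> SubIn Γ Δ σ -> TmIn Γ T⌞σ⌟ t⌜σ⌝.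
Proof.
  intros H. pose proof (TmIn_TyIn H). intros. pick Γ; pick Δ; reps. eapply TmIn_intro; rep.
Qed.
Lemma Msub_id Γ T t : TmIn Γ T t -> t⌜ids Γ⌝ = t.
Proof.
  intros H. pose proof (TmIn_TyIn H) as K. assert (E := Tsub_id K). pick Γ; reps.
  eapply tm_eq with (T := T⌞ids Γ⌟); [rep | rep | rep | rewrite E; rep |].
  eapply et_conv with (A := x0); [apply et_sub_id; raw | raw |].
  apply eT_sym, eT_sub_id; raw.
Qed.
Lemma Msub_cmp Γ Δ Θ T t σ τ :
  TmIn Θ T t -> SubIn Γ Δ σ -> SubIn Δ Θ τ -> t⌜τ⌝⌜σ⌝ = t⌜τ • σ⌝.
Proof.
  intros H Hs Ht. pose proof (TmIn_TyIn H) as K. assert (E := Tsub_cmp K Hs Ht).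
  pick Γ; pick Δ; pick Θ; reps.
  symmetry.
  eapply tm_eq with (T := T⌞τ • σ⌟); [rep | rep | rep | rewrite <- E; rep |].
  eapply et_sub_comp; raw.
Qed.
End Substitutions.

Ltac conv_lock :=
  eapply es_conv; [| apply ec_sym, ec_lock_comp; raw | apply ec_sym, ec_lock_comp; raw].

Section Locks.
Context {n m : mode}.
Implicit Types (Γ Δ Θ : Ctx m) (σ τ υ : Sub m) (μ ν : Hom n m).

Lemma sl_in Γ Δ μ σ : SubIn Γ Δ σ -> SubIn (lk Γ μ) (lk Δ μ) (sl μ σ).
Proof. intros. pick Γ; pick Δ; pick μ; reps. eapply SubIn_intro; rep. Qed.
Lemma ky_in Γ μ ν : le μ ν -> SubIn (lk Γ ν) (lk Γ μ) (ky Γ μ ν).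
Proof. intros. pick Γ; pick μ; pick ν. eapply SubIn_intro; rep. Qed.
Lemma sl_id Γ μ : sl μ (ids Γ) = ids (lk Γ μ).
Proof.
  pick Γ; pick μ. by_rep. repeat split; try (apply ec_lock; raw). apply es_lock_id; raw.
Qed.
Lemma sl_cmp Γ Δ Θ μ σ τ :
  SubIn Γ Δ σ -> SubIn Δ Θ τ -> sl μ (τ • σ) = sl μ τ • sl μ σ.
Proof.
  intros. pick Γ; pick Δ; pick Θ; pick μ; reps. by_rep.
  repeat split; try (apply ec_lock; raw). eapply es_lock_comp; raw.
Qed.
Lemma ky_id Γ μ : ky Γ μ μ = ids (lk Γ μ).
Proof.
  assert (H := le_refl μ). pick Γ; pick μ. by_rep.
  repeat split; try (apply ec_lock; raw). apply es_key_id; raw.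
Qed.
Lemma ky_cmp Γ μ ν ρ : le μ ν -> le ν ρ -> ky Γ μ ν • ky Γ ν ρ = ky Γ μ ρ.
Proof.
  intros H K. assert (L := le_trans H K). pick Γ; pick μ; pick ν; pick ρ. by_rep.
  repeat split; try (apply ec_lock; raw). apply es_key_comp; raw.
Qed.
Lemma ky_nat Γ Δ μ ν σ :
  SubIn Γ Δ σ -> le μ ν -> ky Δ μ ν • sl ν σ = sl μ σ • ky Γ μ ν.
Proof.
  intros. pick Γ; pick Δ; pick μ; pick ν; reps. by_rep.
  repeat split; try (apply ec_lock; raw). apply es_key_nat; raw.
Qed.

Context {o : mode}.
Implicit Types (ρ : Hom o n).

Lemma sl_sl Γ Δ μ ρ σ : SubIn Γ Δ σ -> sl ρ (sl μ σ) = sl (μ · ρ) σ.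
Proof.
  intros. pick Γ; pick Δ; pick μ; pick ρ; reps. by_rep.
  repeat split; [apply ec_lock_comp; raw .. |]. conv_lock. apply es_lock_lock; raw.
Qed.
Lemma sl_ky Γ μ ν ρ : le μ ν -> sl ρ (ky Γ μ ν) = ky Γ (μ · ρ) (ν · ρ).
Proof.
  intros H. assert (K := le_hc H (le_refl ρ)).
  pick Γ; pick μ; pick ν; pick ρ. by_rep.
  repeat split; [apply ec_lock_comp; raw .. |]. conv_lock. apply es_key_whisker_r; raw.
Qed.
Lemma ky_lk Γ μ (ρ ρ' : Hom o n) :
  le ρ ρ' -> ky (lk Γ μ) ρ ρ' = ky Γ (μ · ρ) (μ · ρ').
Proof.
  intros H. assert (K := le_hc (le_refl μ) H).
  pick Γ; pick μ; pick ρ; pick ρ'. by_rep.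
  repeat split; [apply ec_lock_comp; raw .. |]. conv_lock. apply es_key_whisker_l; raw.
Qed.
End Locks.

Lemma sl_1 {m} (Γ Δ : Ctx m) σ : SubIn Γ Δ σ -> sl h1 σ = σ.
Proof.
  intros. pick Γ; pick Δ; reps. by_rep.
  repeat split; [apply ec_lock_one; raw .. |].
  eapply es_conv; [apply es_lock_one; raw | apply ec_sym, ec_lock_one; raw ..].
Qed.

Section Comprehension.
Context {n m : mode}.
Implicit Types (Γ Δ Θ : Ctx m) (σ τ υ : Sub m) (μ ν : Hom n m) (A : Ty n) (a : Tm n).

Lemma wk_in Γ μ A : TyIn (lk Γ μ) A -> SubIn (ex Γ μ A) Γ (wk Γ μ A).
Proof. intros. pick Γ; pick μ; reps. eapply SubIn_intro; rep. Qed.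
Lemma sx_in Γ Δ μ σ A a :
  SubIn Γ Δ σ -> TyIn (lk Δ μ) A -> TmIn (lk Γ μ) A⌞sl μ σ⌟ a ->
  SubIn Γ (ex Δ μ A) (sx μ σ A a).
Proof. intros. pick Γ; pick Δ; pick μ; reps. eapply SubIn_intro; rep. Qed.
Lemma wk_sx Γ Δ μ σ A a :
  SubIn Γ Δ σ -> TyIn (lk Δ μ) A -> TmIn (lk Γ μ) A⌞sl μ σ⌟ a ->
  wk Δ μ A • sx μ σ A a = σ.
Proof.
  intros. pick Γ; pick Δ; pick μ; reps. by_rep. repeat split; raw.
  apply es_wk_ext; raw.
Qed.
Lemma sx_eta Γ Δ μ σ A :
  TyIn (lk Δ μ) A -> SubIn Γ (ex Δ μ A) σ ->
  sx μ (wk Δ μ A • σ) A (var' Δ μ A)⌜sl μ σ⌝ = σ.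
Proof.
  intros H K. assert (W := wk_in H).
  assert (E := Tsub_cmp H (sl_in μ K) (sl_in μ W)). rewrite <- (sl_cmp _ K W) in E. clear W.
  pick Γ; pick Δ; pick μ; reps. symmetry.
  eapply mem_eq; [rep | eapply sx_spec'; [rep..|rewrite <- E; rep] |].
  repeat split; raw; [eapply ctx_ok; rep|]. apply es_ext_eta; raw.
Qed.
Lemma var_in Γ μ A :
  TyIn (lk Γ μ) A -> TmIn (lk (ex Γ μ A) μ) A⌞sl μ (wk Γ μ A)⌟ (var' Γ μ A).
Proof. intros. pick Γ; pick μ; reps. eapply TmIn_intro; rep. Qed.
Lemma var_sx Γ Δ μ σ A a :
  SubIn Γ Δ σ -> TyIn (lk Δ μ) A -> TmIn (lk Γ μ) A⌞sl μ σ⌟ a ->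
  (var' Δ μ A)⌜sl μ (sx μ σ A a)⌝ = a.
Proof.
  intros H K L. assert (W := wk_in K). assert (S := sx_in H K L).
  assert (E := Tsub_cmp K (sl_in μ S) (sl_in μ W)).
  rewrite <- (sl_cmp _ S W), wk_sx with (1 := H) in E by assumption. clear S W.
  pick Γ; pick Δ; pick μ; reps. symmetry.
  eapply tm_eq with (T := A⌞sl μ σ⌟); [rep | rep | rep | rewrite <- E; rep |].
  eapply et_sym, et_var_ext; raw.
Qed.
End Comprehension.

Create HintDb ty.
#[export] Hint Resolve ids_in cmp_in wk_in sx_in sl_in ky_in Tsub_in Msub_in var_in : ty.
#[export] Hint Immediate TmIn_TyIn : ty.
Ltac ty := solve [eauto 9 with ty].

Definition ins {n m} (Γ : Ctx m) (μ : Hom n m) (A : Ty n) (a : Tm n) : Sub m :=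
  sx μ (ids Γ) A a.
Definition lft {n m} (Γ : Ctx m) (μ : Hom n m) (A : Ty n) (σ : Sub m) : Sub m :=
  sx μ (σ • wk Γ μ A⌞sl μ σ⌟) A (var' Γ μ A⌞sl μ σ⌟).

Section Lift.
Context {n m : mode}.
Implicit Types (Γ Δ Θ : Ctx m) (σ τ υ : Sub m) (μ ν : Hom n m) (A : Ty n) (a : Tm n)
  (C : Ty m).

Lemma sl_id_ty Γ μ A : TyIn (lk Γ μ) A -> A⌞sl μ (ids Γ)⌟ = A.
Proof. intros. rewrite sl_id. apply Tsub_id; assumption. Qed.

Lemma ins_spec Γ μ A a G mu Ar ar :
  G ∈ Γ -> mu ∈ μ -> (lock G mu, Ar) ∈ A -> (lock G mu, Ar, ar) ∈ a ->
  (G, ext G mu Ar, inst mu Ar ar) ∈ ins Γ μ A a.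
Proof.
  intros HG Hmu HA Ha. eapply sx_spec'; [rep .. |]. rewrite sl_id_ty; [exact HA|].
  eapply TyIn_intro; rep.
Qed.

Lemma lft_ty Γ Δ μ A σ :
  SubIn Γ Δ σ -> TyIn (lk Δ μ) A ->
  A⌞sl μ (σ • wk Γ μ A⌞sl μ σ⌟)⌟ = A⌞sl μ σ⌟⌞sl μ (wk Γ μ A⌞sl μ σ⌟)⌟.
Proof.
  intros H K. erewrite sl_cmp by ty. symmetry. eapply Tsub_cmp; ty.
Qed.

Lemma lft_spec Γ Δ μ A σ G D mu Ar s :
  G ∈ Γ -> D ∈ Δ -> mu ∈ μ -> (lock D mu, Ar) ∈ A -> (G, D, s) ∈ σ ->
  (ext G mu Ar⟦slock mu s⟧, ext D mu Ar, lift mu Ar s) ∈ lft Γ μ A σ.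
Proof.
  intros. eapply sx_spec'; [rep .. |]. rewrite lft_ty with (Δ := Δ); [rep | |].
  - eapply SubIn_intro; rep.
  - eapply TyIn_intro; rep.
Qed.

Lemma ins_in Γ μ A a :
  TmIn (lk Γ μ) A a -> SubIn Γ (ex Γ μ A) (ins Γ μ A a).
Proof.
  intros H. apply sx_in; [ty | ty |]. rewrite sl_id_ty by ty. exact H.
Qed.
Lemma lft_in Γ Δ μ A σ :
  SubIn Γ Δ σ -> TyIn (lk Δ μ) A -> SubIn (ex Γ μ A⌞sl μ σ⌟) (ex Δ μ A) (lft Γ μ A σ).
Proof.
  intros. apply sx_in; [ty | ty |]. erewrite lft_ty by ty. ty.
Qed.
Lemma wk_ins Γ μ A a : TmIn (lk Γ μ) A a -> wk Γ μ A • ins Γ μ A a = ids Γ.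
Proof.
  intros H. eapply wk_sx; [ty | ty |]. rewrite sl_id_ty by ty. exact H.
Qed.
Lemma wk_lft Γ Δ μ A σ :
  SubIn Γ Δ σ -> TyIn (lk Δ μ) A -> wk Δ μ A • lft Γ μ A σ = σ • wk Γ μ A⌞sl μ σ⌟.
Proof.
  intros. eapply wk_sx; [ty | ty |]. erewrite lft_ty by ty. ty.
Qed.
Hint Resolve ins_in lft_in : ty.

Lemma sub_ext_eq Γ Δ μ A σ τ :
  SubIn Γ (ex Δ μ A) σ -> SubIn Γ (ex Δ μ A) τ -> TyIn (lk Δ μ) A ->
  wk Δ μ A • σ = wk Δ μ A • τ ->
  (var' Δ μ A)⌜sl μ σ⌝ = (var' Δ μ A)⌜sl μ τ⌝ -> σ = τ.
Proof.
  intros H K L E F. rewrite <- (sx_eta L H), <- (sx_eta L K), E, F. reflexivity.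
Qed.

Lemma wk_ty_ins Γ μ A a C :
  TyIn Γ C -> TmIn (lk Γ μ) A a -> C⌞wk Γ μ A⌟⌞ins Γ μ A a⌟ = C.
Proof.
  intros. erewrite Tsub_cmp, wk_ins by ty. apply Tsub_id; assumption.
Qed.
Lemma wk_ty_lft Γ Δ μ A σ C :
  SubIn Γ Δ σ -> TyIn (lk Δ μ) A -> TyIn Δ C ->
  C⌞wk Δ μ A⌟⌞lft Γ μ A σ⌟ = C⌞σ⌟⌞wk Γ μ A⌞sl μ σ⌟⌟.
Proof.
  intros. erewrite Tsub_cmp by ty. erewrite wk_lft by ty. symmetry. eapply Tsub_cmp; ty.
Qed.

Lemma var_ins Γ μ A a : TmIn (lk Γ μ) A a -> (var' Γ μ A)⌜sl μ (ins Γ μ A a)⌝ = a.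
Proof.
  intros H. eapply var_sx; [ty | ty |]. rewrite sl_id_ty by ty. exact H.
Qed.
Lemma var_lft Γ Δ μ A σ :
  SubIn Γ Δ σ -> TyIn (lk Δ μ) A ->
  (var' Δ μ A)⌜sl μ (lft Γ μ A σ)⌝ = var' Γ μ A⌞sl μ σ⌟.
Proof.
  intros. eapply var_sx; [ty | ty |]. erewrite lft_ty by ty. ty.
Qed.

(** This law is not among the rules: both sides have the same weakening and the same last variable,
    and by η these determine a substitution into an extended context. *)
Lemma sx_cmp Γ Δ Θ μ A σ τ a :
  SubIn Γ Δ σ -> SubIn Δ Θ τ -> TyIn (lk Θ μ) A -> TmIn (lk Δ μ) A⌞sl μ τ⌟ a ->
  sx μ τ A a • σ = sx μ (τ • σ) A a⌜sl μ σ⌝.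
Proof.
  intros H K L M.
  assert (S := sx_in K L M).
  assert (N : TmIn (lk Γ μ) A⌞sl μ (τ • σ)⌟ a⌜sl μ σ⌝).
  { erewrite sl_cmp by ty. erewrite <- Tsub_cmp by ty. ty. }
  eapply sub_ext_eq; [ty | apply sx_in; ty | ty | |].
  - erewrite <- cmp_assoc, !wk_sx by ty. reflexivity.
  - erewrite sl_cmp, <- Msub_cmp, !var_sx by ty. reflexivity.
Qed.

Lemma lft_ins Γ Δ μ A σ a :
  SubIn Γ Δ σ -> TyIn (lk Δ μ) A -> TmIn (lk Γ μ) A⌞sl μ σ⌟ a ->
  lft Γ μ A σ • ins Γ μ A⌞sl μ σ⌟ a = sx μ σ A a.
Proof.
  intros H K M. assert (N := ins_in M). unfold lft.
  erewrite sx_cmp; [| ty | ty | ty | erewrite lft_ty by ty; ty].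
  erewrite cmp_assoc, wk_ins, id_r, var_ins by ty. reflexivity.
Qed.

Lemma ins_cmp Γ Δ μ A σ a :
  SubIn Γ Δ σ -> TmIn (lk Δ μ) A a ->
  ins Δ μ A a • σ = sx μ σ A a⌜sl μ σ⌝.
Proof.
  intros H K. unfold ins. erewrite sx_cmp; [| ty | ty | ty |].
  - erewrite id_l by ty. reflexivity.
  - rewrite sl_id_ty by ty. exact K.
Qed.
End Lift.
#[export] Hint Resolve ins_in lft_in : ty.
#[export] Hint Resolve ins_spec lft_spec : rep.

Section Types.
Context {n m : mode}.
Implicit Types (Γ Δ Θ : Ctx m) (σ τ υ : Sub m) (μ ν : Hom n m) (A : Ty n) (a : Tm n)
  (B C D : Ty m).

Lemma Mod_in Γ μ A : TyIn (lk Γ μ) A -> TyIn Γ (TMod Γ μ A).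
Proof. intros. pick Γ; pick μ; reps. eapply TyIn_intro; rep. Qed.
Lemma Mod_sub Γ Δ μ A σ :
  SubIn Γ Δ σ -> TyIn (lk Δ μ) A -> (TMod Δ μ A)⌞σ⌟ = TMod Γ μ A⌞sl μ σ⌟.
Proof.
  intros. pick Γ; pick Δ; pick μ; reps. by_rep. split; raw. apply eT_Mod_sub with (D := x0); raw.
Qed.
Lemma Pi_in Γ μ A B : TyIn (lk Γ μ) A -> TyIn (ex Γ μ A) B -> TyIn Γ (TPi Γ μ A B).
Proof. intros. pick Γ; pick μ; reps. eapply TyIn_intro; rep. Qed.
Lemma Pi_sub Γ Δ μ A B σ :
  SubIn Γ Δ σ -> TyIn (lk Δ μ) A -> TyIn (ex Δ μ A) B ->
  (TPi Δ μ A B)⌞σ⌟ = TPi Γ μ A⌞sl μ σ⌟ B⌞lft Γ μ A σ⌟.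
Proof.
  intros. pick Γ; pick Δ; pick μ; reps. by_rep. split; raw. apply eT_Pi_sub with (D := x0); raw.
Qed.
Lemma Sig_in Γ B C : TyIn Γ B -> TyIn (ex Γ h1 B) C -> TyIn Γ (TSig Γ B C).
Proof.
  intros H K. assert (H' := H). rewrite <- (lk_1 Γ) in H'. pick Γ.
  assert (L := ctx_ok H0).
  destruct (ty_at H H0) as [B0 HB]. assert (HB' := ty_one L HB). clear H H'. reps.
  eapply TyIn_intro; rep.
Qed.
End Types.
#[export] Hint Resolve Mod_in Pi_in Sig_in : ty.

(** * Types, products and equality *)

(** The rules for [ext] and [Pi] at the modality [one] ask for types over [lock G one], those for
    [Sig] for types over [G]; each representative is made available over both. *)
Ltac ones := repeat match goal with
  | H : (?G, ?A) ∈ ?T |- _ =>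
      is_var G;
      lazymatch goal with _ : (lock G one, A) ∈ T |- _ => fail | _ => idtac end;
      assert ((lock G one, A) ∈ T) by (apply ty_one; [raw | assumption])
  | H : (?G, ?A, ?a) ∈ ?t |- _ =>
      is_var G;
      lazymatch goal with _ : (lock G one, A, a) ∈ t |- _ => fail | _ => idtac end;
      assert ((lock G one, A, a) ∈ t) by (apply tm_one; [raw | assumption])
  end.

Section Base.
Context {m : mode}.
Implicit Types (Γ Δ Θ : Ctx m) (σ τ υ : Sub m) (A B C T : Ty m) (a b c p t : Tm m)
  (G D : ctx m) (X Y : ty m) (x y : tm m) (s : sub m).

Lemma U_in Γ : TyIn Γ (TU Γ).
Proof. pick Γ. eapply TyIn_intro; rep. Qed.
Lemma U_sub Γ Δ σ : SubIn Γ Δ σ -> (TU Δ)⌞σ⌟ = TU Γ.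
Proof. intros. pick Γ; pick Δ; reps. by_rep. split; raw. eapply eT_Univ_sub; raw. Qed.
Lemma El_in Γ a : TmIn Γ (TU Γ) a -> TyIn Γ (TEl a).
Proof. intros. pick Γ; reps. eapply TyIn_intro; rep. Qed.
Lemma El_sub Γ Δ σ a : TmIn Δ (TU Δ) a -> SubIn Γ Δ σ -> (TEl a)⌞σ⌟ = TEl a⌜σ⌝.
Proof.
  intros H K. assert (E := U_sub K). pick Γ; pick Δ; reps.
  eapply mem_eq; [rep | apply El_spec; eapply tm_conv; [rep | rep |]; rewrite E; rep |].
  split; raw. apply eT_cumul. eapply eT_El_sub; raw.
Qed.
Lemma Eq_in Γ A a b : TmIn Γ A a -> TmIn Γ A b -> TyIn Γ (TEq A a b).
Proof.
  intros H K. assert (L := TmIn_TyIn H). pick Γ; reps. eapply TyIn_intro; rep.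
Qed.
Lemma Eq_sub Γ Δ σ A a b :
  TmIn Δ A a -> TmIn Δ A b -> SubIn Γ Δ σ -> (TEq A a b)⌞σ⌟ = TEq A⌞σ⌟ a⌜σ⌝ b⌜σ⌝.
Proof.
  intros H K. assert (L := TmIn_TyIn H). intros. pick Γ; pick Δ; reps. by_rep.
  split; raw. eapply eT_Eq_sub; raw.
Qed.
Lemma refl_in Γ A a : TmIn Γ A a -> TmIn Γ (TEq A a a) (refl' A a).
Proof.
  intros H. assert (L := TmIn_TyIn H). pick Γ; reps. eapply TmIn_intro; rep.
Qed.
Lemma reflection Γ A a b p :
  TmIn Γ A a -> TmIn Γ A b -> TmIn Γ (TEq A a b) p -> a = b.
Proof.
  intros H K. assert (L := TmIn_TyIn H). intros. pick Γ; reps.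
  eapply tm_eq with (T := A); [rep .. |]. eapply et_reflection; raw.
Qed.

Definition Prd Γ A C := TSig Γ A C⌞wk Γ h1 A⌟.
Definition Pr Γ A C a c := pair' Γ A C⌞wk Γ h1 A⌟ a c.
Definition P1 Γ A C p := fst' Γ A C⌞wk Γ h1 A⌟ p.
Definition P2 Γ A C p := snd' Γ A C⌞wk Γ h1 A⌟ p.

Lemma ty_1 Γ A : TyIn Γ A -> TyIn (lk Γ h1) A.
Proof. rewrite lk_1. auto. Qed.
Lemma tm_1 Γ A a : TmIn Γ A a -> TmIn (lk Γ h1) A a.
Proof. rewrite lk_1. auto. Qed.
Hint Extern 1 (TyIn (lk _ h1) _) => apply ty_1 : ty.
Hint Extern 1 (TmIn (lk _ h1) _ _) => apply tm_1 : ty.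

Lemma ty_ctx Γ G G' X T : (G, X) ∈ T -> G ∈ Γ -> G' ∈ Γ -> (G', X) ∈ T.
Proof. intros H K L. apply (mem_conv H). split; [exact (ctx_eq K L) | raw]. Qed.
Lemma tm_ctx Γ G G' X x t : (G, X, x) ∈ t -> G ∈ Γ -> G' ∈ Γ -> (G', X, x) ∈ t.
Proof.
  intros H K L. apply (mem_conv H). split; [exact (ctx_eq K L) |].
  exact (proj2 (mem_rel H H)).
Qed.

Lemma wk_ty_spec Γ A C G X Y :
  G ∈ Γ -> (G, X) ∈ A -> (G, Y) ∈ C -> (ext G one X, Y⟦swk⟧) ∈ C⌞wk Γ h1 A⌟.
Proof. intros. ones. rep. Qed.
Lemma wk_inst_spec Γ A C a G X Y x :
  G ∈ Γ -> (G, X) ∈ A -> (G, Y) ∈ C -> (G, X, x) ∈ a ->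
  (G, Y⟦swk⟧⟦inst one X x⟧) ∈ C.
Proof.
  intros. ones. rewrite <- (@wk_ty_ins m m Γ h1 A a C);
    [rep | eapply TyIn_intro; rep | apply tm_1; eapply TmIn_intro; rep].
Qed.
Lemma wk_inst_tm Γ A C a c G X Y x y :
  G ∈ Γ -> (G, X) ∈ A -> (G, Y) ∈ C -> (G, X, x) ∈ a -> (G, Y, y) ∈ c ->
  (G, Y⟦swk⟧⟦inst one X x⟧, y) ∈ c.
Proof. intros. eapply tm_conv; [eassumption .. | eapply wk_inst_spec; eassumption]. Qed.

Lemma Prd_spec Γ A C G X Y :
  G ∈ Γ -> (G, X) ∈ A -> (G, Y) ∈ C -> (G, prod X Y) ∈ Prd Γ A C.
Proof. intros. ones. unfold Prd, prod. rep. Qed.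
Lemma Prd_in Γ A C : TyIn Γ A -> TyIn Γ C -> TyIn Γ (Prd Γ A C).
Proof. intros. unfold Prd. ty. Qed.

Lemma Pr_spec Γ A C a c G X Y x y :
  G ∈ Γ -> (G, X) ∈ A -> (G, Y) ∈ C -> (G, X, x) ∈ a -> (G, Y, y) ∈ c ->
  (G, prod X Y, pair X Y x y) ∈ Pr Γ A C a c.
Proof.
  intros. apply pair_spec; auto; [apply wk_ty_spec; auto|].
  eapply wk_inst_tm; eassumption.
Qed.
Lemma P1_spec Γ A C p G X Y x :
  G ∈ Γ -> (G, X) ∈ A -> (G, Y) ∈ C -> (G, prod X Y, x) ∈ p ->
  (G, X, fst X Y x) ∈ P1 Γ A C p.
Proof. intros. apply fst_spec; auto. apply wk_ty_spec; auto. Qed.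
Lemma P2_spec Γ A C p G X Y x :
  G ∈ Γ -> (G, X) ∈ A -> (G, Y) ∈ C -> (G, prod X Y, x) ∈ p ->
  (G, Y, snd X Y x) ∈ P2 Γ A C p.
Proof.
  intros. eapply tm_conv; [apply snd_spec; auto; apply wk_ty_spec; auto | | eassumption].
  eapply wk_inst_spec; [eassumption .. | eapply P1_spec; eassumption].
Qed.
Hint Resolve Prd_spec Pr_spec P1_spec P2_spec : rep.

Ltac reps_ty := repeat match goal with
  | H : TmIn ?Γ ?T _ |- _ =>
    lazymatch goal with _ : TyIn Γ T |- _ => fail | _ => assert (TyIn Γ T) by exact (TmIn_TyIn H) end
  end.

Lemma Pr_in Γ A C a c :
  TmIn Γ A a -> TmIn Γ C c -> TmIn Γ (Prd Γ A C) (Pr Γ A C a c).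
Proof. intros. reps_ty. pick Γ; reps. eapply TmIn_intro; rep. Qed.
Lemma P1_in Γ A C p :
  TyIn Γ A -> TyIn Γ C -> TmIn Γ (Prd Γ A C) p -> TmIn Γ A (P1 Γ A C p).
Proof. intros. pick Γ; reps. eapply TmIn_intro; rep. Qed.
Lemma P2_in Γ A C p :
  TyIn Γ A -> TyIn Γ C -> TmIn Γ (Prd Γ A C) p -> TmIn Γ C (P2 Γ A C p).
Proof. intros. pick Γ; reps. eapply TmIn_intro; rep. Qed.

Lemma P1_Pr Γ A C a c :
  TmIn Γ A a -> TmIn Γ C c -> P1 Γ A C (Pr Γ A C a c) = a.
Proof.
  intros. reps_ty. pick Γ; reps. eapply tm_eq with (T := A); [rep .. |].
  apply et_Sig_beta1; [raw | raw | | raw |].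
  - eapply ty_mem, wk_ty_spec; eassumption.
  - eapply tm_mem, wk_inst_tm; eassumption.
Qed.
Lemma P2_Pr Γ A C a c :
  TmIn Γ A a -> TmIn Γ C c -> P2 Γ A C (Pr Γ A C a c) = c.
Proof.
  intros. reps_ty. pick Γ; reps. eapply tm_eq with (T := C); [rep .. |].
  assert (W : (x, x1⟦swk⟧⟦inst one x0 x3⟧) ∈ C) by (eapply wk_inst_spec; eassumption).
  eapply et_conv; [| eapply ctx_ok; eassumption | exact (proj2 (mem_rel W H4))].
  apply et_Sig_beta2; [raw | raw | | raw |].
  - eapply ty_mem, wk_ty_spec; eassumption.
  - eapply tm_mem, wk_inst_tm; eassumption.
Qed.
Lemma Pr_eta Γ A C p :
  TyIn Γ A -> TyIn Γ C -> TmIn Γ (Prd Γ A C) p -> Pr Γ A C (P1 Γ A C p) (P2 Γ A C p) = p.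
Proof.
  intros. pick Γ; reps. symmetry. eapply tm_eq with (T := Prd Γ A C); [rep .. |].
  apply et_Sig_eta; [raw | raw | | raw].
  eapply ty_mem, wk_ty_spec; eassumption.
Qed.

(** The natural domain of [lift one X s] is the extension by [X⟦slock one s⟧], while the rules for
    [Sig] extend by [X⟦s⟧]. The two contexts lie in one class because the lock by [one] acts
    trivially. *)
Lemma wk_lift_spec Γ Δ A C G D X Y σ s :
  G ∈ Γ -> D ∈ Δ -> (D, X) ∈ A -> (D, Y) ∈ C -> (G, D, s) ∈ σ ->
  (ext G one X⟦s⟧, Y⟦swk⟧⟦lift one X s⟧) ∈ C⌞σ⌟⌞wk Γ h1 A⌞σ⌟⌟.
Proof.
  intros. assert (S : SubIn Γ Δ σ) by (eapply SubIn_intro; rep).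
  assert (E := sl_1 S). ones.
  assert (TyIn (lk Δ h1) A) by (eapply TyIn_intro; rep).
  assert (TyIn Δ C) by (eapply TyIn_intro; rep).
  eapply ty_ctx with (Γ := ex Γ h1 A⌞sl h1 σ⌟).
  - rewrite <- E at 2. erewrite <- wk_ty_lft by eassumption. rep.
  - rep.
  - rewrite E. assert ((G, X⟦s⟧) ∈ A⌞σ⌟) by rep. ones. rep.
Qed.
Lemma Prd_sub Γ Δ A C σ :
  SubIn Γ Δ σ -> TyIn Δ A -> TyIn Δ C -> (Prd Δ A C)⌞σ⌟ = Prd Γ A⌞σ⌟ C⌞σ⌟.
Proof.
  intros. pick Γ; pick Δ; reps. eapply mem_eq.
  - rep.
  - apply Sig_spec; [eassumption | rep |]. eapply wk_lift_spec; eassumption.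
  - split; raw. apply eT_Sig_sub with (D := x0); raw. eapply ty_mem, wk_ty_spec; eassumption.
Qed.
Lemma Pr_sub Γ Δ A C σ a c :
  SubIn Γ Δ σ -> TmIn Δ A a -> TmIn Δ C c ->
  (Pr Δ A C a c)⌜σ⌝ = Pr Γ A⌞σ⌟ C⌞σ⌟ a⌜σ⌝ c⌜σ⌝.
Proof.
  intros H K L. reps_ty.
  assert (E : (Prd Δ A C)⌞σ⌟ = Prd Γ A⌞σ⌟ C⌞σ⌟) by (apply Prd_sub; ty).
  assert (F : C⌞σ⌟⌞wk Γ h1 A⌞σ⌟⌟⌞ins Γ h1 A⌞σ⌟ a⌜σ⌝⌟ = C⌞σ⌟) by (apply wk_ty_ins; ty).
  pick Γ; pick Δ; reps.
  match goal with
  | _ : (?D, ?X) ∈ A, _ : (?D, ?Y) ∈ C, _ : (?G, ?D, ?s) ∈ σ, _ : (?D, ?X, ?x) ∈ a |- _ =>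
    assert (W : (ext G one X⟦s⟧, Y⟦swk⟧⟦lift one X s⟧) ∈ C⌞σ⌟⌞wk Γ h1 A⌞σ⌟⌟)
      by (eapply wk_lift_spec; eassumption);
    assert (V : (G, Y⟦swk⟧⟦lift one X s⟧⟦inst one X⟦s⟧ x⟪s⟫⟧) ∈ C⌞σ⌟);
    [ rewrite <- F; eapply Tsub_spec; [exact W|];
      assert ((G, X⟦s⟧) ∈ A⌞σ⌟) by rep; assert ((G, X⟦s⟧, x⟪s⟫) ∈ a⌜σ⌝) by rep;
      ones; rep |]
  end.
  eapply tm_eq with (T := (Prd Δ A C)⌞σ⌟).
  - rep.
  - apply pair_spec; [eassumption | rep | exact W | rep |].
    eapply tm_conv; [rep | | exact V]. rep.
  - rep.
  - rewrite E. apply Sig_spec; [eassumption | rep | exact W].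
  - apply et_pair_sub with (D := x0); raw.
    + eapply ty_mem, wk_ty_spec; eassumption.
    + eapply tm_mem, wk_inst_tm; eassumption.
Qed.
(** Writing [p] as a pair by η reduces the claim to [Pr_sub] and β. *)
Lemma P1_sub Γ Δ A C σ p :
  SubIn Γ Δ σ -> TyIn Δ A -> TyIn Δ C -> TmIn Δ (Prd Δ A C) p ->
  (P1 Δ A C p)⌜σ⌝ = P1 Γ A⌞σ⌟ C⌞σ⌟ p⌜σ⌝.
Proof.
  intros H K L M. assert (M1 := P1_in K L M). assert (M2 := P2_in K L M).
  rewrite <- (Pr_eta K L M) at 2. erewrite Pr_sub, P1_Pr by ty. reflexivity.
Qed.
Lemma P2_sub Γ Δ A C σ p :
  SubIn Γ Δ σ -> TyIn Δ A -> TyIn Δ C -> TmIn Δ (Prd Δ A C) p ->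
  (P2 Δ A C p)⌜σ⌝ = P2 Γ A⌞σ⌟ C⌞σ⌟ p⌜σ⌝.
Proof.
  intros H K L M. assert (M1 := P1_in K L M). assert (M2 := P2_in K L M).
  rewrite <- (Pr_eta K L M) at 2. erewrite Pr_sub, P2_Pr by ty. reflexivity.
Qed.
End Base.
#[export] Hint Resolve U_in El_in Eq_in refl_in Prd_in Pr_in P1_in P2_in : ty.
#[export] Hint Extern 1 (TyIn (lk _ h1) _) => apply ty_1 : ty.
#[export] Hint Extern 1 (TmIn (lk _ h1) _ _) => apply tm_1 : ty.
#[export] Hint Resolve Prd_spec Pr_spec P1_spec P2_spec : rep.
Ltac reps_ty := repeat match goal with
  | H : TmIn ?Γ ?T _ |- _ =>
    lazymatch goal with _ : TyIn Γ T |- _ => fail | _ => assert (TyIn Γ T) by exact (TmIn_TyIn H) end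
  end.

(** * Functions and modalities *)

Section Functions.
Context {n m : mode}.
Implicit Types (Γ Δ Θ : Ctx m) (σ τ υ : Sub m) (μ ν : Hom n m) (A : Ty n) (a : Tm n)
  (C : Ty m) (b f : Tm m)
  (G D : ctx m) (mu : hom n m) (X : ty n) (Y Z : ty m) (x : tm n) (y z : tm m) (s : sub m).

Definition Arr Γ μ A C := TPi Γ μ A C⌞wk Γ μ A⌟.
Definition Lam Γ μ A C b := lam Γ μ A C⌞wk Γ μ A⌟ b.
Definition App Γ μ A C f a := app' Γ μ A C⌞wk Γ μ A⌟ f a.

Lemma App_spec Γ μ A C f a G mu X Y Z y x :
  G ∈ Γ -> mu ∈ μ -> (lock G mu, X) ∈ A -> (ext G mu X, Z) ∈ C⌞wk Γ μ A⌟ ->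
  (G, Pi mu X Z, y) ∈ f -> (lock G mu, X, x) ∈ a -> (G, Y) ∈ C ->
  (G, Y, tapp mu X Z y x) ∈ App Γ μ A C f a.
Proof.
  intros. eapply tm_conv; [apply app_spec; eassumption | | eassumption].
  rewrite <- (@wk_ty_ins n m Γ μ A a C); [rep | eapply TyIn_intro; rep | eapply TmIn_intro; rep].
Qed.

Lemma Lam_in Γ μ A C b :
  TyIn (lk Γ μ) A -> TyIn Γ C -> TmIn (ex Γ μ A) C⌞wk Γ μ A⌟ b ->
  TmIn Γ (Arr Γ μ A C) (Lam Γ μ A C b).
Proof.
  intros. pick Γ; pick μ; reps. unfold Arr, Lam. eapply TmIn_intro; rep.
Qed.
Lemma App_in Γ μ A C f a :
  TyIn Γ C -> TmIn Γ (Arr Γ μ A C) f -> TmIn (lk Γ μ) A a -> TmIn Γ C (App Γ μ A C f a).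
Proof.
  unfold Arr. intros. assert (TyIn (lk Γ μ) A) by ty.
  pick Γ; pick μ; reps. eapply TmIn_intro; [rep | eassumption |].
  eapply App_spec; rep.
Qed.

Lemma wk_lift_spec' Γ Δ μ A C G D mu X Y σ s :
  G ∈ Γ -> D ∈ Δ -> mu ∈ μ -> (lock D mu, X) ∈ A -> (D, Y) ∈ C -> (G, D, s) ∈ σ ->
  (ext G mu X⟦slock mu s⟧, Y⟦swk⟧⟦lift mu X s⟧) ∈ C⌞σ⌟⌞wk Γ μ A⌞sl μ σ⌟⌟.
Proof.
  intros. erewrite <- wk_ty_lft; [rep | eapply SubIn_intro; rep | eapply TyIn_intro; rep ..].
Qed.

Lemma Arr_sub Γ Δ μ A C σ :
  SubIn Γ Δ σ -> TyIn (lk Δ μ) A -> TyIn Δ C ->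
  (Arr Δ μ A C)⌞σ⌟ = Arr Γ μ A⌞sl μ σ⌟ C⌞σ⌟.
Proof. intros. unfold Arr. erewrite Pi_sub, wk_ty_lft by ty. reflexivity. Qed.

Lemma Lam_sub Γ Δ μ A C σ b :
  SubIn Γ Δ σ -> TyIn (lk Δ μ) A -> TyIn Δ C -> TmIn (ex Δ μ A) C⌞wk Δ μ A⌟ b ->
  (Lam Δ μ A C b)⌜σ⌝ = Lam Γ μ A⌞sl μ σ⌟ C⌞σ⌟ b⌜lft Γ μ A σ⌝.
Proof.
  intros. assert (E : (Arr Δ μ A C)⌞σ⌟ = Arr Γ μ A⌞sl μ σ⌟ C⌞σ⌟) by (apply Arr_sub; ty).
  unfold Arr in E. pick Γ; pick Δ; pick μ; reps.
  unfold Lam. eapply tm_eq with (T := (Arr Δ μ A C)⌞σ⌟).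
  - rep.
  - apply lam_spec; [eassumption .. | rep | eapply wk_lift_spec'; eassumption | rep].
  - unfold Arr. rep.
  - unfold Arr. rewrite E.
    apply Pi_spec; [eassumption .. | rep | eapply wk_lift_spec'; eassumption].
  - eapply et_lam_sub with (D := x0); raw. eapply ty_mem; rep.
Qed.

Lemma App_Lam Γ μ A C b a :
  TyIn Γ C -> TmIn (ex Γ μ A) C⌞wk Γ μ A⌟ b -> TmIn (lk Γ μ) A a ->
  App Γ μ A C (Lam Γ μ A C b) a = b⌜ins Γ μ A a⌝.
Proof.
  intros. assert (TyIn (lk Γ μ) A) by ty.
  assert (E : C⌞wk Γ μ A⌟⌞ins Γ μ A a⌟ = C) by (apply wk_ty_ins; ty).
  pick Γ; pick μ; reps. eapply tm_eq with (T := C⌞wk Γ μ A⌟⌞ins Γ μ A a⌟).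
  - unfold App, Lam. rep.
  - rep.
  - rep.
  - rep.
  - apply et_Pi_beta; raw. eapply ty_mem; rep.
Qed.

Lemma Arr_eta Γ μ A C f :
  TyIn (lk Γ μ) A -> TyIn Γ C -> TmIn Γ (Arr Γ μ A C) f ->
  Lam Γ μ A C (App (ex Γ μ A) μ A⌞sl μ (wk Γ μ A)⌟ C⌞wk Γ μ A⌟ f⌜wk Γ μ A⌝ (var' Γ μ A)) = f.
Proof.
  intros H K L.
  assert (E : (Arr Γ μ A C)⌞wk Γ μ A⌟ =
    Arr (ex Γ μ A) μ A⌞sl μ (wk Γ μ A)⌟ C⌞wk Γ μ A⌟) by (apply Arr_sub; ty).
  unfold Arr in *. symmetry. pick Γ; pick μ; reps.
  assert (W : (ext (ext x x0 x2) x0 x2⟦slock x0 swk⟧, x1⟦swk⟧⟦lift x0 x2 swk⟧)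
    ∈ C⌞wk Γ μ A⌟⌞wk (ex Γ μ A) μ A⌞sl μ (wk Γ μ A)⌟⌟) by (eapply wk_lift_spec'; rep).
  eapply tm_eq with (T := Arr Γ μ A C).
  - rep.
  - unfold Lam. eapply lam_spec; [rep | rep | rep | rep |].
    eapply App_spec; [rep | rep | rep | exact W | | rep | rep].
    eapply tm_conv; [rep | rep |]. rewrite E. rep.
  - unfold Arr; rep.
  - unfold Arr; rep.
  - apply et_Pi_eta; raw. eapply ty_mem; rep.
Qed.

(** By η the function is an abstraction; its substitution is [Lam_sub], and after β both sides are
    the same substitution instance of the body. *)
Lemma App_sub Γ Δ μ A C σ f a :
  SubIn Γ Δ σ -> TyIn Δ C -> TmIn Δ (Arr Δ μ A C) f -> TmIn (lk Δ μ) A a ->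
  (App Δ μ A C f a)⌜σ⌝ = App Γ μ A⌞sl μ σ⌟ C⌞σ⌟ f⌜σ⌝ a⌜sl μ σ⌝.
Proof.
  intros H K L M.
  assert (N : TmIn (ex Δ μ A) C⌞wk Δ μ A⌟
    (App (ex Δ μ A) μ A⌞sl μ (wk Δ μ A)⌟ C⌞wk Δ μ A⌟ f⌜wk Δ μ A⌝ (var' Δ μ A))).
  { apply App_in; [ty | | ty]. erewrite <- Arr_sub; ty. }
  rewrite <- (Arr_eta (TmIn_TyIn M) K L).
  erewrite Lam_sub by ty.
  rewrite !App_Lam; [| ty | | ty | ty | ty | ty].
  - erewrite !Msub_cmp by ty. erewrite ins_cmp, lft_ins by ty. reflexivity.
  - erewrite <- wk_ty_lft by ty. ty.
Qed.
End Functions.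
#[export] Hint Resolve Lam_in App_in : ty.

Section Modal.
Context {n m : mode}.
Implicit Types (Γ Δ Θ : Ctx m) (σ τ υ : Sub m) (μ ν : Hom n m) (A : Ty n) (a : Tm n).

Lemma mod_in Γ μ A a : TmIn (lk Γ μ) A a -> TmIn Γ (TMod Γ μ A) (mod Γ μ A a).
Proof. intros. reps_ty. pick Γ; pick μ; reps. eapply TmIn_intro; rep. Qed.
Lemma mod_sub Γ Δ μ A a σ :
  SubIn Γ Δ σ -> TmIn (lk Δ μ) A a ->
  (mod Δ μ A a)⌜σ⌝ = mod Γ μ A⌞sl μ σ⌟ a⌜sl μ σ⌝.
Proof.
  intros. reps_ty.
  assert (E : (TMod Δ μ A)⌞σ⌟ = TMod Γ μ A⌞sl μ σ⌟) by (apply Mod_sub; ty).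
  pick Γ; pick Δ; pick μ; reps. eapply tm_eq with (T := (TMod Δ μ A)⌞σ⌟);
    [rep .. | rewrite E; rep |].
  apply et_mod_sub with (D := x0); raw.
Qed.
End Modal.
#[export] Hint Resolve mod_in : ty.

Section LockReps.
Context {o n m : mode}.
Implicit Types (G : ctx m) (mu : hom o n) (nu : hom n m) (X : ty o) (T : Ty o) (t : Tm o).

Lemma ty_lk G nu mu X T :
  ⊢c G -> (lock (lock G nu) mu, X) ∈ T -> (lock G (nu ∘ mu), X) ∈ T.
Proof. intros HG H. apply (mem_conv H); split; [now apply ec_lock_comp | raw]. Qed.
Lemma ty_lk' G nu mu X T :
  ⊢c G -> (lock G (nu ∘ mu), X) ∈ T -> (lock (lock G nu) mu, X) ∈ T.
Proof. intros HG H. apply (mem_conv H); split; [now apply ec_sym, ec_lock_comp | raw]. Qed.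
Lemma tm_lk' G nu mu X x t :
  ⊢c G -> (lock G (nu ∘ mu), X, x) ∈ t -> (lock (lock G nu) mu, X, x) ∈ t.
Proof.
  intros HG H. apply (mem_conv H); split; [now apply ec_sym, ec_lock_comp |].
  exact (proj2 (mem_rel H H)).
Qed.
Lemma tm_lk G nu mu X x t :
  ⊢c G -> (lock (lock G nu) mu, X, x) ∈ t -> (lock G (nu ∘ mu), X, x) ∈ t.
Proof.
  intros HG H. apply (mem_conv H); split; [now apply ec_lock_comp |].
  exact (proj2 (mem_rel H H)).
Qed.
End LockReps.

Section Let.
Context {o n m : mode}.
Implicit Types (Γ Δ Θ : Ctx m) (σ τ υ : Sub m) (ν : Hom n m) (μ : Hom o n) (A : Ty o)
  (a : Tm o) (z : Tm n) (B C : Ty m) (b t : Tm m)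
  (G D : ctx m) (mu : hom o n) (nu : hom n m) (X : ty o) (Y Z : ty m) (s : sub m).

(** The class of [smod]. Because Γ.{ν}.{μ} and Γ.{ν∘μ} are one class, the last variable can be used
    under the two locks as it stands. *)
Definition smd Γ ν μ A :=
  sx ν (wk Γ (ν · μ) A) (TMod (lk Γ ν) μ A)
    (mod (lk (ex Γ (ν · μ) A) ν) μ A⌞sl (ν · μ) (wk Γ (ν · μ) A)⌟ (var' Γ (ν · μ) A)).

Lemma ty_lk2 Γ ν μ A : TyIn (lk Γ (ν · μ)) A -> TyIn (lk (lk Γ ν) μ) A.
Proof. rewrite lk_lk. auto. Qed.
Lemma tm_lk2 Γ ν μ A a : TmIn (lk Γ (ν · μ)) A a -> TmIn (lk (lk Γ ν) μ) A a.
Proof. rewrite lk_lk. auto. Qed.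
Hint Immediate ty_lk2 tm_lk2 : ty.

Lemma TMod_in Γ ν μ A : TyIn (lk Γ (ν · μ)) A -> TyIn (lk Γ ν) (TMod (lk Γ ν) μ A).
Proof. intros. apply Mod_in. ty. Qed.
Hint Resolve TMod_in : ty.

Lemma TMod_sub Γ Δ ν μ A σ :
  SubIn Γ Δ σ -> TyIn (lk Δ (ν · μ)) A ->
  (TMod (lk Δ ν) μ A)⌞sl ν σ⌟ = TMod (lk Γ ν) μ A⌞sl (ν · μ) σ⌟.
Proof. intros. erewrite Mod_sub, sl_sl by ty. reflexivity. Qed.

Lemma mod_lk_in Γ ν μ A a :
  TmIn (lk Γ (ν · μ)) A a -> TmIn (lk Γ ν) (TMod (lk Γ ν) μ A) (mod (lk Γ ν) μ A a).
Proof. intros. apply mod_in. ty. Qed.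
Hint Resolve mod_lk_in : ty.

Lemma smd_var_in Γ ν μ A :
  TyIn (lk Γ (ν · μ)) A ->
  TmIn (lk (ex Γ (ν · μ) A) ν) (TMod (lk Γ ν) μ A)⌞sl ν (wk Γ (ν · μ) A)⌟
    (mod (lk (ex Γ (ν · μ) A) ν) μ A⌞sl (ν · μ) (wk Γ (ν · μ) A)⌟ (var' Γ (ν · μ) A)).
Proof. intros. erewrite TMod_sub by ty. ty. Qed.
Hint Resolve smd_var_in : ty.

Lemma smd_in Γ ν μ A :
  TyIn (lk Γ (ν · μ)) A ->
  SubIn (ex Γ (ν · μ) A) (ex Γ ν (TMod (lk Γ ν) μ A)) (smd Γ ν μ A).
Proof. intros. apply sx_in; ty. Qed.
Hint Resolve smd_in : ty.

Lemma smd_spec Γ ν μ A G nu mu X :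
  G ∈ Γ -> nu ∈ ν -> mu ∈ μ -> (lock (lock G nu) mu, X) ∈ A ->
  (ext G (nu ∘ mu) X, ext G nu (Mod mu X), smod nu mu X) ∈ smd Γ ν μ A.
Proof.
  intros HG Hnu Hmu HA. assert (HA' := ty_lk (ctx_ok HG) HA).
  assert (K : TyIn (lk Γ (ν · μ)) A) by (eapply TyIn_intro; rep).
  assert (W := wk_in K).
  assert (HE : ⊢c ext G (nu ∘ mu) X) by (eapply ctx_ok; rep).
  assert (HX : (lock (lock (ext G (nu ∘ mu) X) nu) mu, X⟦slock mu (slock nu swk)⟧)
    ∈ A⌞sl (ν · μ) (wk Γ (ν · μ) A)⌟) by (erewrite <- sl_sl by exact W; rep).
  eapply sx_spec'; [rep | rep | rep | |].
  - apply mod_spec; [rep | rep | exact HX |].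
    eapply tm_conv; [apply tm_lk'; [exact HE | rep] | | exact HX].
    apply ty_lk'; [exact HE | rep].
  - erewrite TMod_sub by ty. rep.
Qed.
Hint Resolve smd_spec : rep.

Lemma let_in Γ ν μ A B z b :
  TyIn (lk Γ (ν · μ)) A -> TyIn (ex Γ ν (TMod (lk Γ ν) μ A)) B ->
  TmIn (lk Γ ν) (TMod (lk Γ ν) μ A) z -> TmIn (ex Γ (ν · μ) A) B⌞smd Γ ν μ A⌟ b ->
  TmIn Γ B⌞ins Γ ν (TMod (lk Γ ν) μ A) z⌟ (let' Γ ν μ A B z b).
Proof.
  intros HA. assert (HA' := ty_lk2 HA). intros.
  pick Γ; pick ν; pick μ; clear HA. reps.
  match goal with H : (lock (lock ?G ?nu) ?mu, ?X) ∈ A |- _ =>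
    assert (L := ty_lk (ctx_ok H2) H) end.
  reps. eapply TmIn_intro; rep.
Qed.

(* Elimination into [Eq] and reflection: the uniqueness that the missing η rule of
   modal types would give. *)
Lemma let_ext_ins Γ ν μ A B z t1 t2 :
  TyIn (lk Γ (ν · μ)) A -> TmIn (lk Γ ν) (TMod (lk Γ ν) μ A) z ->
  TmIn (ex Γ ν (TMod (lk Γ ν) μ A)) B t1 -> TmIn (ex Γ ν (TMod (lk Γ ν) μ A)) B t2 ->
  t1⌜smd Γ ν μ A⌝ = t2⌜smd Γ ν μ A⌝ ->
  t1⌜ins Γ ν (TMod (lk Γ ν) μ A) z⌝ = t2⌜ins Γ ν (TMod (lk Γ ν) μ A) z⌝.
Proof.
  intros HA Hz H1 H2 E.
  eapply (@reflection m Γ B⌞ins Γ ν (TMod (lk Γ ν) μ A) z⌟); [ty | ty |].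
  erewrite <- Eq_sub by ty. eapply let_in; [ty | ty | ty |].
  erewrite Eq_sub, <- E by ty. ty.
Qed.

Lemma wk_smd Γ ν μ A :
  TyIn (lk Γ (ν · μ)) A ->
  wk Γ ν (TMod (lk Γ ν) μ A) • smd Γ ν μ A = wk Γ (ν · μ) A.
Proof. intros. eapply wk_sx; ty. Qed.
Lemma var_smd Γ ν μ A :
  TyIn (lk Γ (ν · μ)) A ->
  (var' Γ ν (TMod (lk Γ ν) μ A))⌜sl ν (smd Γ ν μ A)⌝ =
  mod (lk (ex Γ (ν · μ) A) ν) μ A⌞sl (ν · μ) (wk Γ (ν · μ) A)⌟ (var' Γ (ν · μ) A).
Proof. intros. eapply var_sx; ty. Qed.

Lemma mod_lk_sub Γ Δ ν μ A a σ :
  SubIn Γ Δ σ -> TmIn (lk Δ (ν · μ)) A a ->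
  (mod (lk Δ ν) μ A a)⌜sl ν σ⌝ = mod (lk Γ ν) μ A⌞sl (ν · μ) σ⌟ a⌜sl (ν · μ) σ⌝.
Proof. intros. erewrite mod_sub, !sl_sl by ty. reflexivity. Qed.

Lemma smd_nat Γ Δ ν μ A σ :
  SubIn Γ Δ σ -> TyIn (lk Δ (ν · μ)) A ->
  lft Γ ν (TMod (lk Δ ν) μ A) σ • smd Γ ν μ A⌞sl (ν · μ) σ⌟ =
  smd Δ ν μ A • lft Γ (ν · μ) A σ.
Proof.
  intros H K.
  assert (F := TMod_sub H K).
  assert (L : SubIn (ex Γ ν (TMod (lk Γ ν) μ A⌞sl (ν · μ) σ⌟))
    (ex Δ ν (TMod (lk Δ ν) μ A)) (lft Γ ν (TMod (lk Δ ν) μ A) σ)).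
  { rewrite <- F. ty. }
  assert (M : TyIn (lk Γ (ν · μ)) A⌞sl (ν · μ) σ⌟) by ty.
  assert (S := smd_in M).
  assert (W := wk_in M). assert (W' := wk_in K). assert (L' := lft_in H K).
  eapply sub_ext_eq; [ty | ty | ty | |].
  - erewrite <- !cmp_assoc by ty. rewrite wk_smd by ty. erewrite !wk_lft by ty. rewrite F.
    erewrite cmp_assoc by ty. rewrite wk_smd by ty. reflexivity.
  - erewrite !sl_cmp by ty. erewrite <- !Msub_cmp by ty.
    erewrite var_lft by ty. rewrite F, !var_smd by ty.
    erewrite mod_lk_sub by ty. erewrite var_lft by ty. f_equal.
    erewrite !Tsub_cmp by ty. erewrite <- !sl_cmp by ty. erewrite wk_lft by ty. reflexivity.
Qed.

(** [let_ext_ins] compares only instances at a term [z]. The open terms are themselves such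
    instances: over the context Θ extended by the modal variable, weaken them along Θ → Γ and take
    for [z] the last variable of Θ. The hypothesis survives the weakening by [smd_nat]. *)
Lemma let_ext Γ ν μ A B t1 t2 :
  TyIn (lk Γ (ν · μ)) A ->
  TmIn (ex Γ ν (TMod (lk Γ ν) μ A)) B t1 -> TmIn (ex Γ ν (TMod (lk Γ ν) μ A)) B t2 ->
  t1⌜smd Γ ν μ A⌝ = t2⌜smd Γ ν μ A⌝ -> t1 = t2.
Proof.
  intros HA H1 H2 E.
  set (M := TMod (lk Γ ν) μ A) in *. set (Θ := ex Γ ν M) in *. set (w := wk Γ ν M).
  assert (HM : TyIn (lk Γ ν) M) by ty.
  assert (W : SubIn Θ Γ w) by (apply wk_in; exact HM).
  assert (F := TMod_sub W HA). fold M in F.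
  assert (L : SubIn (ex Θ ν M⌞sl ν w⌟) Θ (lft Θ ν M w)) by (unfold Θ at 3; ty).
  assert (V : TmIn (lk Θ ν) M⌞sl ν w⌟ (var' Γ ν M)) by (apply var_in; exact HM).
  (* Weakening and then instantiating with the last variable is the identity, by η for extended
     contexts. *)
  assert (I : lft Θ ν M w • ins Θ ν M⌞sl ν w⌟ (var' Γ ν M) = ids Θ).
  { erewrite lft_ins by ty.
    assert (I' : SubIn Θ (ex Γ ν M) (ids Θ)) by ty.
    rewrite <- (sx_eta HM I'). unfold w. erewrite id_r, sl_id, Msub_id by ty. reflexivity. }
  assert (K : forall t, TmIn Θ B t ->
    t = t⌜lft Θ ν M w⌝⌜ins Θ ν M⌞sl ν w⌟ (var' Γ ν M)⌝).
  { intros t Ht. erewrite Msub_cmp, I, Msub_id by ty. reflexivity. }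
  rewrite (K t1 H1), (K t2 H2). rewrite F in *.
  apply let_ext_ins with (B := B⌞lft Θ ν M w⌟); [ty | ty | ty | ty |].
  assert (N := smd_nat W HA). fold M in N.
  assert (SM := smd_in HA). fold M Θ in SM.
  assert (SM' := smd_in (Tsub_in HA (sl_in _ W))).
  assert (L' := lft_in W HA).
  erewrite !Msub_cmp by ty. rewrite N. erewrite <- !Msub_cmp by ty. rewrite E. reflexivity.
Qed.

Definition Let Γ ν μ A C z b :=
  let' Γ ν μ A C⌞wk Γ ν (TMod (lk Γ ν) μ A)⌟ z b.

Lemma wk_ty_smd Γ ν μ A C :
  TyIn (lk Γ (ν · μ)) A -> TyIn Γ C ->
  C⌞wk Γ ν (TMod (lk Γ ν) μ A)⌟⌞smd Γ ν μ A⌟ = C⌞wk Γ (ν · μ) A⌟.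
Proof. intros. erewrite Tsub_cmp by ty. rewrite wk_smd by ty. reflexivity. Qed.

Lemma Let_in Γ ν μ A C z b :
  TyIn (lk Γ (ν · μ)) A -> TyIn Γ C ->
  TmIn (lk Γ ν) (TMod (lk Γ ν) μ A) z -> TmIn (ex Γ (ν · μ) A) C⌞wk Γ (ν · μ) A⌟ b ->
  TmIn Γ C (Let Γ ν μ A C z b).
Proof.
  intros. rewrite <- (@wk_ty_ins n m Γ ν (TMod (lk Γ ν) μ A) z C) at 1 by ty.
  apply let_in; [ty | ty | ty |]. rewrite wk_ty_smd by ty. assumption.
Qed.

Lemma Let_spec Γ ν μ A C z b G nu mu X Y Z Z' (z' : tm n) (b' : tm m) :
  G ∈ Γ -> nu ∈ ν -> mu ∈ μ -> (lock (lock G nu) mu, X) ∈ A ->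
  (G, Y) ∈ C -> (ext G nu (Mod mu X), Z) ∈ C⌞wk Γ ν (TMod (lk Γ ν) μ A)⌟ ->
  (lock G nu, Mod mu X, z') ∈ z ->
  (ext G (nu ∘ mu) X, Z') ∈ C⌞wk Γ (ν · μ) A⌟ ->
  (ext G (nu ∘ mu) X, Z', b') ∈ b ->
  (G, Y, tlet nu mu X Z z' b') ∈ Let Γ ν μ A C z b.
Proof.
  intros HG Hnu Hmu HA HC HZ Hz HZ' Hb.
  assert (HA' := ty_lk (ctx_ok HG) HA).
  assert (K : TyIn (lk Γ (ν · μ)) A) by (eapply TyIn_intro; rep).
  assert (KC : TyIn Γ C) by (eapply TyIn_intro; rep).
  assert (M : TmIn (lk Γ ν) (TMod (lk Γ ν) μ A) z) by (eapply TmIn_intro; rep).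
  assert (W := wk_ty_smd K KC).
  assert (V := wk_ty_ins KC M).
  eapply tm_conv; [apply let_spec; try eassumption | | exact HC].
  - eapply tm_conv; [exact Hb | exact HZ' |]. rewrite <- W. rep.
  - rewrite <- V. rep.
Qed.

Lemma Let_beta Γ ν μ A C a b :
  TyIn Γ C -> TmIn (lk Γ (ν · μ)) A a -> TmIn (ex Γ (ν · μ) A) C⌞wk Γ (ν · μ) A⌟ b ->
  Let Γ ν μ A C (mod (lk Γ ν) μ A a) b = b⌜ins Γ (ν · μ) A a⌝.
Proof.
  intros HC Ha Hb. assert (HA := TmIn_TyIn Ha).
  assert (HA' := ty_lk2 HA). assert (Ha' := tm_lk2 Ha).
  assert (M := mod_lk_in Ha). assert (W := wk_ty_smd HA HC).
  assert (V := wk_ty_ins HC M). assert (U := wk_ty_ins HC Ha).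
  rewrite <- W in Hb, U. clear M Ha HA.
  pick Γ; pick ν; pick μ. reps.
  match goal with
  | H : (lock (lock ?G ?nu) ?mu, ?X) ∈ A, H' : (lock (lock ?G ?nu) ?mu, ?X, _) ∈ a,
    K : ?G ∈ Γ |- _ =>
    assert (L := ty_lk (ctx_ok K) H); assert (L' := tm_lk (ctx_ok K) H') end.
  reps.
  eapply tm_eq with (T := C); [unfold Let; rep | rep | rewrite <- V; rep | rewrite <- U; rep |].
  apply et_Mod_beta; raw. eapply ty_mem; rep.
Qed.

Lemma Let_sub Γ Δ ν μ A C σ z b :
  SubIn Γ Δ σ -> TyIn (lk Δ (ν · μ)) A -> TyIn Δ C ->
  TmIn (lk Δ ν) (TMod (lk Δ ν) μ A) z -> TmIn (ex Δ (ν · μ) A) C⌞wk Δ (ν · μ) A⌟ b ->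
  (Let Δ ν μ A C z b)⌜σ⌝ =
  Let Γ ν μ A⌞sl (ν · μ) σ⌟ C⌞σ⌟ z⌜sl ν σ⌝ b⌜lft Γ (ν · μ) A σ⌝.
Proof.
  intros Hs HA HC Hz Hb.
  assert (HA' := ty_lk2 HA). assert (W := wk_ty_smd HA HC).
  assert (F := TMod_sub Hs HA).
  assert (V := wk_ty_ins HC Hz).
  assert (W' := wk_ty_lft Hs HA HC).
  assert (SL := sl_sl ν μ Hs).
  assert (Hs' := Hs). assert (HC' := HC). assert (HA'' := Tsub_in HA (sl_in (ν · μ) Hs)).
  rewrite <- W in Hb. clear HA HC.
  pick Γ; pick Δ; pick ν; pick μ.
  destruct (sub_at Hs H H0) as [s Ks].
  destruct (ty_at HC' H0) as [Y KY].
  destruct (ty_at (G := lock (lock x0 x1) x2) HA') as [X KX]; [rep|].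
  assert (L := ty_lk (ctx_ok H0) KX).
  edestruct (@tm_at _ _ _ z (lock x0 x1) (Mod x2 X) Hz) as [z' Kz]; [rep | rep |].
  edestruct (@tm_at _ _ _ b (ext x0 (x1 ∘ x2) X) (Y⟦swk⟧⟦smod x1 x2 X⟧) Hb) as [b' Kb];
    [rep | rep |].
  set (X' := X⟦slock x2 (slock x1 s)⟧).
  assert (KX' : (lock (lock x x1) x2, X') ∈ A⌞sl (ν · μ) σ⌟).
  { unfold X'. rewrite <- SL. rep. }
  assert (L' := ty_lk (ctx_ok H) KX').
  eapply tm_eq with (T := C⌞σ⌟).
  - unfold Let. rep.
  - eapply Let_spec with (Y := Y⟦s⟧); [eassumption | eassumption | eassumption | exact KX' | rep | | | |].
    + eapply ty_ctx with (Γ := ex Γ ν (TMod (lk Γ ν) μ A⌞sl (ν · μ) σ⌟));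
        rewrite <- ?F; [eapply wk_lift_spec' with (Y := Y); rep | rep | rewrite F; rep].
    + eapply tm_conv; [rep | rep |]. rewrite F. rep.
    + eapply ty_ctx with (Γ := ex Γ (ν · μ) A⌞sl (ν · μ) σ⌟);
        [rewrite <- W', <- W; rep | rep | rep].
    + eapply tm_ctx with (Γ := ex Γ (ν · μ) A⌞sl (ν · μ) σ⌟); rep.
  - rewrite <- V. rep.
  - rep.
  - apply et_let_sub with (D := x0); raw. eapply ty_mem; rep.
Qed.
End Let.
#[export] Hint Immediate ty_lk2 tm_lk2 : ty.
#[export] Hint Resolve TMod_in mod_lk_in Let_in : ty.

(** * Codes and Löb induction *)

Section Codes.
Context {m : mode}.
Implicit Types (Γ Δ : Ctx m) (σ : Sub m) (a b : Tm m).

Lemma cprod_in Γ a b : TmIn Γ (TU Γ) a -> TmIn Γ (TU Γ) b -> TmIn Γ (TU Γ) (cprod Γ a b).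
Proof. intros. pick Γ; reps. eapply TmIn_intro; rep. Qed.

Lemma El_cprod Γ a b :
  TmIn Γ (TU Γ) a -> TmIn Γ (TU Γ) b -> TEl (cprod Γ a b) = Prd Γ (TEl a) (TEl b).
Proof.
  intros. pick Γ; reps. by_rep. split; raw.
  apply eT_cumul, eT_El_code, eT_Sig; [raw | apply eT_El; raw |].
  apply small_wk; raw. apply eT_cumul, eT_El; raw.
Qed.

(** The proof of [cprod_sub] has to stay with raw types, where smallness is visible. The facts about
    [lift] that it uses are read off from the calculation [wk_lft] with classes. *)
Lemma wk_lift_raw (G D : ctx m) s X :
  ⊢c G -> ⊢c D -> D ⊢T large X -> G ⊢s s ∶ D ->
  ext G one X⟦s⟧ ⊢s lift one X s ∶ ext D one X /\
  ext G one X⟦s⟧ ⊢s swk ⊚ lift one X s ≡ s ⊚ swk ∶ D.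
Proof.
  intros HG HD HX Hs.
  destruct (ex_class HG) as [Γ KG]. destruct (ex_class HD) as [Δ KD].
  destruct (ex_class (R := @rty m) (x := (D, X))) as [T KT]; [now split|].
  destruct (ex_class (R := @rsub m) (x := (G, D, s))) as [σ Ks]; [now split|].
  assert (Hσ : SubIn Γ Δ σ) by (eapply SubIn_intro; rep).
  assert (HT : TyIn Δ T) by (eapply TyIn_intro; rep).
  assert (E := wk_lft Hσ (ty_1 HT)).
  assert (F := sl_1 Hσ). ones.
  assert (K : (G, X⟦s⟧) ∈ T⌞σ⌟) by rep. ones.
  assert (C : ⊢c ext G one X⟦slock one s⟧ ≡ ext G one X⟦s⟧).
  { apply (@ctx_eq m (ex Γ h1 T⌞sl h1 σ⌟)); [|rewrite F]; rep. }
  assert (M : (ext G one X⟦slock one s⟧, D, swk ⊚ lift one X s) ∈ wk Δ h1 T • lft Γ h1 T σ)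
    by rep.
  rewrite E in M.
  assert (M' : (ext G one X⟦slock one s⟧, D, s ⊚ swk) ∈ σ • wk Γ h1 T⌞sl h1 σ⌟) by rep.
  destruct (mem_rel M M') as (_ & _ & R).
  assert (N : (ext G one X⟦slock one s⟧, ext D one X, lift one X s) ∈ lft Γ h1 T σ) by rep.
  destruct (mem_rel N N) as (_ & N1 & N2).
  split; [eapply es_conv; [exact N2 | exact C | exact N1] |].
  eapply es_conv; [exact R | exact C | exact HD].
Qed.

Lemma cprod_sub Γ Δ σ a b :
  SubIn Γ Δ σ -> TmIn Δ (TU Δ) a -> TmIn Δ (TU Δ) b ->
  (cprod Δ a b)⌜σ⌝ = cprod Γ a⌜σ⌝ b⌜σ⌝.
Proof.
  intros H K L. assert (E := U_sub H). pick Γ; pick Δ; reps.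
  match goal with
  | KG : ?G ∈ Γ, KD : ?D ∈ Δ, Ks : (?G, ?D, ?s) ∈ σ, Ka : (?D, Univ, ?x) ∈ a,
    Kb : (?D, Univ, ?y) ∈ b |- _ =>
    assert (HD := ctx_ok KD); assert (HG := ctx_ok KG); assert (Hs := sub_mem Ks);
    assert (Ha := tm_mem Ka); assert (Hb := tm_mem Kb);
    assert (Na : (G, Univ, x⟪s⟫) ∈ a⌜σ⌝) by (eapply tm_conv; [rep | rep | rewrite E; rep]);
    assert (Nb : (G, Univ, y⟪s⟫) ∈ b⌜σ⌝) by (eapply tm_conv; [rep | rep | rewrite E; rep]);
    assert (HX : D ⊢T small El x) by (apply eT_El; raw);
    assert (HXl := eT_cumul HX);
    assert (HXs : G ⊢T small (El x)⟦s⟧ ≡ El x⟪s⟫) by (eapply eT_El_sub; raw);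
    assert (HXw : ext G one (El x)⟦s⟧ ⊢s swk ∶ G)
      by (apply es_wk; [raw|];
          eapply eT_conv; [apply eT_cumul; eapply eT_sub; raw | now apply ec_sym, ec_lock_one]);
    assert (HDw : ext D one (El x) ⊢s swk ∶ D)
      by (apply es_wk; [raw|]; eapply eT_conv; [apply eT_cumul; raw | now apply ec_sym, ec_lock_one]);
    destruct (wk_lift_raw HG HD (eT_cumul HX) Hs) as [HL HW]
  end.
  eapply tm_eq with (T := (TU Δ)⌞σ⌟); [rep | rep | rep | rewrite E; rep |].
  eapply et_conv with (A := Univ); [| raw | apply eT_sym; eapply eT_Univ_sub; raw].
  eapply et_trans; [eapply et_code_sub; [|raw] |].
  - apply eT_Sig; [raw | raw |]. apply small_wk; raw.
  - apply et_code. eapply eT_trans; [eapply eT_Sig_sub with (D := x0); [raw | raw | apply small_wk; raw | raw] |].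
    apply eT_Sig; [raw | raw |].
    eapply eT_trans; [apply eT_sym; eapply eT_sub_comp; [apply eT_El; raw | exact HL | exact HDw]|].
    eapply eT_trans; [eapply eT_sub; [apply eT_El; raw | exact HW]|].
    eapply eT_trans; [eapply eT_sub_comp; [apply eT_El; raw | exact HXw | raw]|].
    eapply eT_sub; [eapply eT_El_sub; raw | exact HXw].
Qed.

Context {n : mode}.
Implicit Types (μ : Hom n m) (c : Tm n).

Lemma cmod_in Γ μ c : TmIn (lk Γ μ) (TU (lk Γ μ)) c -> TmIn Γ (TU Γ) (cmod Γ μ c).
Proof. intros. pick Γ; pick μ; reps. eapply TmIn_intro; rep. Qed.
Lemma El_cmod Γ μ c :
  TmIn (lk Γ μ) (TU (lk Γ μ)) c -> TEl (cmod Γ μ c) = TMod Γ μ (TEl c).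
Proof.
  intros. pick Γ; pick μ; reps. by_rep. split; raw.
  apply eT_cumul, eT_El_code, eT_Mod; [raw | raw | apply eT_El; raw].
Qed.
Lemma cmod_sub Γ Δ μ σ c :
  SubIn Γ Δ σ -> TmIn (lk Δ μ) (TU (lk Δ μ)) c ->
  (cmod Δ μ c)⌜σ⌝ = cmod Γ μ c⌜sl μ σ⌝.
Proof.
  intros H K. assert (E := U_sub H). assert (F := U_sub (sl_in μ H)).
  pick Γ; pick Δ; pick μ; reps.
  match goal with
  | KG : ?G ∈ Γ, KD : ?D ∈ Δ, Km : ?mu ∈ μ, Ks : (?G, ?D, ?s) ∈ σ,
    Kc : (lock ?D ?mu, Univ, ?x) ∈ c |- _ =>
    assert (HD := ctx_ok KD); assert (HG := ctx_ok KG); assert (Hs := sub_mem Ks);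
    assert (Hc := tm_mem Kc);
    assert (Nc : (lock G mu, Univ, x⟪slock mu s⟫) ∈ c⌜sl μ σ⌝)
      by (eapply tm_conv; [rep | rep | rewrite F; rep]);
    assert (HL : lock G mu ⊢s slock mu s ∶ lock D mu) by (apply es_lock; raw)
  end.
  eapply tm_eq with (T := (TU Δ)⌞σ⌟); [rep | rep | rep | rewrite E; rep |].
  eapply et_conv with (A := Univ); [| raw | apply eT_sym; eapply eT_Univ_sub; raw].
  eapply et_trans; [eapply et_code_sub; [|raw] |].
  - apply eT_Mod; [raw | raw | apply eT_El; raw].
  - apply et_code. eapply eT_trans; [eapply eT_Mod_sub with (D := x0); [raw | apply eT_El; raw | raw] |].
    apply eT_Mod; [raw | raw |]. eapply eT_El_sub; raw.
Qed.
End Codes.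
#[export] Hint Resolve cprod_in cmod_in : ty.

Section Loeb.
Implicit Types (Γ Δ : Ctx mode_t) (σ : Sub mode_t) (T : Ty mode_t) (x y φ : Tm mode_t)
  (G : ctx mode_t) (X : ty mode_t) (r f : tm mode_t).

Definition Later Γ T := TMod Γ hℓ T⌞ky Γ h1 hℓ⌟.
Definition Next Γ T x := mod Γ hℓ T⌞ky Γ h1 hℓ⌟ x⌜ky Γ h1 hℓ⌝.

Lemma ky_1l Γ : SubIn (lk Γ hℓ) Γ (ky Γ h1 hℓ).
Proof. rewrite <- (lk_1 Γ) at 2. apply ky_in, le_1l. Qed.
Hint Resolve ky_1l : ty.

Lemma Later_in Γ T : TyIn Γ T -> TyIn Γ (Later Γ T).
Proof. intros. unfold Later. ty. Qed.
Lemma Next_in Γ T x : TmIn Γ T x -> TmIn Γ (Later Γ T) (Next Γ T x).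
Proof. intros. unfold Later, Next. ty. Qed.
Hint Resolve Later_in Next_in : ty.

Lemma ky_nat1 Γ Δ σ : SubIn Γ Δ σ -> ky Δ h1 hℓ • sl hℓ σ = σ • ky Γ h1 hℓ.
Proof. intros H. erewrite ky_nat, sl_1; [reflexivity | exact H | exact H | apply le_1l]. Qed.

Lemma Later_sub Γ Δ T σ : SubIn Γ Δ σ -> TyIn Δ T -> (Later Δ T)⌞σ⌟ = Later Γ T⌞σ⌟.
Proof.
  intros. unfold Later. erewrite Mod_sub by ty. erewrite !Tsub_cmp by ty.
  erewrite ky_nat1 by ty. reflexivity.
Qed.

Lemma later_spec Γ T G X : G ∈ Γ -> (G, X) ∈ T -> (G, later G X) ∈ Later Γ T.
Proof.
  intros. assert (L := le_1l). ones. apply Mod_spec; rep.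
Qed.

(** The raw [next] eliminates [mod_1(x)], whereas [Next] is its β-reduct. The equation [F] below
    undoes the β-step, after which [Let_spec] exhibits the raw term. *)
Lemma next_spec Γ T x G X r :
  G ∈ Γ -> (G, X) ∈ T -> (G, X, r) ∈ x -> (G, later G X, next G X r) ∈ Next Γ T x.
Proof.
  intros HG HT Hx.
  assert (O := h_1l (@h1 mode_t)).
  assert (KT : TyIn Γ T) by (eapply TyIn_intro; rep).
  assert (Kx : TmIn Γ T x) by (eapply TmIn_intro; rep).
  assert (HT1 := ty_one (ctx_ok HG) HT). assert (Hx1 := tm_one (ctx_ok HG) Hx).
  assert (HT2 := ty_one (ctx_ok (lk_spec HG one_spec)) HT1).
  assert (Hx2 := tm_one (ctx_ok (lk_spec HG one_spec)) Hx1).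
  assert (HT3 := ty_lk (ctx_ok HG) HT2).
  assert (O1 : one ∘ one ∈ @h1 mode_t) by (rewrite <- O; rep).
  set (Γ1 := ex Γ h1 T). set (w := wk Γ h1 T).
  assert (W : SubIn Γ1 Γ w) by (apply wk_in; rewrite lk_1; exact KT).
  assert (E : T⌞ky Γ h1 hℓ⌟⌞sl hℓ w⌟ = T⌞w⌟⌞ky Γ1 h1 hℓ⌟).
  { erewrite !Tsub_cmp, ky_nat1 by ty. reflexivity. }
  assert (V : TmIn Γ1 T⌞w⌟ (var' Γ h1 T)).
  { assert (V := var_in (ty_1 KT)). fold Γ1 w in V. rewrite lk_1, (sl_1 W) in V. exact V. }
  assert (F : Next Γ T x = Let Γ h1 h1 T (Later Γ T) (mod (lk Γ h1) h1 T x)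
    (mod Γ1 hℓ T⌞ky Γ h1 hℓ⌟⌞sl hℓ w⌟ (var' Γ h1 T)⌜ky Γ1 h1 hℓ⌝)).
  { rewrite E.
    assert (I := ins_in (tm_1 Kx)). fold Γ1 in I.
    assert (J : w • ins Γ h1 T x = ids Γ) by (apply wk_ins, tm_1; exact Kx).
    assert (N : (var' Γ h1 T)⌜ins Γ h1 T x⌝ = x).
    { rewrite <- (sl_1 I). apply var_ins, tm_1. exact Kx. }
    assert (P : TmIn Γ1 (Later Γ T)⌞w⌟
      (mod Γ1 hℓ T⌞w⌟⌞ky Γ1 h1 hℓ⌟ (var' Γ h1 T)⌜ky Γ1 h1 hℓ⌝)).
    { erewrite Later_sub by ty. unfold Later. ty. }
    rewrite Let_beta; rewrite ?O; [ | ty | ty | exact P].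
    erewrite mod_sub by ty. unfold Next. rewrite <- E. f_equal.
    - erewrite Tsub_cmp by ty. erewrite <- sl_cmp by ty. rewrite J, sl_id.
      symmetry; eapply Tsub_id; ty.
    - erewrite Msub_cmp by ty. erewrite ky_nat1 by ty. erewrite <- Msub_cmp by ty.
      rewrite N. reflexivity. }
  rewrite F. assert (L := le_1l).
  assert (HX := ctx_ok (ex_spec HG O1 HT3)).
  assert (K1 : (ext G (one ∘ one) X) ∈ Γ1) by (unfold Γ1; rep).
  assert (K2 : (lock (ext G (one ∘ one) X) ell, X⟦skey G one ell⟧⟦slock ell swk⟧)
    ∈ T⌞ky Γ h1 hℓ⌟⌞sl hℓ w⌟) by (unfold w; rep).
  assert (K4 : (lock (ext G (one ∘ one) X) one, X⟦slock (one ∘ one) swk⟧, var)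
    ∈ var' Γ h1 T).
  { eapply tm_ctx with (Γ := lk Γ1 h1); rep. }
  assert (K5 : (lock (ext G (one ∘ one) X) ell,
      X⟦slock (one ∘ one) swk⟧⟦skey (ext G (one ∘ one) X) one ell⟧) ∈
      T⌞ky Γ h1 hℓ⌟⌞sl hℓ w⌟).
  { rewrite E, <- (sl_1 W). eapply Tsub_spec; [|rep].
    eapply ty_ctx with (Γ := lk Γ1 h1); [unfold w; rep | rep | rep]. }
  eapply Let_spec with (Z' := (later G X)⟦swk⟧).
  - exact HG.
  - apply one_spec.
  - apply one_spec.
  - exact HT2.
  - apply later_spec; assumption.
  - eapply Tsub_spec; [apply later_spec; eassumption | rep].
  - eapply mod_spec; rep.
  - rewrite O. eapply Tsub_spec; [apply later_spec; eassumption | rep].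
  - eapply tm_conv with (T := (Later Γ T)⌞w⌟).
    + eapply mod_spec; [exact K1 | apply ell_spec | exact K2 |].
      eapply tm_conv; [eapply Msub_spec; [exact K4 | rep] | exact K5 | exact K2].
    + unfold Later. erewrite Mod_sub by ty. rep.
    + eapply Tsub_spec; [apply later_spec; eassumption | unfold w; rep].
Qed.

(** All that is kept of [tloeb] is a class containing the raw term and the equation satisfied by
    this class; by [loeb_unique] the equation determines it. *)
Lemma loeb_spec Γ T φ G X f :
  G ∈ Γ -> (G, X) ∈ T -> (G, arr (later G X) X, f) ∈ φ ->
  exists x, (G, X, tloeb X f) ∈ x /\ x = App Γ h1 (Later Γ T) T φ (Next Γ T x).
Proof.
  intros HG HT Hf. assert (HL := later_spec HG HT).
  assert (HGr := ctx_ok HG). assert (HTr := ty_mem HT). assert (Hfr := tm_mem Hf).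
  assert (Hx : G ⊢t tloeb X f ∶ X) by (apply et_loeb; assumption).
  destruct (ex_class (R := @rtm mode_t) (x := (G, X, tloeb X f))) as [x Kx]; [now split|].
  exists x. split; [exact Kx|].
  eapply tm_eq with (T := T); [exact Kx | | exact HT | exact HT |].
  - eapply App_spec with (mu := one) (Z := X⟦swk⟧);
      [exact HG | rep | apply ty_one; eassumption | | exact Hf | | exact HT].
    + eapply wk_ty_spec; eassumption.
    + apply tm_one; [exact HGr | apply next_spec; eassumption].
  - apply et_loeb_unfold; assumption.
Qed.

Lemma loeb_ex Γ T φ :
  TyIn Γ T -> TmIn Γ (Arr Γ h1 (Later Γ T) T) φ ->
  exists x, TmIn Γ T x /\ x = App Γ h1 (Later Γ T) T φ (Next Γ T x).
Proof.
  intros HT Hφ. pick Γ. destruct (ty_at HT H) as [X HX].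
  assert (HL := later_spec H HX). assert (HL' := ty_one (ctx_ok H) HL).
  assert (HA : (x, arr (later x X) X) ∈ Arr Γ h1 (Later Γ T) T) by (unfold Arr, arr; rep).
  destruct (tm_at Hφ H HA) as [f Hf].
  destruct (loeb_spec H HX Hf) as (y & Hy & E). exists y; split; [|exact E].
  eapply TmIn_intro; eassumption.
Qed.

(* Löb induction at [Eq T x y]. *)
Lemma loeb_unique Γ T φ x y :
  TyIn Γ T -> TmIn Γ (Arr Γ h1 (Later Γ T) T) φ -> TmIn Γ T x -> TmIn Γ T y ->
  x = App Γ h1 (Later Γ T) T φ (Next Γ T x) ->
  y = App Γ h1 (Later Γ T) T φ (Next Γ T y) -> x = y.
Proof.
  intros HT Hφ Hx Hy Ex Ey.
  set (Q := TEq T x y). assert (HQ : TyIn Γ Q) by (apply Eq_in; assumption).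
  assert (HL := Later_in HQ).
  set (Θ := ex Γ h1 (Later Γ Q)). set (w := wk Γ h1 (Later Γ Q)).
  assert (W : SubIn Θ Γ w) by (apply wk_in; rewrite lk_1; exact HL).
  (* By [let_ext] the hypothesis of type ▷ Q may be taken to be [mod_ℓ] of a proof of Q. That proof
     lives under the lock ℓ, where reflection gives x = y; this is all that [Next] sees of its
     argument. *)
  assert (N : (Next Γ T x)⌜w⌝ = (Next Γ T y)⌜w⌝).
  { assert (HQ1 : TyIn (lk Γ (h1 · hℓ)) Q⌞ky Γ h1 hℓ⌟) by (rewrite h_1l; ty).
    assert (L := fun B => @let_ext _ _ _ Γ h1 hℓ Q⌞ky Γ h1 hℓ⌟ B
      (Next Γ T x)⌜w⌝ (Next Γ T y)⌜w⌝ HQ1).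
    assert (K := wk_smd HQ1). assert (S := smd_in HQ1).
    assert (WW := wk_in HQ1). assert (VV := var_in HQ1).
    rewrite lk_1 in L, K, S. rewrite h_1l in K, S, WW, VV. fold (Later Γ Q) in L, K, S.
    fold Θ in L, K, S. fold w in K.
    set (Θ2 := ex Γ hℓ Q⌞ky Γ h1 hℓ⌟) in *. set (w2 := wk Γ hℓ Q⌞ky Γ h1 hℓ⌟) in *.
    apply L with (B := (Later Γ T)⌞w⌟); [ty | ty |].
    erewrite !Msub_cmp by ty. rewrite K. unfold Next. erewrite !mod_sub by ty. f_equal.
    eapply (@reflection mode_t (lk Θ2 hℓ) T⌞ky Γ h1 hℓ⌟⌞sl hℓ w2⌟); [ty | ty |].
    erewrite <- !Eq_sub by ty. exact VV. }
  (* After one unfolding, x and y occur only below [Next]. *)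
  assert (E : x⌜w⌝ = y⌜w⌝).
  { rewrite Ex, Ey. erewrite !App_sub by ty. rewrite (sl_1 W), N. reflexivity. }
  destruct (@loeb_ex Γ Q (Lam Γ h1 (Later Γ Q) Q (refl' T⌞w⌟ x⌜w⌝))) as (p & Hp & _).
  - exact HQ.
  - apply Lam_in; [ty | ty |]. fold Θ w. unfold Q. erewrite Eq_sub by ty.
    rewrite <- E. ty.
  - eapply reflection; eassumption.
Qed.
End Loeb.
#[export] Hint Resolve ky_1l Later_in Next_in : ty.

(** * Families natural in the context *)

(* A family natural in the context stands for a term with a bound variable, which
   [generic] recovers. *)
Definition family n m := Ctx m -> Sub m -> Tm n -> Tm m.

Section Families.
Context {n m : mode}.
Implicit Types (Γ Δ Θ : Ctx m) (σ τ υ ρ : Sub m) (μ ν : Hom n m) (A : Ty n) (a : Tm n)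
  (C : Ty m) (b f : Tm m) (t : family n m).

Definition fam Γ μ A C t : Prop :=
  forall Δ τ a, SubIn Δ Γ τ -> TmIn (lk Δ μ) A⌞sl μ τ⌟ a ->
    TmIn Δ C⌞τ⌟ (t Δ τ a) /\
    forall Θ ρ, SubIn Θ Δ ρ -> (t Δ τ a)⌜ρ⌝ = t Θ (τ • ρ) a⌜sl μ ρ⌝.

Lemma fam_in Γ μ A C t Δ τ a :
  fam Γ μ A C t -> SubIn Δ Γ τ -> TmIn (lk Δ μ) A⌞sl μ τ⌟ a -> TmIn Δ C⌞τ⌟ (t Δ τ a).
Proof. intros H K L; exact (proj1 (H _ _ _ K L)). Qed.
Lemma fam_sub Γ μ A C t Δ Θ τ ρ a :
  fam Γ μ A C t -> SubIn Δ Γ τ -> TmIn (lk Δ μ) A⌞sl μ τ⌟ a -> SubIn Θ Δ ρ ->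
  (t Δ τ a)⌜ρ⌝ = t Θ (τ • ρ) a⌜sl μ ρ⌝.
Proof. intros H K L; exact (proj2 (H _ _ _ K L) Θ ρ). Qed.

Definition generic Γ μ A t : Tm m := t (ex Γ μ A) (wk Γ μ A) (var' Γ μ A).

Lemma generic_in Γ μ A C t :
  TyIn (lk Γ μ) A -> fam Γ μ A C t -> TmIn (ex Γ μ A) C⌞wk Γ μ A⌟ (generic Γ μ A t).
Proof. intros K H. eapply fam_in; [exact H | ty | ty]. Qed.

Lemma generic_sub Γ μ A C t Δ ρ :
  TyIn (lk Γ μ) A -> fam Γ μ A C t -> SubIn Δ (ex Γ μ A) ρ ->
  (generic Γ μ A t)⌜ρ⌝ = t Δ (wk Γ μ A • ρ) (var' Γ μ A)⌜sl μ ρ⌝.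
Proof. intros K H L. eapply fam_sub; [exact H | ty | ty | exact L]. Qed.

Lemma fam_restrict Γ μ A C t Δ τ :
  TyIn (lk Γ μ) A -> TyIn Γ C -> fam Γ μ A C t -> SubIn Δ Γ τ ->
  fam Δ μ A⌞sl μ τ⌟ C⌞τ⌟ (fun Θ ρ => t Θ (τ • ρ)).
Proof.
  intros HA HC H K Θ ρ a L M.
  erewrite Tsub_cmp in M by ty. erewrite <- sl_cmp in M by ty.
  split.
  - erewrite Tsub_cmp by ty. eapply fam_in; [exact H | ty | exact M].
  - intros Ξ υ N. erewrite fam_sub; [| exact H | ty | exact M | exact N].
    erewrite cmp_assoc by ty. reflexivity.
Qed.

Definition hlam Γ μ A C t := Lam Γ μ A C (generic Γ μ A t).

Lemma hlam_in Γ μ A C t :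
  TyIn (lk Γ μ) A -> TyIn Γ C -> fam Γ μ A C t -> TmIn Γ (Arr Γ μ A C) (hlam Γ μ A C t).
Proof. intros. apply Lam_in; [ty | ty | apply generic_in; assumption]. Qed.

Lemma hlam_app Γ μ A C t Δ τ a :
  TyIn (lk Γ μ) A -> TyIn Γ C -> fam Γ μ A C t -> SubIn Δ Γ τ ->
  TmIn (lk Δ μ) A⌞sl μ τ⌟ a ->
  App Δ μ A⌞sl μ τ⌟ C⌞τ⌟ (hlam Γ μ A C t)⌜τ⌝ a = t Δ τ a.
Proof.
  intros HA HC H K L. assert (M := generic_in HA H).
  unfold hlam. erewrite Lam_sub by ty.
  rewrite App_Lam; [| ty | | exact L].
  - erewrite Msub_cmp by ty. erewrite lft_ins by ty.
    erewrite generic_sub; [| exact HA | exact H | ty].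
    erewrite wk_sx, var_sx by ty. reflexivity.
  - erewrite <- wk_ty_lft by ty. ty.
Qed.

Lemma hlam_sub Γ μ A C t Δ τ :
  TyIn (lk Γ μ) A -> TyIn Γ C -> fam Γ μ A C t -> SubIn Δ Γ τ ->
  (hlam Γ μ A C t)⌜τ⌝ = hlam Δ μ A⌞sl μ τ⌟ C⌞τ⌟ (fun Θ ρ => t Θ (τ • ρ)).
Proof.
  intros HA HC H K. assert (M := generic_in HA H).
  unfold hlam. erewrite Lam_sub by ty. f_equal.
  erewrite generic_sub; [| exact HA | exact H | ty].
  erewrite wk_lft, var_lft by ty. reflexivity.
Qed.

(** By η it is enough to compare at the generic variable, one of the stages quantified over. *)
Lemma App_ext Γ μ A C f f' :
  TyIn (lk Γ μ) A -> TyIn Γ C -> TmIn Γ (Arr Γ μ A C) f -> TmIn Γ (Arr Γ μ A C) f' ->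
  (forall Δ τ a, SubIn Δ Γ τ -> TmIn (lk Δ μ) A⌞sl μ τ⌟ a ->
    App Δ μ A⌞sl μ τ⌟ C⌞τ⌟ f⌜τ⌝ a = App Δ μ A⌞sl μ τ⌟ C⌞τ⌟ f'⌜τ⌝ a) ->
  f = f'.
Proof.
  intros HA HC Hf Hf' E. rewrite <- (Arr_eta HA HC Hf), <- (Arr_eta HA HC Hf').
  rewrite E; [reflexivity | ty | ty].
Qed.
End Families.

Section LetFamilies.
Context {o n m : mode}.
Implicit Types (Γ Δ Θ : Ctx m) (σ τ υ ρ : Sub m) (ν : Hom n m) (μ : Hom o n) (A : Ty o)
  (a : Tm o) (z : Tm n) (C : Ty m) (t : family o m) (e : family n m).

Definition hlet Γ ν μ A C z t := Let Γ ν μ A C z (generic Γ (ν · μ) A t).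

Lemma hlet_in Γ ν μ A C z t :
  TyIn (lk Γ (ν · μ)) A -> TyIn Γ C -> TmIn (lk Γ ν) (TMod (lk Γ ν) μ A) z ->
  fam Γ (ν · μ) A C t -> TmIn Γ C (hlet Γ ν μ A C z t).
Proof. intros. apply Let_in; [ty .. | apply generic_in; assumption]. Qed.

Lemma hlet_beta Γ ν μ A C a t :
  TyIn Γ C -> TmIn (lk Γ (ν · μ)) A a -> fam Γ (ν · μ) A C t ->
  hlet Γ ν μ A C (mod (lk Γ ν) μ A a) t = t Γ (ids Γ) a.
Proof.
  intros HC Ha H. assert (HA := TmIn_TyIn Ha). assert (M := generic_in HA H).
  unfold hlet. rewrite Let_beta by ty. erewrite generic_sub; [| exact HA | exact H | ty].
  rewrite wk_ins, var_ins by ty. reflexivity.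
Qed.

Lemma hlet_sub Γ Δ ν μ A C z t τ :
  TyIn (lk Γ (ν · μ)) A -> TyIn Γ C -> TmIn (lk Γ ν) (TMod (lk Γ ν) μ A) z ->
  fam Γ (ν · μ) A C t -> SubIn Δ Γ τ ->
  (hlet Γ ν μ A C z t)⌜τ⌝ =
  hlet Δ ν μ A⌞sl (ν · μ) τ⌟ C⌞τ⌟ z⌜sl ν τ⌝ (fun Θ ρ => t Θ (τ • ρ)).
Proof.
  intros HA HC Hz H K. assert (M := generic_in HA H).
  unfold hlet. erewrite Let_sub by ty. f_equal.
  erewrite generic_sub; [| exact HA | exact H | ty].
  erewrite wk_lft, var_lft by ty. reflexivity.
Qed.

(** A natural family is determined by its value at the generic variable, and there [let_ext]
    applies. This is the form in which the missing η rule for modalities is replaced in the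
    sequel. *)
Lemma mod_ext Γ ν μ A C e e' :
  TyIn (lk Γ (ν · μ)) A -> TyIn Γ C ->
  fam Γ ν (TMod (lk Γ ν) μ A) C e -> fam Γ ν (TMod (lk Γ ν) μ A) C e' ->
  (forall Δ τ a, SubIn Δ Γ τ -> TmIn (lk Δ (ν · μ)) A⌞sl (ν · μ) τ⌟ a ->
    e Δ τ (mod (lk Δ ν) μ A⌞sl (ν · μ) τ⌟ a) = e' Δ τ (mod (lk Δ ν) μ A⌞sl (ν · μ) τ⌟ a)) ->
  forall Δ τ z, SubIn Δ Γ τ -> TmIn (lk Δ ν) (TMod (lk Γ ν) μ A)⌞sl ν τ⌟ z ->
    e Δ τ z = e' Δ τ z.
Proof.
  intros HA HC He He' E Δ τ z H Hz. set (M := TMod (lk Γ ν) μ A) in *.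
  assert (HM : TyIn (lk Γ ν) M) by ty.
  assert (K : generic Γ ν M e = generic Γ ν M e').
  { eapply let_ext; [exact HA | apply (generic_in HM He) | apply (generic_in HM He') |].
    rewrite (generic_sub HM He (smd_in HA)), (generic_sub HM He' (smd_in HA)).
    unfold M. rewrite wk_smd, var_smd by exact HA. apply E; ty. }
  assert (P : forall e, fam Γ ν M C e -> (generic Γ ν M e)⌜sx ν τ M z⌝ = e Δ τ z).
  { intros e0 H0. rewrite (generic_sub HM H0 (sx_in H HM Hz)).
    rewrite (wk_sx H HM Hz), (var_sx H HM Hz). reflexivity. }
  rewrite <- (P e He), <- (P e' He'), K. reflexivity.
Qed.
End LetFamilies.

(** * The canonical maps out of ⟨1 | A⟩ and ⟨μ | ⟨ν | A⟩⟩ *)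

Section Trv.
Context {m : mode}.
Implicit Types (Γ Δ : Ctx m) (σ τ : Sub m) (A : Ty m) (a x : Tm m).

Lemma fam_id Γ A : TyIn Γ A -> fam Γ (h1 · h1) A A (fun _ _ a => a).
Proof.
  intros HA Δ τ a H K. rewrite h_1l, lk_1, (sl_1 H) in K. split; [exact K|].
  intros Θ ρ L. rewrite h_1l, (sl_1 L). reflexivity.
Qed.
Lemma ty_11 Γ A : TyIn Γ A -> TyIn (lk Γ (h1 · h1)) A.
Proof. rewrite h_1l, lk_1. auto. Qed.
Lemma tm_11 Γ A a : TmIn Γ A a -> TmIn (lk Γ (h1 · h1)) A a.
Proof. rewrite h_1l, lk_1. auto. Qed.

Definition Trv Γ A x := hlet Γ h1 h1 A A x (fun _ _ a => a).

Lemma mod1_in Γ A x : TmIn Γ (TMod Γ h1 A) x -> TmIn (lk Γ h1) (TMod (lk Γ h1) h1 A) x.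
Proof. rewrite lk_1. auto. Qed.
Lemma Trv_in Γ A x : TyIn Γ A -> TmIn Γ (TMod Γ h1 A) x -> TmIn Γ A (Trv Γ A x).
Proof.
  intros. apply hlet_in; [apply ty_11 | | apply mod1_in | apply fam_id]; assumption.
Qed.
Lemma Trv_sub Γ Δ A x σ :
  SubIn Γ Δ σ -> TyIn Δ A -> TmIn Δ (TMod Δ h1 A) x ->
  (Trv Δ A x)⌜σ⌝ = Trv Γ A⌞σ⌟ x⌜σ⌝.
Proof.
  intros H K L. unfold Trv.
  erewrite hlet_sub; [| apply ty_11, K | exact K | apply mod1_in, L | apply fam_id, K | exact H].
  rewrite h_1l, !(sl_1 H). reflexivity.
Qed.
Lemma Trv_beta Γ A a : TmIn Γ A a -> Trv Γ A (mod Γ h1 A a) = a.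
Proof.
  intros H. assert (K := TmIn_TyIn H). unfold Trv.
  replace (mod Γ h1 A a) with (mod (lk Γ h1) h1 A a) by (rewrite lk_1; reflexivity).
  apply hlet_beta; [exact K | apply tm_11, H | apply fam_id, K].
Qed.
Lemma Trv_spec Γ A x G (X : ty m) (r : tm m) :
  G ∈ Γ -> (G, X) ∈ A -> (G, Mod one X, r) ∈ x -> (G, X, triv_map X r) ∈ Trv Γ A x.
Proof.
  intros HG HA Hx. assert (HGr := ctx_ok HG). ones.
  assert (HA2 : (lock (lock G one) one, X) ∈ A)
    by (apply ty_one; [eapply ctx_ok; rep | assumption]).
  assert (HA3 := ty_lk HGr HA2).
  assert (O1 : one ∘ one ∈ @h1 m) by (rewrite <- (h_1l h1); rep).
  assert (K : TyIn Γ A) by (eapply TyIn_intro; eassumption).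
  assert (W := wk_in (ty_1 K)).
  unfold Trv, hlet.
  eapply Let_spec with (Z' := X⟦swk⟧); [eassumption | rep | rep | eassumption | eassumption
    | rep | eassumption | rewrite h_1l; rep |].
  unfold generic. rewrite h_1l.
  assert (V : (lock (ext G (one ∘ one) X) (one ∘ one), X⟦slock (one ∘ one) swk⟧, var)
    ∈ var' Γ h1 A) by rep.
  eapply tm_conv with (A := X⟦slock (one ∘ one) swk⟧) (T := A⌞wk Γ h1 A⌟).
  - eapply tm_ctx with (Γ := lk (ex Γ h1 A) h1); [exact V | rep | rewrite lk_1; rep].
  - eapply ty_ctx with (Γ := lk (ex Γ h1 A) h1); [| rep | rewrite lk_1; rep].
    rewrite <- (sl_1 W). rep.
  - rep.
Qed.
End Trv.

Section Cmp.
Context {o n m : mode}.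
Implicit Types (Γ Δ Θ : Ctx m) (σ τ ρ : Sub m) (μ : Hom n m) (ν : Hom o n) (A : Ty o)
  (a : Tm o) (x : Tm m).

Lemma fam_mod Γ μ ν A :
  TyIn (lk Γ (μ · ν)) A ->
  fam Γ (μ · ν) A (TMod Γ (μ · ν) A)
    (fun Δ τ a => mod Δ (μ · ν) A⌞sl (μ · ν) τ⌟ a).
Proof.
  intros HA Δ τ a H K. split.
  - erewrite Mod_sub by ty. ty.
  - intros Θ ρ L. erewrite mod_sub by ty. erewrite Tsub_cmp by ty.
    erewrite sl_cmp by ty. reflexivity.
Qed.

(** The inner elimination of [comp_map], as a family in the variable bound by the outer one. *)
Definition cmp_in_fam Γ μ ν A : family n m := fun Δ τ y =>
  hlet Δ μ ν A⌞sl (μ · ν) τ⌟ (TMod Γ (μ · ν) A)⌞τ⌟ y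
    (fun Θ ρ a => mod Θ (μ · ν) A⌞sl (μ · ν) (τ • ρ)⌟ a).

Lemma cmp_in_fam_ok Γ μ ν A :
  TyIn (lk Γ (μ · ν)) A ->
  fam Γ μ (TMod (lk Γ μ) ν A) (TMod Γ (μ · ν) A) (cmp_in_fam Γ μ ν A).
Proof.
  intros HA Δ τ y H K. assert (F := fam_restrict HA (Mod_in HA) (fam_mod HA) H).
  erewrite TMod_sub in K by ty. split.
  - apply hlet_in; [ty | ty | exact K | exact F].
  - intros Θ ρ L. unfold cmp_in_fam.
    erewrite hlet_sub; [| | | exact K | exact F | exact L]; [| ty | ty].
    erewrite !Tsub_cmp by ty. erewrite <- sl_cmp by ty.
    unfold hlet, generic. erewrite cmp_assoc; [reflexivity | | exact L | exact H].
    apply wk_in. ty.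
Qed.

Definition Cmp Γ μ ν A x :=
  hlet Γ h1 μ (TMod (lk Γ μ) ν A) (TMod Γ (μ · ν) A) x (cmp_in_fam Γ μ ν A).

Lemma Cmp_in Γ μ ν A x :
  TyIn (lk Γ (μ · ν)) A -> TmIn Γ (TMod Γ μ (TMod (lk Γ μ) ν A)) x ->
  TmIn Γ (TMod Γ (μ · ν) A) (Cmp Γ μ ν A x).
Proof.
  intros HA H. apply hlet_in; rewrite ?h_1l, ?lk_1; [ty | ty | exact H |].
  apply cmp_in_fam_ok; exact HA.
Qed.
Lemma Cmp_sub Γ Δ μ ν A x σ :
  SubIn Γ Δ σ -> TyIn (lk Δ (μ · ν)) A -> TmIn Δ (TMod Δ μ (TMod (lk Δ μ) ν A)) x ->
  (Cmp Δ μ ν A x)⌜σ⌝ = Cmp Γ μ ν A⌞sl (μ · ν) σ⌟ x⌜σ⌝.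
Proof.
  intros H HA K. assert (F := cmp_in_fam_ok HA). unfold Cmp.
  erewrite hlet_sub; [| | | | | exact H]; rewrite ?h_1l, ?lk_1; [| ty | ty | exact K | exact F].
  rewrite (sl_1 H). erewrite TMod_sub, Mod_sub by ty.
  unfold hlet. f_equal. rewrite h_1l. unfold generic, cmp_in_fam.
  assert (W : SubIn (ex Γ μ (TMod (lk Γ μ) ν A⌞sl (μ · ν) σ⌟)) Γ
    (wk Γ μ (TMod (lk Γ μ) ν A⌞sl (μ · ν) σ⌟))) by ty.
  set (w := wk Γ μ (TMod (lk Γ μ) ν A⌞sl (μ · ν) σ⌟)) in *.
  erewrite <- Mod_sub by ty. erewrite !Tsub_cmp by ty. erewrite <- sl_cmp by ty.
  unfold hlet, generic. f_equal.
  set (w' := wk _ (μ · ν) A⌞_⌟).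
  assert (W' : SubIn (ex (ex Γ μ (TMod (lk Γ μ) ν A⌞sl (μ · ν) σ⌟)) (μ · ν) A⌞sl (μ · ν) (σ • w)⌟)
    (ex Γ μ (TMod (lk Γ μ) ν A⌞sl (μ · ν) σ⌟)) w') by (apply wk_in; ty).
  erewrite Tsub_cmp by ty. erewrite <- sl_cmp, cmp_assoc by ty. reflexivity.
Qed.
Lemma Cmp_beta Γ μ ν A a :
  TmIn (lk Γ (μ · ν)) A a ->
  Cmp Γ μ ν A (mod Γ μ (TMod (lk Γ μ) ν A) (mod (lk Γ μ) ν A a)) = mod Γ (μ · ν) A a.
Proof.
  intros H. assert (HA := TmIn_TyIn H). assert (F := cmp_in_fam_ok HA). unfold Cmp.
  replace (mod Γ μ (TMod (lk Γ μ) ν A) (mod (lk Γ μ) ν A a)) with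
    (mod (lk Γ h1) μ (TMod (lk Γ μ) ν A) (mod (lk Γ μ) ν A a)) by (rewrite lk_1; reflexivity).
  rewrite hlet_beta; rewrite ?h_1l, ?lk_1; [| ty | ty | exact F].
  unfold cmp_in_fam. rewrite sl_id, !Tsub_id by ty.
  rewrite hlet_beta; [| ty | exact H |].
  - rewrite id_l with (Γ := Γ) by ty. rewrite sl_id, Tsub_id by ty. reflexivity.
  - assert (I := fam_restrict HA (Mod_in HA) (fam_mod HA) (ids_in Γ)).
    rewrite sl_id, !Tsub_id in I by ty. exact I.
Qed.

Lemma Cmp_spec Γ μ ν A x G mu nu (X : ty o) (r : tm m) :
  G ∈ Γ -> mu ∈ μ -> nu ∈ ν -> (lock (lock G mu) nu, X) ∈ A ->
  (G, Mod mu (Mod nu X), r) ∈ x ->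
  (G, Mod (mu ∘ nu) X, comp_map mu nu X r) ∈ Cmp Γ μ ν A x.
Proof.
  intros HG Hmu Hnu HX Hr. assert (HGr := ctx_ok HG).
  assert (HX' := ty_lk HGr HX).
  assert (HA : TyIn (lk Γ (μ · ν)) A) by (eapply TyIn_intro; rep).
  assert (Omu : one ∘ mu ∈ μ) by (rewrite <- h_1l; rep).
  set (M := TMod (lk Γ μ) ν A). assert (HM : TyIn (lk Γ μ) M) by (unfold M; ty).
  set (Γ1 := ex Γ μ M). set (w := wk Γ μ M).
  assert (W : SubIn Γ1 Γ w) by (apply wk_in; exact HM).
  assert (KM : (lock G mu, Mod nu X) ∈ M) by (unfold M; rep).
  assert (KM1 : (lock (lock G one) mu, Mod nu X) ∈ M).
  { eapply ty_ctx with (Γ := lk Γ μ); [exact KM | rep | rewrite <- (lk_1 Γ); rep]. }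
  assert (KM2 : (lock G (one ∘ mu), Mod nu X) ∈ M) by (apply ty_lk; assumption).
  set (Gx := ext G (one ∘ mu) (Mod nu X)).
  assert (KG1 : Gx ∈ Γ1) by (unfold Gx, Γ1; rep).
  assert (Kw : (Gx, G, swk) ∈ w) by (unfold Gx, w; rep).
  set (X1 := X⟦slock nu (slock mu swk)⟧). set (A1 := A⌞sl (μ · ν) w⌟).
  assert (KX1 : (lock (lock Gx mu) nu, X1) ∈ A1)
    by (unfold A1, X1; erewrite <- sl_sl by exact W; rep).
  assert (KX1' := ty_lk (ctx_ok KG1) KX1).
  assert (HA1 : TyIn (lk Γ1 (μ · ν)) A1) by (unfold A1; ty).
  set (Γ2 := ex Γ1 (μ · ν) A1). set (w2 := wk Γ1 (μ · ν) A1).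
  assert (W2 : SubIn Γ2 Γ1 w2) by (apply wk_in; exact HA1).
  set (Gy := ext Gx (mu ∘ nu) X1).
  assert (KG2 : Gy ∈ Γ2) by (unfold Gy, Γ2; rep).
  assert (Kw2 : (Gy, Gx, swk) ∈ w2) by (unfold Gy, w2; rep).
  assert (EC : (TMod Γ (μ · ν) A)⌞w⌟ = TMod Γ1 (μ · ν) A1)
    by (unfold A1; erewrite Mod_sub by ty; reflexivity).
  assert (EM : M⌞sl μ w⌟ = TMod (lk Γ1 μ) ν A1) by (apply TMod_sub; assumption).
  unfold Cmp, hlet.
  eapply Let_spec with (Z' := Mod (mu ∘ nu) X1);
    [exact HG | apply one_spec | exact Hmu | exact KM1 | rep | | | |].
  - rewrite lk_1. fold M.
    eapply Tsub_spec; [rep |]. apply wk_spec; [exact HG | apply one_spec |].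
    apply ty_one; [exact HGr | rep].
  - apply tm_one; assumption.
  - rewrite h_1l. fold M w. rewrite EC. rep.
  - unfold generic. rewrite h_1l. fold M w Γ1. unfold cmp_in_fam, hlet. fold A1. rewrite EC.
    eapply Let_spec with (Z' := (Mod (mu ∘ nu) X1)⟦swk⟧);
      [exact KG1 | exact Hmu | exact Hnu | exact KX1 | rep | | | |].
    + eapply Tsub_spec; rep.
    + assert (V : (lock Gx (one ∘ mu), (Mod nu X)⟦slock (one ∘ mu) swk⟧, var) ∈ var' Γ μ M)
        by (unfold Gx; rep).
      eapply tm_conv; [eapply tm_ctx with (Γ := lk Γ1 μ); [exact V | rep | rep] | |].
      * eapply ty_ctx with (Γ := lk Γ1 μ); [eapply Tsub_spec with (σ := sl μ w); rep | rep | rep].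
      * rewrite EM. rep.
    + rep.
    + unfold generic. fold Γ2 w2.
      assert (EA : A⌞sl (μ · ν) (w • w2)⌟ = A1⌞sl (μ · ν) w2⌟).
      { unfold A1. erewrite Tsub_cmp by ty. erewrite <- sl_cmp by ty. reflexivity. }
      rewrite EA.
      eapply tm_conv with (T := (TMod Γ1 (μ · ν) A1)⌞w2⌟).
      * eapply mod_spec with (mu := mu ∘ nu); [exact KG2 | rep | rep | rep].
      * erewrite Mod_sub by ty. rep.
      * rep.
Qed.
End Cmp.

(** * Streams *)

(** With composites associated to the right, γδ = 1 and γℓ = γ must also be available in front of a
    further 1-cell for the rewriting in [hm] to be complete enough. *)
Lemma h_gdx {n} (μ : Hom n mode_s) : hγ · (hδ · μ) = μ.
Proof. apply hom_s. Qed.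
Lemma h_glx {n} (μ : Hom n mode_t) : hγ · (hℓ · μ) = hγ · μ.
Proof. apply hom_s. Qed.
Create HintDb hm.
#[export] Hint Rewrite @lk_lk @lk_1 @h_1l @h_1r h_gd h_gl @h_gdx @h_glx @h_assoc : hm.
Ltac nrm := autorewrite with hm.

Lemma le_d : le hδ (hℓ · hδ).
Proof. rewrite <- (h_1l hδ) at 1. apply le_hc; [apply le_1l | apply le_refl]. Qed.
#[export] Hint Resolve le_refl le_dg le_1l le_d : ty.

(** * Keys over stages of a base of mode s *)

Section Base.
Context {n k : mode} (Γ : Ctx mode_s) (κ : Hom n mode_s) (κ' : Hom k mode_s).

Lemma ky_base (μ ν : Hom k n) : le μ ν -> ky (lk Γ κ) μ ν = ids (lk Γ κ').
Proof.
  intros H. rewrite (ky_lk _ _ H), (hom_s (κ · μ) κ'), (hom_s (κ · ν) κ'). apply ky_id.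
Qed.
Lemma lk_base (μ : Hom k n) : lk (lk Γ κ) μ = lk Γ κ'.
Proof. rewrite lk_lk, (hom_s (κ · μ) κ'). reflexivity. Qed.
Lemma sl_base Δ σ (μ : Hom k n) :
  SubIn Δ (lk Γ κ) σ -> SubIn (lk Δ μ) (lk Γ κ') (sl μ σ).
Proof. intros. rewrite <- (lk_base μ). ty. Qed.
(** Naturality of the key along σ: of the two keys in the square, the one over the base is an
    identity. *)
Lemma key_base Δ σ (μ ν : Hom k n) :
  SubIn Δ (lk Γ κ) σ -> le μ ν -> sl μ σ • ky Δ μ ν = sl ν σ.
Proof.
  intros H K. erewrite <- ky_nat by eassumption. rewrite (ky_base K).
  eapply id_l. apply sl_base. exact H.
Qed.
(** By [key_base] a key does not affect types pulled back from the base, although it is a genuine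
    substitution of the stage Δ. Transport along it thus changes the lock but keeps the type. *)
Lemma key_in Δ σ (μ ν : Hom k n) T t :
  SubIn Δ (lk Γ κ) σ -> le μ ν -> TyIn (lk Γ κ') T -> TmIn (lk Δ μ) T⌞sl μ σ⌟ t ->
  TmIn (lk Δ ν) T⌞sl ν σ⌟ t⌜ky Δ μ ν⌝.
Proof.
  intros H K L M. rewrite <- (key_base H K).
  erewrite <- Tsub_cmp; [ty | exact L | apply ky_in, K | apply sl_base, H].
Qed.
End Base.

Lemma key_sub {n k} (Δ Θ : Ctx n) σ (μ ν : Hom k n) T t :
  SubIn Θ Δ σ -> le μ ν -> TmIn (lk Δ μ) T t ->
  t⌜ky Δ μ ν⌝⌜sl ν σ⌝ = t⌜sl μ σ⌝⌜ky Θ μ ν⌝.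
Proof.
  intros. erewrite !Msub_cmp by ty. erewrite ky_nat by eassumption. reflexivity.
Qed.

Section Streams.
(** The argument is made for any type S with the unfolding [ES]; codes enter when S is taken to be
    [El (Str' A)]. Below, Δ with σ : Δ → L is a stage of mode t, and Ξ with σ : Ξ → Γ one of mode
    s. *)
Context (Γ : Ctx mode_s) (A : Ty mode_s) (S : Ty mode_t).
Notation L := (lk Γ hγ).
Context (HA : TyIn Γ A) (HS : TyIn L S).
Context (ES : S = Prd L (TMod L hδ A) (TMod L hℓ S)).

Lemma sl_δ Δ σ : SubIn Δ L σ -> SubIn (lk Δ hδ) Γ (sl hδ σ).
Proof. intros H. rewrite <- (lk_1 Γ). apply sl_base with (κ := hγ). exact H. Qed.
Lemma sl_ℓ Δ σ : SubIn Δ L σ -> SubIn (lk Δ hℓ) L (sl hℓ σ).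
Proof. apply sl_base. Qed.
Lemma sl_δγ Δ σ : SubIn Δ L σ -> SubIn (lk Δ (hδ · hγ)) L (sl (hδ · hγ) σ).
Proof. apply sl_base. Qed.
Hint Resolve sl_δ sl_ℓ sl_δγ : ty.

Lemma A_δ : TyIn (lk L hδ) A.
Proof. nrm. exact HA. Qed.
Lemma S_ℓ : TyIn (lk L hℓ) S.
Proof. nrm. exact HS. Qed.
Hint Resolve A_δ S_ℓ HA HS : ty.

Definition MA := TMod L hδ A.
Definition MS := TMod L hℓ S.
Definition St := TMod Γ hγ S.
Lemma MA_in : TyIn L MA. Proof. unfold MA; ty. Qed.
Lemma MS_in : TyIn L MS. Proof. unfold MS; ty. Qed.
Lemma St_in : TyIn Γ St. Proof. unfold St; ty. Qed.
Hint Resolve MA_in MS_in St_in : ty.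
Lemma MA_sub Δ σ : SubIn Δ L σ -> MA⌞σ⌟ = TMod Δ hδ A⌞sl hδ σ⌟.
Proof. intros. unfold MA. erewrite Mod_sub by ty. reflexivity. Qed.
Lemma MS_sub Δ σ : SubIn Δ L σ -> MS⌞σ⌟ = TMod Δ hℓ S⌞sl hℓ σ⌟.
Proof. intros. unfold MS. erewrite Mod_sub by ty. reflexivity. Qed.
Lemma St_sub Δ σ : SubIn Δ Γ σ -> St⌞σ⌟ = TMod Δ hγ S⌞sl hγ σ⌟.
Proof. intros. unfold St. erewrite Mod_sub by ty. reflexivity. Qed.
Lemma S_sub Δ σ : SubIn Δ L σ -> S⌞σ⌟ = Prd Δ MA⌞σ⌟ MS⌞σ⌟.
Proof. intros. rewrite ES at 1. fold MA MS. erewrite Prd_sub by ty. reflexivity. Qed.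

Definition p0 Δ σ y := P1 Δ MA⌞σ⌟ MS⌞σ⌟ y.
Definition p1 Δ σ y := P2 Δ MA⌞σ⌟ MS⌞σ⌟ y.
Lemma p0_in Δ σ y : SubIn Δ L σ -> TmIn Δ S⌞σ⌟ y -> TmIn Δ MA⌞σ⌟ (p0 Δ σ y).
Proof. intros H K. rewrite (S_sub H) in K. unfold p0. ty. Qed.
Lemma p1_in Δ σ y : SubIn Δ L σ -> TmIn Δ S⌞σ⌟ y -> TmIn Δ MS⌞σ⌟ (p1 Δ σ y).
Proof. intros H K. rewrite (S_sub H) in K. unfold p1. ty. Qed.
Lemma p0_sub Δ Θ σ τ y :
  SubIn Δ L σ -> SubIn Θ Δ τ -> TmIn Δ S⌞σ⌟ y -> (p0 Δ σ y)⌜τ⌝ = p0 Θ (σ • τ) y⌜τ⌝.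
Proof.
  intros H M K. rewrite (S_sub H) in K. unfold p0. erewrite P1_sub, !Tsub_cmp by ty.
  reflexivity.
Qed.
Lemma p1_sub Δ Θ σ τ y :
  SubIn Δ L σ -> SubIn Θ Δ τ -> TmIn Δ S⌞σ⌟ y -> (p1 Δ σ y)⌜τ⌝ = p1 Θ (σ • τ) y⌜τ⌝.
Proof.
  intros H M K. rewrite (S_sub H) in K. unfold p1. erewrite P2_sub, !Tsub_cmp by ty.
  reflexivity.
Qed.
Hint Resolve p0_in p1_in : ty.

(* [let_δ mod_γ(y) ← z in y^{δγ≤1}], the transpose of the identity of [⟨γ | S⟩]. *)
Definition eps Δ σ z :=
  hlet Δ hδ hγ S⌞sl (hδ · hγ) σ⌟ S⌞σ⌟ z (fun Θ _ y => y⌜ky Θ (hδ · hγ) h1⌝).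

Lemma key_δγ Δ σ y :
  SubIn Δ L σ -> TmIn (lk Δ (hδ · hγ)) S⌞sl (hδ · hγ) σ⌟ y ->
  TmIn Δ S⌞σ⌟ y⌜ky Δ (hδ · hγ) h1⌝.
Proof.
  intros H K. assert (M := key_in (κ' := hγ) H le_dg HS K).
  rewrite lk_1, (sl_1 H) in M. exact M.
Qed.
Lemma eps_fam Δ σ :
  SubIn Δ L σ ->
  fam Δ (hδ · hγ) S⌞sl (hδ · hγ) σ⌟ S⌞σ⌟ (fun Θ _ y => y⌜ky Θ (hδ · hγ) h1⌝).
Proof.
  intros H Θ τ y K M. erewrite Tsub_cmp in M by ty. erewrite <- sl_cmp in M by ty.
  split.
  - erewrite Tsub_cmp by ty. apply key_δγ; [ty | exact M].
  - intros Ξ ρ N. rewrite <- (sl_1 N) at 1. eapply key_sub; [exact N | apply le_dg | exact M].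
Qed.

Lemma St_δ Δ σ z :
  SubIn Δ L σ -> TmIn (lk Δ hδ) St⌞sl hδ σ⌟ z ->
  TmIn (lk Δ hδ) (TMod (lk Δ hδ) hγ S⌞sl (hδ · hγ) σ⌟) z.
Proof. intros H K. rewrite (St_sub (sl_δ H)) in K. erewrite sl_sl in K by ty. exact K. Qed.

Lemma eps_in Δ σ z :
  SubIn Δ L σ -> TmIn (lk Δ hδ) St⌞sl hδ σ⌟ z -> TmIn Δ S⌞σ⌟ (eps Δ σ z).
Proof.
  intros H K. apply hlet_in; [ty | ty | apply St_δ; assumption | apply eps_fam, H].
Qed.
Lemma eps_sub Δ Θ σ τ z :
  SubIn Δ L σ -> SubIn Θ Δ τ -> TmIn (lk Δ hδ) St⌞sl hδ σ⌟ z ->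
  (eps Δ σ z)⌜τ⌝ = eps Θ (σ • τ) z⌜sl hδ τ⌝.
Proof.
  intros H M K. unfold eps.
  erewrite hlet_sub; [| ty | ty | apply St_δ; eassumption | apply eps_fam, H | exact M].
  erewrite !Tsub_cmp by ty. erewrite <- sl_cmp by ty. reflexivity.
Qed.
Lemma eps_beta Δ σ y :
  SubIn Δ L σ -> TmIn (lk Δ (hδ · hγ)) S⌞sl (hδ · hγ) σ⌟ y ->
  eps Δ σ (mod (lk Δ hδ) hγ S⌞sl (hδ · hγ) σ⌟ y) = y⌜ky Δ (hδ · hγ) h1⌝.
Proof.
  intros H K. unfold eps. rewrite hlet_beta; [reflexivity | ty | exact K | apply eps_fam, H].
Qed.
Hint Resolve eps_in : ty.

Lemma sl_γ Ξ σ : SubIn Ξ Γ σ -> SubIn (lk Ξ hγ) L (sl hγ σ).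
Proof. intros. ty. Qed.

Lemma MA_γ Ξ σ : SubIn Ξ Γ σ -> MA⌞sl hγ σ⌟ = TMod (lk Ξ hγ) hδ A⌞σ⌟.
Proof.
  intros H. rewrite (MA_sub (sl_γ H)), (sl_sl hγ hδ H), h_gd, (sl_1 H). reflexivity.
Qed.
Lemma MS_γ Ξ σ : SubIn Ξ Γ σ -> MS⌞sl hγ σ⌟ = TMod (lk Ξ hγ) hℓ S⌞sl hγ σ⌟.
Proof.
  intros H. rewrite (MS_sub (sl_γ H)), (sl_sl hγ hℓ H), h_gl. reflexivity.
Qed.

Lemma A_γδ Ξ σ : SubIn Ξ Γ σ -> TyIn (lk Ξ (hγ · hδ)) A⌞σ⌟.
Proof. intros. nrm. ty. Qed.
Lemma S_γℓ Ξ σ : SubIn Ξ Γ σ -> TyIn (lk Ξ (hγ · hℓ)) S⌞sl hγ σ⌟.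
Proof. intros. nrm. ty. Qed.
Hint Resolve A_γδ S_γℓ : ty.

(* [head] and [tail] of [mod_γ(y)] in terms of [w], the first resp. second component
   of [y]. *)
Definition hd' Ξ σ w := Trv Ξ A⌞σ⌟ (Cmp Ξ hγ hδ A⌞σ⌟ (mod Ξ hγ MA⌞sl hγ σ⌟ w)).
Definition tl' Ξ σ w := Cmp Ξ hγ hℓ S⌞sl hγ σ⌟ (mod Ξ hγ MS⌞sl hγ σ⌟ w).

Lemma hd'_in1 Ξ σ w :
  SubIn Ξ Γ σ -> TmIn (lk Ξ hγ) MA⌞sl hγ σ⌟ w ->
  TmIn Ξ (TMod Ξ h1 A⌞σ⌟) (Cmp Ξ hγ hδ A⌞σ⌟ (mod Ξ hγ MA⌞sl hγ σ⌟ w)).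
Proof.
  intros H K. rewrite <- h_gd. apply Cmp_in; [ty|]. rewrite (MA_γ H) in *. ty.
Qed.
Lemma hd'_in Ξ σ w :
  SubIn Ξ Γ σ -> TmIn (lk Ξ hγ) MA⌞sl hγ σ⌟ w -> TmIn Ξ A⌞σ⌟ (hd' Ξ σ w).
Proof. intros H K. apply Trv_in; [ty | apply hd'_in1; assumption]. Qed.
Lemma tl'_in Ξ σ w :
  SubIn Ξ Γ σ -> TmIn (lk Ξ hγ) MS⌞sl hγ σ⌟ w -> TmIn Ξ St⌞σ⌟ (tl' Ξ σ w).
Proof.
  intros H K. rewrite (St_sub H). rewrite <- h_gl at 1. apply Cmp_in; [ty|].
  rewrite (MS_γ H) in *. ty.
Qed.
Lemma hd'_sub Ξ Θ σ τ w :
  SubIn Ξ Γ σ -> SubIn Θ Ξ τ -> TmIn (lk Ξ hγ) MA⌞sl hγ σ⌟ w ->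
  (hd' Ξ σ w)⌜τ⌝ = hd' Θ (σ • τ) w⌜sl hγ τ⌝.
Proof.
  intros H M K. unfold hd'.
  erewrite Trv_sub; [| exact M | ty | apply hd'_in1; assumption].
  erewrite Cmp_sub; [| exact M | ty |].
  - erewrite mod_sub by ty. rewrite h_gd, (sl_1 M). erewrite !Tsub_cmp by ty.
    erewrite <- sl_cmp by ty. reflexivity.
  - rewrite (MA_γ H) in *. ty.
Qed.
Lemma tl'_sub Ξ Θ σ τ w :
  SubIn Ξ Γ σ -> SubIn Θ Ξ τ -> TmIn (lk Ξ hγ) MS⌞sl hγ σ⌟ w ->
  (tl' Ξ σ w)⌜τ⌝ = tl' Θ (σ • τ) w⌜sl hγ τ⌝.
Proof.
  intros H M K. unfold tl'.
  erewrite Cmp_sub; [| exact M | ty |].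
  - erewrite mod_sub by ty. rewrite h_gl. erewrite !Tsub_cmp by ty.
    erewrite <- sl_cmp by ty. reflexivity.
  - rewrite (MS_γ H) in *. ty.
Qed.
Lemma hd'_beta Ξ σ a :
  SubIn Ξ Γ σ -> TmIn Ξ A⌞σ⌟ a -> hd' Ξ σ (mod (lk Ξ hγ) hδ A⌞σ⌟ a) = a.
Proof.
  intros H K. unfold hd'. rewrite (MA_γ H), Cmp_beta by (nrm; exact K).
  rewrite h_gd. apply Trv_beta. exact K.
Qed.
Lemma tl'_beta Ξ σ v :
  SubIn Ξ Γ σ -> TmIn (lk Ξ hγ) S⌞sl hγ σ⌟ v ->
  tl' Ξ σ (mod (lk Ξ hγ) hℓ S⌞sl hγ σ⌟ v) = mod Ξ hγ S⌞sl hγ σ⌟ v.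
Proof.
  intros H K. unfold tl'. rewrite (MS_γ H), Cmp_beta by (nrm; exact K).
  rewrite h_gl. reflexivity.
Qed.
Hint Resolve hd'_in tl'_in : ty.

Definition hd Ξ σ x := hlet Ξ h1 hγ S⌞sl hγ σ⌟ A⌞σ⌟ x
  (fun Θ τ y => hd' Θ (σ • τ) (p0 (lk Θ hγ) (sl hγ (σ • τ)) y)).
Definition tl Ξ σ x := hlet Ξ h1 hγ S⌞sl hγ σ⌟ St⌞σ⌟ x
  (fun Θ τ y => tl' Θ (σ • τ) (p1 (lk Θ hγ) (sl hγ (σ • τ)) y)).

Lemma hd_fam Ξ σ :
  SubIn Ξ Γ σ -> fam Ξ (h1 · hγ) S⌞sl hγ σ⌟ A⌞σ⌟
    (fun Θ τ y => hd' Θ (σ • τ) (p0 (lk Θ hγ) (sl hγ (σ • τ)) y)).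
Proof.
  intros H Θ τ y K M. rewrite h_1l in *.
  erewrite Tsub_cmp in M by ty. erewrite <- sl_cmp in M by ty.
  assert (N : SubIn (lk Θ hγ) L (sl hγ (σ • τ))) by (apply sl_γ; ty).
  split.
  - erewrite Tsub_cmp by ty. apply hd'_in; [ty | apply p0_in; assumption].
  - intros Ω ρ R. erewrite hd'_sub; [| ty | exact R | apply p0_in; assumption].
    erewrite p0_sub; [| exact N | ty | exact M].
    erewrite <- sl_cmp, cmp_assoc by ty. reflexivity.
Qed.
Lemma tl_fam Ξ σ :
  SubIn Ξ Γ σ -> fam Ξ (h1 · hγ) S⌞sl hγ σ⌟ St⌞σ⌟
    (fun Θ τ y => tl' Θ (σ • τ) (p1 (lk Θ hγ) (sl hγ (σ • τ)) y)).
Proof.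
  intros H Θ τ y K M. rewrite h_1l in *.
  erewrite Tsub_cmp in M by ty. erewrite <- sl_cmp in M by ty.
  assert (N : SubIn (lk Θ hγ) L (sl hγ (σ • τ))) by (apply sl_γ; ty).
  split.
  - erewrite Tsub_cmp by ty. apply tl'_in; [ty | apply p1_in; assumption].
  - intros Ω ρ R. erewrite tl'_sub; [| ty | exact R | apply p1_in; assumption].
    erewrite p1_sub; [| exact N | ty | exact M].
    erewrite <- sl_cmp, cmp_assoc by ty. reflexivity.
Qed.

Lemma S_1γ Ξ σ : SubIn Ξ Γ σ -> TyIn (lk Ξ (h1 · hγ)) S⌞sl hγ σ⌟.
Proof. intros. nrm. ty. Qed.
Lemma St_1 Ξ σ x :
  SubIn Ξ Γ σ -> TmIn Ξ St⌞σ⌟ x -> TmIn (lk Ξ h1) (TMod (lk Ξ h1) hγ S⌞sl hγ σ⌟) x.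
Proof. intros H K. rewrite (St_sub H) in K. rewrite lk_1. exact K. Qed.
Hint Resolve S_1γ St_1 hd_fam tl_fam : ty.

Lemma hd_in Ξ σ x : SubIn Ξ Γ σ -> TmIn Ξ St⌞σ⌟ x -> TmIn Ξ A⌞σ⌟ (hd Ξ σ x).
Proof. intros H K. apply hlet_in; ty. Qed.
Lemma tl_in Ξ σ x : SubIn Ξ Γ σ -> TmIn Ξ St⌞σ⌟ x -> TmIn Ξ St⌞σ⌟ (tl Ξ σ x).
Proof. intros H K. apply hlet_in; ty. Qed.
Lemma hd_sub Ξ Θ σ τ x :
  SubIn Ξ Γ σ -> SubIn Θ Ξ τ -> TmIn Ξ St⌞σ⌟ x -> (hd Ξ σ x)⌜τ⌝ = hd Θ (σ • τ) x⌜τ⌝.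
Proof.
  intros H M K. unfold hd.
  erewrite hlet_sub; [| ty | ty | ty | apply hd_fam, H | exact M].
  rewrite h_1l, (sl_1 M). erewrite !Tsub_cmp by ty. erewrite <- sl_cmp by ty.
  unfold hlet, generic. f_equal. erewrite cmp_assoc; [reflexivity | | exact M | exact H].
  apply wk_in. nrm. eapply Tsub_in; ty.
Qed.
Lemma tl_sub Ξ Θ σ τ x :
  SubIn Ξ Γ σ -> SubIn Θ Ξ τ -> TmIn Ξ St⌞σ⌟ x -> (tl Ξ σ x)⌜τ⌝ = tl Θ (σ • τ) x⌜τ⌝.
Proof.
  intros H M K. unfold tl.
  erewrite hlet_sub; [| ty | ty | ty | apply tl_fam, H | exact M].
  rewrite h_1l, (sl_1 M). erewrite !Tsub_cmp by ty. erewrite <- sl_cmp by ty.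
  unfold hlet, generic. f_equal. erewrite cmp_assoc; [reflexivity | | exact M | exact H].
  apply wk_in. nrm. eapply Tsub_in; ty.
Qed.
Lemma hd_beta Ξ σ y :
  SubIn Ξ Γ σ -> TmIn (lk Ξ hγ) S⌞sl hγ σ⌟ y ->
  hd Ξ σ (mod Ξ hγ S⌞sl hγ σ⌟ y) = hd' Ξ σ (p0 (lk Ξ hγ) (sl hγ σ) y).
Proof.
  intros H K. unfold hd. rewrite <- (lk_1 Ξ) at 2.
  rewrite hlet_beta; [| ty | nrm; exact K | apply hd_fam, H]. rewrite (id_r H). reflexivity.
Qed.
Lemma tl_beta Ξ σ y :
  SubIn Ξ Γ σ -> TmIn (lk Ξ hγ) S⌞sl hγ σ⌟ y ->
  tl Ξ σ (mod Ξ hγ S⌞sl hγ σ⌟ y) = tl' Ξ σ (p1 (lk Ξ hγ) (sl hγ σ) y).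
Proof.
  intros H K. unfold tl. rewrite <- (lk_1 Ξ) at 2.
  rewrite hlet_beta; [| ty | nrm; exact K | apply tl_fam, H]. rewrite (id_r H). reflexivity.
Qed.
Hint Resolve hd_in tl_in : ty.

(** * The two components of [eps], and its section property *)

Lemma sl_δ_γ Δ σ : SubIn Δ L σ -> sl hγ (sl hδ σ) = sl (hδ · hγ) σ.
Proof. apply sl_sl. Qed.

(** By [mod_ext] one may take w = mod_δ(a). The key then acts on a as δγδ ≤ δ, an identity because
    γδ = 1, and [hd'_beta] returns the same a on the right. *)
Lemma MA_key Δ σ w :
  SubIn Δ L σ -> TmIn (lk Δ (hδ · hγ)) MA⌞sl (hδ · hγ) σ⌟ w ->
  w⌜ky Δ (hδ · hγ) h1⌝ = mod Δ hδ A⌞sl hδ σ⌟ (hd' (lk Δ hδ) (sl hδ σ) w).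
Proof.
  intros H K.
  assert (T : TyIn (lk L (hδ · hγ · hδ)) A) by (nrm; exact HA).
  assert (E : TMod (lk L (hδ · hγ)) hδ A = MA) by (unfold MA; nrm; reflexivity).
  eapply (@mod_ext _ _ _ L (hδ · hγ) hδ A MA
    (fun Δ σ w => w⌜ky Δ (hδ · hγ) h1⌝)
    (fun Δ σ w => mod Δ hδ A⌞sl hδ σ⌟ (hd' (lk Δ hδ) (sl hδ σ) w)));
    [exact T | ty | | | | exact H | rewrite E; exact K]; rewrite ?E; clear Δ σ w H K T.
  (* The first two goals are the naturality of the two sides, which [mod_ext] requires; the
     computation at a modal introduction comes last. The later uses of [mod_ext] are organised in
     the same way. *)
  - intros Δ σ w H K. split.
    + assert (M := key_in (κ' := hγ) H le_dg MA_in K).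
      rewrite lk_1, (sl_1 H) in M. exact M.
    + intros Θ ρ R. rewrite <- (sl_1 R) at 1. eapply key_sub; [exact R | apply le_dg | exact K].
  - intros Δ σ w H K.
    assert (K' : TmIn (lk (lk Δ hδ) hγ) MA⌞sl hγ (sl hδ σ)⌟ w).
    { rewrite lk_lk, (sl_δ_γ H). exact K. }
    split.
    + rewrite (MA_sub H). ty.
    + intros Θ ρ R. erewrite mod_sub by ty. erewrite Tsub_cmp by ty. erewrite <- sl_cmp by ty.
      erewrite hd'_sub; [| ty | ty | exact K'].
      erewrite <- sl_cmp by ty. rewrite (sl_sl hδ hγ R). reflexivity.
  - rewrite !h_assoc, h_gd, h_1r. intros Δ σ a H K.
    assert (K' : TmIn (lk (lk Δ (hδ · hγ)) hδ) A⌞sl hδ σ⌟ a) by (nrm; exact K).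
    assert (N := ky_in Δ le_dg).
    erewrite mod_sub; [| exact N | exact K'].
    rewrite <- (lk_lk Δ hδ hγ), (hd'_beta (sl_δ H) K).
    rewrite (sl_ky _ _ le_dg), !h_assoc, h_gd, h_1r, h_1l, ky_id, lk_1.
    erewrite Tsub_id, Msub_id by ty. reflexivity.
Qed.

(** For z = mod_γ(y) the counit is the key δγ ≤ 1 applied to y. Projections commute with keys, so
    the claim is [MA_key] for the first component of y. *)
Lemma p0_eps Δ σ z :
  SubIn Δ L σ -> TmIn (lk Δ hδ) St⌞sl hδ σ⌟ z ->
  p0 Δ σ (eps Δ σ z) = mod Δ hδ A⌞sl hδ σ⌟ (hd (lk Δ hδ) (sl hδ σ) z).
Proof.
  intros H K.
  assert (T : TyIn (lk L (hδ · hγ)) S) by (nrm; exact HS).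
  assert (E : TMod (lk L hδ) hγ S = St) by (unfold St; nrm; reflexivity).
  eapply (@mod_ext _ _ _ L hδ hγ S MA
    (fun Δ σ z => p0 Δ σ (eps Δ σ z))
    (fun Δ σ z => mod Δ hδ A⌞sl hδ σ⌟ (hd (lk Δ hδ) (sl hδ σ) z)));
    [exact T | ty | | | | exact H | rewrite E; exact K]; rewrite ?E; clear Δ σ z H K T.
  - intros Δ σ z H K. split; [ty|].
    intros Θ ρ R. erewrite p0_sub; [| exact H | exact R | ty]. erewrite eps_sub by eassumption.
    reflexivity.
  - intros Δ σ z H K. split.
    + rewrite (MA_sub H). ty.
    + intros Θ ρ R. erewrite mod_sub by ty. erewrite Tsub_cmp by ty. erewrite <- sl_cmp by ty.
      erewrite hd_sub; [| ty | ty | exact K]. erewrite <- sl_cmp by ty. reflexivity.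
  - intros Δ σ y H K.
    assert (K' : TmIn (lk (lk Δ hδ) hγ) S⌞sl hγ (sl hδ σ)⌟ y)
      by (rewrite lk_lk, (sl_δ_γ H); exact K).
    rewrite (eps_beta H K). rewrite <- (sl_δ_γ H), (hd_beta (sl_δ H) K').
    rewrite lk_lk, (sl_δ_γ H).
    assert (N := ky_in Δ le_dg). assert (H' := sl_δγ H).
    rewrite <- MA_key by ty.
    erewrite p0_sub; [| exact H' | exact N | exact K].
    rewrite lk_1, (key_base (κ := hγ) hγ H le_dg), (sl_1 H). reflexivity.
Qed.

Lemma le_ℓδγ : le (hℓ · (hδ · hγ)) hℓ.
Proof. rewrite <- (h_1r hℓ) at 2. apply le_hc; [apply le_refl | apply le_dg]. Qed.
Lemma le_δγℓ : le (hδ · hγ) (hℓ · (hδ · hγ)).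
Proof. rewrite <- (h_1l (hδ · hγ)) at 1. apply le_hc; [apply le_1l | apply le_refl]. Qed.

(** Recursive calls happen under ℓ, so their arguments must move from Δ.{δ} to Δ.{ℓ}.{δ}. Over L
    both contexts are Γ and nothing happens; over a general stage the key δ ≤ ℓδ is needed. *)
Definition nxt Δ z := z⌜ky Δ hδ (hℓ · hδ)⌝.
Lemma nxt_in Δ σ T z :
  SubIn Δ L σ -> TyIn Γ T -> TmIn (lk Δ hδ) T⌞sl hδ σ⌟ z ->
  TmIn (lk (lk Δ hℓ) hδ) T⌞sl hδ (sl hℓ σ)⌟ (nxt Δ z).
Proof.
  intros H K M. rewrite <- (lk_1 Γ) in K.
  assert (N := key_in H le_d K M). rewrite lk_lk, (sl_sl hℓ hδ H). exact N.
Qed.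
Lemma nxt_sub Δ Θ ρ T z :
  SubIn Θ Δ ρ -> TmIn (lk Δ hδ) T z ->
  (nxt Δ z)⌜sl hδ (sl hℓ ρ)⌝ = nxt Θ z⌜sl hδ ρ⌝.
Proof.
  intros R K. unfold nxt. rewrite (sl_sl hℓ hδ R). eapply key_sub; [exact R | apply le_d | exact K].
Qed.

(** For w = mod_ℓ(v) the left side transports v along δγ ≤ ℓ, as δγℓ = δγ. The right side does so in
    two stages, δγ ≤ ℓδγ from [nxt] and ℓδγ ≤ ℓ from [eps], and keys compose. *)
Lemma MS_key Δ σ w :
  SubIn Δ L σ -> TmIn (lk Δ (hδ · hγ)) MS⌞sl (hδ · hγ) σ⌟ w ->
  w⌜ky Δ (hδ · hγ) h1⌝ =
  mod Δ hℓ S⌞sl hℓ σ⌟ (eps (lk Δ hℓ) (sl hℓ σ) (nxt Δ (tl' (lk Δ hδ) (sl hδ σ) w))).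
Proof.
  intros H K.
  assert (T : TyIn (lk L (hδ · hγ · hℓ)) S) by (nrm; exact HS).
  assert (E : TMod (lk L (hδ · hγ)) hℓ S = MS) by (unfold MS; nrm; reflexivity).
  eapply (@mod_ext _ _ _ L (hδ · hγ) hℓ S MS
    (fun Δ σ w => w⌜ky Δ (hδ · hγ) h1⌝)
    (fun Δ σ w => mod Δ hℓ S⌞sl hℓ σ⌟
      (eps (lk Δ hℓ) (sl hℓ σ) (nxt Δ (tl' (lk Δ hδ) (sl hδ σ) w)))));
    [exact T | ty | | | | exact H | rewrite E; exact K]; rewrite ?E; clear Δ σ w H K T.
  - intros Δ σ w H K. split.
    + assert (M := key_in (κ' := hγ) H le_dg MS_in K).
      rewrite lk_1, (sl_1 H) in M. exact M.
    + intros Θ ρ R. rewrite <- (sl_1 R) at 1. eapply key_sub; [exact R | apply le_dg | exact K].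
  - intros Δ σ w H K.
    assert (K' : TmIn (lk (lk Δ hδ) hγ) MS⌞sl hγ (sl hδ σ)⌟ w).
    { rewrite lk_lk, (sl_δ_γ H). exact K. }
    assert (N : TmIn (lk Δ hδ) St⌞sl hδ σ⌟ (tl' (lk Δ hδ) (sl hδ σ) w)) by ty.
    assert (N' := nxt_in H St_in N).
    split.
    + rewrite (MS_sub H). ty.
    + intros Θ ρ R. erewrite mod_sub by ty. erewrite Tsub_cmp by ty. erewrite <- sl_cmp by ty.
      erewrite eps_sub; [| ty | ty | exact N'].
      erewrite <- sl_cmp by ty. erewrite nxt_sub; [| exact R | exact N].
      erewrite tl'_sub; [| ty | ty | exact K'].
      erewrite <- sl_cmp by ty. rewrite (sl_sl hδ hγ R). reflexivity.
  - rewrite !h_assoc, h_gl. intros Δ σ v H K.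
    assert (K1 : TmIn (lk (lk Δ hδ) hγ) S⌞sl hγ (sl hδ σ)⌟ v)
      by (rewrite lk_lk, (sl_δ_γ H); exact K).
    assert (K' : TmIn (lk (lk Δ (hδ · hγ)) hℓ) S⌞sl (hδ · hγ) σ⌟ v) by (nrm; exact K).
    assert (N := ky_in Δ le_dg).
    erewrite mod_sub; [| exact N | exact K'].
    rewrite <- (lk_lk Δ hδ hγ), <- (sl_δ_γ H), (tl'_beta (sl_δ H) K1).
    rewrite (sl_ky _ _ le_dg), !h_assoc, h_gl, h_1l, lk_1, (sl_δ_γ H).
    unfold nxt. erewrite mod_sub; [| apply ky_in, le_d | rewrite lk_lk; exact K].
    rewrite (sl_ky _ _ le_d), h_assoc.
    assert (T' : TyIn (lk Γ hγ) S) by exact HS.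
    assert (Q := key_in (κ' := hγ) H le_δγℓ HS K).
    assert (SL := sl_sl hℓ (hδ · hγ) H).
    (* The modal introduction carries its type along the key of [nxt]; the type has to be brought to
       the form that [eps_beta] expects over Δ.{ℓ}. *)
    assert (P : S⌞sl (hδ · hγ) σ⌟⌞ky Δ (hδ · hγ) (hℓ · (hδ · hγ))⌟ =
      S⌞sl (hδ · hγ) (sl hℓ σ)⌟).
    { rewrite SL, <- (key_base (κ := hγ) hγ H le_δγℓ).
      eapply Tsub_cmp; [exact HS | apply ky_in, le_δγℓ | apply sl_δγ, H]. }
    rewrite P. rewrite <- (lk_lk Δ hℓ hδ).
    rewrite eps_beta; [| ty | rewrite lk_lk, SL; exact Q].
    rewrite (ky_lk _ _ le_dg), h_1r.
    erewrite Msub_cmp; [| exact K | apply ky_in, le_ℓδγ | apply ky_in, le_δγℓ].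
    rewrite (ky_cmp _ le_δγℓ le_ℓδγ). f_equal.
    rewrite <- (key_base (κ := hγ) (ν := hℓ) hγ H (le_trans le_δγℓ le_ℓδγ)).
    eapply Tsub_cmp; [exact HS | apply ky_in, (le_trans le_δγℓ le_ℓδγ) | apply sl_δγ, H].
Qed.

(** As for [p0_eps], with [MS_key] for the second component. The occurrence of [eps] on the right
    stands under ℓ: this guardedness is what makes Löb induction applicable to [eps] composed with a
    morphism. *)
Lemma p1_eps Δ σ z :
  SubIn Δ L σ -> TmIn (lk Δ hδ) St⌞sl hδ σ⌟ z ->
  p1 Δ σ (eps Δ σ z) =
  mod Δ hℓ S⌞sl hℓ σ⌟ (eps (lk Δ hℓ) (sl hℓ σ) (nxt Δ (tl (lk Δ hδ) (sl hδ σ) z))).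
Proof.
  intros H K.
  assert (T : TyIn (lk L (hδ · hγ)) S) by (nrm; exact HS).
  assert (E : TMod (lk L hδ) hγ S = St) by (unfold St; nrm; reflexivity).
  eapply (@mod_ext _ _ _ L hδ hγ S MS
    (fun Δ σ z => p1 Δ σ (eps Δ σ z))
    (fun Δ σ z => mod Δ hℓ S⌞sl hℓ σ⌟
      (eps (lk Δ hℓ) (sl hℓ σ) (nxt Δ (tl (lk Δ hδ) (sl hδ σ) z)))));
    [exact T | ty | | | | exact H | rewrite E; exact K]; rewrite ?E; clear Δ σ z H K T.
  - intros Δ σ z H K. split; [ty|].
    intros Θ ρ R. erewrite p1_sub; [| exact H | exact R | ty]. erewrite eps_sub by eassumption.
    reflexivity.
  - intros Δ σ z H K.
    assert (N : TmIn (lk Δ hδ) St⌞sl hδ σ⌟ (tl (lk Δ hδ) (sl hδ σ) z)) by ty.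
    assert (N' := nxt_in H St_in N).
    split.
    + rewrite (MS_sub H). ty.
    + intros Θ ρ R. erewrite mod_sub by ty. erewrite Tsub_cmp by ty. erewrite <- sl_cmp by ty.
      erewrite eps_sub; [| ty | ty | exact N'].
      erewrite <- sl_cmp by ty. erewrite nxt_sub; [| exact R | exact N].
      erewrite tl_sub; [| ty | ty | exact K]. erewrite <- sl_cmp by ty. reflexivity.
  - intros Δ σ y H K.
    assert (K' : TmIn (lk (lk Δ hδ) hγ) S⌞sl hγ (sl hδ σ)⌟ y)
      by (rewrite lk_lk, (sl_δ_γ H); exact K).
    rewrite (eps_beta H K). rewrite <- (sl_δ_γ H), (tl_beta (sl_δ H) K').
    rewrite lk_lk, (sl_δ_γ H).
    assert (N := ky_in Δ le_dg). assert (H' := sl_δγ H).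
    rewrite <- MS_key by ty.
    erewrite p1_sub; [| exact H' | exact N | exact K].
    rewrite lk_1, (key_base (κ := hγ) hγ H le_dg), (sl_1 H). reflexivity.
Qed.

(** For z = mod_γ(y) the counit acts on y as the key γδγ ≤ γ, an identity between 1-cells into s.
    This is a triangle identity of the adjunction behind δ and γ. *)
Lemma mod_eps Ξ σ z :
  SubIn Ξ Γ σ -> TmIn Ξ St⌞σ⌟ z ->
  mod Ξ hγ S⌞sl hγ σ⌟ (eps (lk Ξ hγ) (sl hγ σ) z) = z.
Proof.
  intros H K.
  assert (T : TyIn (lk Γ (h1 · hγ)) S) by (nrm; exact HS).
  assert (E : TMod (lk Γ h1) hγ S = St) by (unfold St; nrm; reflexivity).
  assert (D : forall Ξ σ z, SubIn Ξ Γ σ -> TmIn Ξ St⌞σ⌟ z ->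
    TmIn (lk (lk Ξ hγ) hδ) St⌞sl hδ (sl hγ σ)⌟ z).
  { intros Ξ' σ' z' H' K'. rewrite (sl_sl hγ hδ H'). nrm. rewrite (sl_1 H'). exact K'. }
  eapply (@mod_ext _ _ _ Γ h1 hγ S St
    (fun Ξ σ z => mod Ξ hγ S⌞sl hγ σ⌟ (eps (lk Ξ hγ) (sl hγ σ) z))
    (fun Ξ σ z => z));
    [exact T | ty | | | | exact H | rewrite E, (sl_1 H), lk_1; exact K];
    rewrite ?E; clear Ξ σ z H K T.
  - intros Ξ σ z H K. rewrite lk_1, (sl_1 H) in K. assert (K' := D _ _ _ H K). split.
    + rewrite (St_sub H). ty.
    + intros Θ ρ R. erewrite mod_sub by ty. erewrite Tsub_cmp by ty. erewrite <- sl_cmp by ty.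
      erewrite eps_sub; [| ty | ty | exact K']. erewrite <- sl_cmp by ty.
      rewrite (sl_sl hγ hδ R), h_gd. reflexivity.
  - intros Ξ σ z H K. rewrite lk_1, (sl_1 H) in K. split; [exact K|].
    intros Θ ρ R. rewrite (sl_1 R). reflexivity.
  - rewrite h_1l. intros Ξ σ y H K. rewrite lk_1. f_equal.
    assert (SL : sl (hδ · hγ) (sl hγ σ) = sl hγ σ) by (rewrite (sl_sl hγ _ H); nrm; reflexivity).
    assert (B := @eps_beta (lk Ξ hγ) (sl hγ σ) y (sl_γ H)).
    revert B. rewrite SL, (ky_lk _ _ le_dg). nrm. rewrite ky_id. intros B.
    rewrite B by exact K. eapply Msub_id. exact K.
Qed.

(** * The coalgebra and its corecursor *)

Context (B : Ty mode_s) (HB : TyIn Γ B).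
Hint Resolve HB : ty.

Definition ap Ξ σ C f b := App Ξ h1 B⌞σ⌟ C⌞σ⌟ f⌜σ⌝ b.

Lemma Arr_B_sub Ξ σ C :
  SubIn Ξ Γ σ -> TyIn Γ C -> (Arr Γ h1 B C)⌞σ⌟ = Arr Ξ h1 B⌞σ⌟ C⌞σ⌟.
Proof. intros H K. erewrite Arr_sub by ty. rewrite (sl_1 H). reflexivity. Qed.
Lemma ap_in Ξ σ C f b :
  SubIn Ξ Γ σ -> TyIn Γ C -> TmIn Γ (Arr Γ h1 B C) f -> TmIn Ξ B⌞σ⌟ b ->
  TmIn Ξ C⌞σ⌟ (ap Ξ σ C f b).
Proof.
  intros H HC Hf Hb. apply App_in; [ty | | ty].
  rewrite <- (Arr_B_sub H HC). ty.
Qed.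
Lemma ap_sub Ξ Θ σ τ C f b :
  SubIn Ξ Γ σ -> SubIn Θ Ξ τ -> TyIn Γ C -> TmIn Γ (Arr Γ h1 B C) f -> TmIn Ξ B⌞σ⌟ b ->
  (ap Ξ σ C f b)⌜τ⌝ = ap Θ (σ • τ) C f b⌜τ⌝.
Proof.
  intros H K HC Hf Hb. unfold ap.
  assert (Hf' : TmIn Ξ (Arr Ξ h1 B⌞σ⌟ C⌞σ⌟) f⌜σ⌝).
  { rewrite <- (Arr_B_sub H HC). ty. }
  erewrite App_sub by ty. rewrite (sl_1 K). erewrite !Tsub_cmp, !Msub_cmp by ty. reflexivity.
Qed.
Lemma ap_ext C f g :
  TyIn Γ C -> TmIn Γ (Arr Γ h1 B C) f -> TmIn Γ (Arr Γ h1 B C) g ->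
  (forall Ξ σ b, SubIn Ξ Γ σ -> TmIn Ξ B⌞σ⌟ b -> ap Ξ σ C f b = ap Ξ σ C g b) -> f = g.
Proof.
  intros HC Hf Hg E. eapply App_ext; [| | exact Hf | exact Hg |]; [ty | ty |].
  intros Ξ σ b H K. rewrite lk_1, (sl_1 H) in *. apply E; assumption.
Qed.
Lemma ap_hlam Ξ σ C t b :
  TyIn Γ C -> fam Γ h1 B C t -> SubIn Ξ Γ σ -> TmIn Ξ B⌞σ⌟ b ->
  ap Ξ σ C (hlam Γ h1 B C t) b = t Ξ σ b.
Proof.
  intros HC Ht H K. unfold ap. rewrite <- (sl_1 H) at 1.
  apply hlam_app; [ty | exact HC | exact Ht | exact H | rewrite lk_1, (sl_1 H); exact K].
Qed.

Context (c : Tm mode_s) (Hc : TmIn Γ (Arr Γ h1 B (Prd Γ A B)) c).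
Hint Resolve Hc : ty.

Definition c0 Ξ σ b := P1 Ξ A⌞σ⌟ B⌞σ⌟ (ap Ξ σ (Prd Γ A B) c b).
Definition c1 Ξ σ b := P2 Ξ A⌞σ⌟ B⌞σ⌟ (ap Ξ σ (Prd Γ A B) c b).
Lemma ap_c_in Ξ σ b :
  SubIn Ξ Γ σ -> TmIn Ξ B⌞σ⌟ b ->
  TmIn Ξ (Prd Ξ A⌞σ⌟ B⌞σ⌟) (ap Ξ σ (Prd Γ A B) c b).
Proof. intros H K. erewrite <- Prd_sub by ty. apply ap_in; ty. Qed.
Hint Resolve ap_in ap_c_in : ty.
Lemma c0_in Ξ σ b : SubIn Ξ Γ σ -> TmIn Ξ B⌞σ⌟ b -> TmIn Ξ A⌞σ⌟ (c0 Ξ σ b).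
Proof. intros H K. unfold c0. ty. Qed.
Lemma c1_in Ξ σ b : SubIn Ξ Γ σ -> TmIn Ξ B⌞σ⌟ b -> TmIn Ξ B⌞σ⌟ (c1 Ξ σ b).
Proof. intros H K. unfold c1. ty. Qed.
Lemma c0_sub Ξ Θ σ τ b :
  SubIn Ξ Γ σ -> SubIn Θ Ξ τ -> TmIn Ξ B⌞σ⌟ b -> (c0 Ξ σ b)⌜τ⌝ = c0 Θ (σ • τ) b⌜τ⌝.
Proof.
  intros H M K. unfold c0. erewrite P1_sub, ap_sub, !Tsub_cmp by ty. reflexivity.
Qed.
Lemma c1_sub Ξ Θ σ τ b :
  SubIn Ξ Γ σ -> SubIn Θ Ξ τ -> TmIn Ξ B⌞σ⌟ b -> (c1 Ξ σ b)⌜τ⌝ = c1 Θ (σ • τ) b⌜τ⌝.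
Proof.
  intros H M K. unfold c1. erewrite P2_sub, ap_sub, !Tsub_cmp by ty. reflexivity.
Qed.
Hint Resolve c0_in c1_in : ty.

(* The type of the corecursor at mode t. *)
Definition Q := Arr L hδ B S.
Definition MQ := TMod L hℓ Q.
Lemma B_δ : TyIn (lk L hδ) B.
Proof. nrm. exact HB. Qed.
Hint Resolve B_δ : ty.
Lemma Q_in : TyIn L Q. Proof. unfold Q; ty. Qed.
Hint Resolve Q_in : ty.
Lemma Q_ℓ : TyIn (lk L hℓ) Q. Proof. nrm. ty. Qed.
Hint Resolve Q_ℓ : ty.
Lemma Q_sub Δ σ : SubIn Δ L σ -> Q⌞σ⌟ = Arr Δ hδ B⌞sl hδ σ⌟ S⌞σ⌟.
Proof. intros. unfold Q. erewrite Arr_sub by ty. reflexivity. Qed.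
Lemma MQ_sub Δ σ : SubIn Δ L σ -> MQ⌞σ⌟ = TMod Δ hℓ Q⌞sl hℓ σ⌟.
Proof. intros. unfold MQ. erewrite Mod_sub by ty. reflexivity. Qed.

Definition apQ Δ σ q b := App Δ hδ B⌞sl hδ σ⌟ S⌞σ⌟ q b.
Lemma apQ_in Δ σ q b :
  SubIn Δ L σ -> TmIn Δ Q⌞σ⌟ q -> TmIn (lk Δ hδ) B⌞sl hδ σ⌟ b -> TmIn Δ S⌞σ⌟ (apQ Δ σ q b).
Proof. intros H K M. rewrite (Q_sub H) in K. unfold apQ. ty. Qed.
Lemma apQ_sub Δ Θ σ τ q b :
  SubIn Δ L σ -> SubIn Θ Δ τ -> TmIn Δ Q⌞σ⌟ q -> TmIn (lk Δ hδ) B⌞sl hδ σ⌟ b ->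
  (apQ Δ σ q b)⌜τ⌝ = apQ Θ (σ • τ) q⌜τ⌝ b⌜sl hδ τ⌝.
Proof.
  intros H K M N. rewrite (Q_sub H) in M. unfold apQ. erewrite App_sub by ty.
  erewrite !Tsub_cmp by ty. erewrite <- sl_cmp by ty. reflexivity.
Qed.
Hint Resolve apQ_in : ty.

(** The applicative action of ▷: the recursive call q exists only under ℓ and is applied there to b,
    moved by [nxt]. Eliminating ▷ Q with this family gives [tlq]. *)
Definition unf (Δ : Ctx mode_t) σ b : family mode_t mode_t := fun Θ τ q =>
  mod Θ hℓ S⌞sl hℓ (σ • τ)⌟ (apQ (lk Θ hℓ) (sl hℓ (σ • τ)) q (nxt Θ b⌜sl hδ τ⌝)).
Lemma unf_fam Δ σ b :
  SubIn Δ L σ -> TmIn (lk Δ hδ) B⌞sl hδ σ⌟ b ->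
  fam Δ (h1 · hℓ) Q⌞sl hℓ σ⌟ MS⌞σ⌟ (unf Δ σ b).
Proof.
  intros H Hb Θ τ q K M. rewrite h_1l in *.
  assert (N : SubIn Θ L (σ • τ)) by ty.
  erewrite Tsub_cmp in M by ty. erewrite <- sl_cmp in M by ty.
  assert (Hb1 : TmIn (lk Θ hδ) B⌞sl hδ (σ • τ)⌟ b⌜sl hδ τ⌝).
  { erewrite sl_cmp by ty. erewrite <- Tsub_cmp by ty. ty. }
  assert (Hb' := nxt_in N HB Hb1).
  split.
  - erewrite Tsub_cmp by ty. rewrite (MS_sub N). unfold unf. ty.
  - intros Ω ρ R. unfold unf. erewrite mod_sub by ty. erewrite Tsub_cmp by ty.
    erewrite <- sl_cmp by ty. erewrite apQ_sub; [| ty | ty | exact M | exact Hb'].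
    erewrite nxt_sub; [| exact R | exact Hb1]. erewrite Msub_cmp by ty.
    erewrite <- !sl_cmp by ty. erewrite cmp_assoc by ty. reflexivity.
Qed.

Definition tlq Δ σ F b := hlet Δ h1 hℓ Q⌞sl hℓ σ⌟ MS⌞σ⌟ F (unf Δ σ b).
Lemma Q_1ℓ Δ σ : SubIn Δ L σ -> TyIn (lk Δ (h1 · hℓ)) Q⌞sl hℓ σ⌟.
Proof. intros. nrm. ty. Qed.
Lemma MQ_1 Δ σ F :
  SubIn Δ L σ -> TmIn Δ MQ⌞σ⌟ F -> TmIn (lk Δ h1) (TMod (lk Δ h1) hℓ Q⌞sl hℓ σ⌟) F.
Proof. intros H K. rewrite lk_1, <- (MQ_sub H). exact K. Qed.
Hint Resolve Q_1ℓ MQ_1 unf_fam : ty.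
Lemma tlq_in Δ σ F b :
  SubIn Δ L σ -> TmIn Δ MQ⌞σ⌟ F -> TmIn (lk Δ hδ) B⌞sl hδ σ⌟ b ->
  TmIn Δ MS⌞σ⌟ (tlq Δ σ F b).
Proof. intros. apply hlet_in; ty. Qed.
Lemma tlq_sub Δ Θ σ τ F b :
  SubIn Δ L σ -> SubIn Θ Δ τ -> TmIn Δ MQ⌞σ⌟ F -> TmIn (lk Δ hδ) B⌞sl hδ σ⌟ b ->
  (tlq Δ σ F b)⌜τ⌝ = tlq Θ (σ • τ) F⌜τ⌝ b⌜sl hδ τ⌝.
Proof.
  intros H K M N. unfold tlq.
  erewrite hlet_sub; [| ty | ty | ty | apply unf_fam; assumption | exact K].
  rewrite h_1l, (sl_1 K). erewrite !Tsub_cmp by ty. erewrite <- sl_cmp by ty.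
  unfold hlet, generic. f_equal. unfold unf.
  set (w := wk _ _ _). assert (W : SubIn (ex Θ (h1 · hℓ) Q⌞sl hℓ (σ • τ)⌟) Θ w)
    by (apply wk_in; nrm; ty).
  erewrite cmp_assoc by ty. erewrite Msub_cmp by ty. erewrite <- sl_cmp by ty. reflexivity.
Qed.
Lemma tlq_beta Δ σ q b :
  SubIn Δ L σ -> TmIn (lk Δ hℓ) Q⌞sl hℓ σ⌟ q -> TmIn (lk Δ hδ) B⌞sl hδ σ⌟ b ->
  tlq Δ σ (mod Δ hℓ Q⌞sl hℓ σ⌟ q) b =
  mod Δ hℓ S⌞sl hℓ σ⌟ (apQ (lk Δ hℓ) (sl hℓ σ) q (nxt Δ b)).
Proof.
  intros H K M. unfold tlq. rewrite <- (lk_1 Δ) at 2.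
  rewrite hlet_beta; [| ty | nrm; exact K | apply unf_fam; assumption].
  unfold unf. rewrite (id_r H), sl_id. erewrite Msub_id by ty. reflexivity.
Qed.
Hint Resolve tlq_in : ty.

Definition body Δ σ F b :=
  Pr Δ MA⌞σ⌟ MS⌞σ⌟ (mod Δ hδ A⌞sl hδ σ⌟ (c0 (lk Δ hδ) (sl hδ σ) b))
    (tlq Δ σ F (c1 (lk Δ hδ) (sl hδ σ) b)).
Lemma body_in Δ σ F b :
  SubIn Δ L σ -> TmIn Δ MQ⌞σ⌟ F -> TmIn (lk Δ hδ) B⌞sl hδ σ⌟ b ->
  TmIn Δ S⌞σ⌟ (body Δ σ F b).
Proof.
  intros H K M. rewrite (S_sub H). apply Pr_in; [rewrite (MA_sub H)|]; ty.
Qed.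
Lemma body_sub Δ Θ σ τ F b :
  SubIn Δ L σ -> SubIn Θ Δ τ -> TmIn Δ MQ⌞σ⌟ F -> TmIn (lk Δ hδ) B⌞sl hδ σ⌟ b ->
  (body Δ σ F b)⌜τ⌝ = body Θ (σ • τ) F⌜τ⌝ b⌜sl hδ τ⌝.
Proof.
  intros H K M N. unfold body.
  erewrite Pr_sub; [| exact K | rewrite (MA_sub H); ty | ty].
  erewrite mod_sub by ty. erewrite c0_sub by ty.
  erewrite tlq_sub; [| exact H | exact K | exact M | ty].
  erewrite c1_sub by ty. erewrite !Tsub_cmp by ty. erewrite <- sl_cmp by ty. reflexivity.
Qed.

Definition stepQ : family mode_t mode_t := fun Δ σ F =>
  hlam Δ hδ B⌞sl hδ σ⌟ S⌞σ⌟ (fun Θ τ b => body Θ (σ • τ) F⌜τ⌝ b).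
Lemma body_fam Δ σ F :
  SubIn Δ L σ -> TmIn Δ MQ⌞σ⌟ F ->
  fam Δ hδ B⌞sl hδ σ⌟ S⌞σ⌟ (fun Θ τ b => body Θ (σ • τ) F⌜τ⌝ b).
Proof.
  intros H K Θ τ b M N. erewrite Tsub_cmp in N by ty. erewrite <- sl_cmp in N by ty.
  assert (K' : TmIn Θ MQ⌞σ • τ⌟ F⌜τ⌝) by (erewrite <- Tsub_cmp by ty; ty).
  split.
  - erewrite Tsub_cmp by ty. apply body_in; ty.
  - intros Ω ρ R. erewrite body_sub; [| ty | exact R | exact K' | exact N].
    erewrite cmp_assoc, Msub_cmp by ty. reflexivity.
Qed.
Lemma stepQ_fam : fam L h1 MQ Q stepQ.
Proof.
  intros Δ σ F H K. rewrite lk_1, (sl_1 H) in K. split.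
  - rewrite (Q_sub H). apply hlam_in; [ty | ty | apply body_fam; assumption].
  - intros Θ ρ R. unfold stepQ.
    erewrite hlam_sub; [| ty | ty | apply body_fam; assumption | exact R].
    rewrite (sl_1 R). erewrite !Tsub_cmp by ty. erewrite <- sl_cmp by ty.
    unfold hlam, generic. f_equal.
    assert (W : SubIn (ex Θ hδ B⌞sl hδ (σ • ρ)⌟) Θ (wk Θ hδ B⌞sl hδ (σ • ρ)⌟)) by ty.
    erewrite cmp_assoc, Msub_cmp by ty. reflexivity.
Qed.

Definition φQ := hlam L h1 MQ Q stepQ.
(** The key 1 ≤ ℓ is an identity over L, so Q is not changed by it; likewise for terms in
    [NextQ]. *)
Lemma LaterQ : Later L Q = MQ.
Proof.
  unfold Later. rewrite (ky_base _ _ hγ le_1l), Tsub_id by ty. reflexivity.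
Qed.
Lemma NextQ q : TmIn L Q q -> Next L Q q = mod L hℓ Q q.
Proof.
  intros H. unfold Next. rewrite (ky_base _ _ hγ le_1l), Tsub_id by ty.
  erewrite Msub_id by ty. reflexivity.
Qed.
Lemma φQ_in : TmIn L (Arr L h1 (Later L Q) Q) φQ.
Proof. rewrite LaterQ. apply hlam_in; [ty | ty | apply stepQ_fam]. Qed.

(** One unfolding, read pointwise at every stage: β for [φQ], for the abstraction over b, and for
    the elimination of [mod_ℓ(q)]. *)
Lemma unfold_φQ q Δ σ b :
  TmIn L Q q -> SubIn Δ L σ -> TmIn (lk Δ hδ) B⌞sl hδ σ⌟ b ->
  apQ Δ σ (App L h1 (Later L Q) Q φQ (Next L Q q))⌜σ⌝ b =
  Pr Δ MA⌞σ⌟ MS⌞σ⌟ (mod Δ hδ A⌞sl hδ σ⌟ (c0 (lk Δ hδ) (sl hδ σ) b))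
    (mod Δ hℓ S⌞sl hℓ σ⌟
      (apQ (lk Δ hℓ) (sl hℓ σ) q⌜sl hℓ σ⌝ (nxt Δ (c1 (lk Δ hδ) (sl hδ σ) b)))).
Proof.
  intros Hq H Hb. assert (P := φQ_in). rewrite LaterQ, (NextQ Hq) in *.
  assert (Hq' : TmIn (lk L hℓ) Q q) by (nrm; exact Hq).
  assert (HM : TmIn L MQ (mod L hℓ Q q)) by (unfold MQ; ty).
  erewrite App_sub; [| exact H | ty | exact P | ty].
  rewrite !(sl_1 H). erewrite mod_sub by ty.
  assert (HF : TmIn Δ MQ⌞σ⌟ (mod Δ hℓ Q⌞sl hℓ σ⌟ q⌜sl hℓ σ⌝)).
  { rewrite (MQ_sub H). apply mod_in. ty. }
  rewrite <- (sl_1 H) at 2. unfold φQ.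
  rewrite hlam_app; [| ty | ty | apply stepQ_fam | exact H | rewrite lk_1, (sl_1 H); exact HF].
  assert (X := hlam_app (Γ := Δ) (μ := hδ) (A := B⌞sl hδ σ⌟) (C := S⌞σ⌟) (τ := ids Δ) (a := b)
    (Tsub_in HB (sl_δ H)) (Tsub_in HS H) (body_fam H HF) (ids_in Δ)).
  rewrite sl_id, !Tsub_id in X by ty. rewrite (id_r H) in X.
  fold (stepQ Δ σ (mod Δ hℓ Q⌞sl hℓ σ⌟ q⌜sl hℓ σ⌝)) in X.
  assert (Y : TmIn Δ Q⌞σ⌟ (stepQ Δ σ (mod Δ hℓ Q⌞sl hℓ σ⌟ q⌜sl hℓ σ⌝))).
  { eapply fam_in; [apply stepQ_fam | exact H | rewrite lk_1, (sl_1 H); exact HF]. }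
  rewrite (Msub_id Y), (Msub_id HF) in X. unfold apQ at 1.
  rewrite X by exact Hb. unfold body. rewrite tlq_beta by ty. reflexivity.
Qed.

(** Componentwise and at all stages, in place of the single equation in a context with one variable;
    [hom_iff] compares the two. *)
Definition is_hom f := forall Ξ σ b, SubIn Ξ Γ σ -> TmIn Ξ B⌞σ⌟ b ->
  hd Ξ σ (ap Ξ σ St f b) = c0 Ξ σ b /\ tl Ξ σ (ap Ξ σ St f b) = ap Ξ σ St f (c1 Ξ σ b).

Lemma B_γδ Ξ σ b : SubIn Ξ Γ σ -> TmIn Ξ B⌞σ⌟ b -> TmIn (lk (lk Ξ hγ) hδ) B⌞sl hδ (sl hγ σ)⌟ b.
Proof. intros H K. rewrite (sl_sl hγ hδ H). nrm. rewrite (sl_1 H). exact K. Qed.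

Section Solution.
Context (q : Tm mode_t) (Hq : TmIn L Q q).
Context (Hfix : q = App L h1 (Later L Q) Q φQ (Next L Q q)).
Hint Resolve Hq : ty.

(** The corecursor expects its argument in Ξ.{γ}.{δ}, which is Ξ, so b is passed on unchanged. *)
Definition ana_fam : family mode_s mode_s := fun Ξ σ b =>
  mod Ξ hγ S⌞sl hγ σ⌟ (apQ (lk Ξ hγ) (sl hγ σ) q⌜sl hγ σ⌝ b).
Lemma ana_fam_ok : fam Γ h1 B St ana_fam.
Proof.
  intros Ξ σ b H K. rewrite lk_1, (sl_1 H) in K. assert (K' := B_γδ H K). split.
  - rewrite (St_sub H). unfold ana_fam. ty.
  - intros Θ ρ R. unfold ana_fam. erewrite mod_sub by ty. erewrite apQ_sub by ty.
    erewrite Tsub_cmp, Msub_cmp by ty. erewrite <- sl_cmp by ty.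
    rewrite (sl_sl hγ hδ R), h_gd. reflexivity.
Qed.
Definition ana := hlam Γ h1 B St ana_fam.
Lemma ana_in : TmIn Γ (Arr Γ h1 B St) ana.
Proof. apply hlam_in; [ty | ty | apply ana_fam_ok]. Qed.

Lemma apQ_sol Δ σ b :
  SubIn Δ L σ -> TmIn (lk Δ hδ) B⌞sl hδ σ⌟ b ->
  apQ Δ σ q⌜σ⌝ b =
  Pr Δ MA⌞σ⌟ MS⌞σ⌟ (mod Δ hδ A⌞sl hδ σ⌟ (c0 (lk Δ hδ) (sl hδ σ) b))
    (mod Δ hℓ S⌞sl hℓ σ⌟
      (apQ (lk Δ hℓ) (sl hℓ σ) q⌜sl hℓ σ⌝ (nxt Δ (c1 (lk Δ hδ) (sl hδ σ) b)))).
Proof. intros H K. rewrite Hfix at 1. apply unfold_φQ; assumption. Qed.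

Lemma ana_hom : is_hom ana.
Proof.
  intros Ξ σ b H K. assert (K' := B_γδ H K).
  assert (F := ana_fam_ok). unfold ana. rewrite !ap_hlam by ty. unfold ana_fam.
  assert (N := sl_γ H).
  assert (M : TmIn (lk Ξ hγ) Q⌞sl hγ σ⌟ q⌜sl hγ σ⌝) by ty.
  assert (M' : TmIn (lk (lk Ξ hγ) hℓ) Q⌞sl hℓ (sl hγ σ)⌟ q⌜sl hℓ (sl hγ σ)⌝) by ty.
  assert (W : SubIn (lk (lk Ξ hγ) hδ) Γ (sl hδ (sl hγ σ))) by ty.
  assert (W' : TmIn (lk (lk Ξ hγ) hδ) A⌞sl hδ (sl hγ σ)⌟ (c0 (lk (lk Ξ hγ) hδ) (sl hδ (sl hγ σ)) b))
    by ty.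
  assert (V : TmIn (lk (lk Ξ hγ) hδ) B⌞sl hδ (sl hγ σ)⌟ (c1 (lk (lk Ξ hγ) hδ) (sl hδ (sl hγ σ)) b))
    by ty.
  assert (V' := nxt_in N HB V).
  assert (ESL : sl hδ (sl hγ σ) = σ) by (rewrite (sl_sl hγ hδ H), h_gd; apply (sl_1 H)).
  assert (ELK : lk (lk Ξ hγ) hδ = Ξ) by (nrm; reflexivity).
  assert (X1 : TmIn (lk Ξ hγ) MA⌞sl hγ σ⌟ (mod (lk Ξ hγ) hδ A⌞sl hδ (sl hγ σ)⌟
    (c0 (lk (lk Ξ hγ) hδ) (sl hδ (sl hγ σ)) b))) by (rewrite (MA_sub N); ty).
  assert (X2 : TmIn (lk Ξ hγ) MS⌞sl hγ σ⌟ (mod (lk Ξ hγ) hℓ S⌞sl hℓ (sl hγ σ)⌟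
    (apQ (lk (lk Ξ hγ) hℓ) (sl hℓ (sl hγ σ)) q⌜sl hℓ (sl hγ σ)⌝
      (nxt (lk Ξ hγ) (c1 (lk (lk Ξ hγ) hδ) (sl hδ (sl hγ σ)) b))))) by (rewrite (MS_sub N); ty).
  split.
  - rewrite hd_beta by ty. rewrite apQ_sol by ty. unfold p0. rewrite P1_Pr by assumption.
    rewrite ESL, ELK. apply hd'_beta; ty.
  - rewrite tl_beta by ty. rewrite apQ_sol by ty. unfold p1. rewrite P2_Pr by assumption.
    rewrite ESL, ELK in *.
    (* Over Ξ.{γ} the key of [nxt] is γδ ≤ γℓδ, an identity, and the recursive call is again a value
       of [ana_fam]. *)
    assert (EN : nxt (lk Ξ hγ) (c1 Ξ σ b) = c1 Ξ σ b).
    { unfold nxt. rewrite (ky_lk _ _ le_d). nrm. rewrite ky_id, lk_1.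
      eapply Msub_id. exact V. }
    rewrite EN in *. rewrite (sl_sl hγ hℓ H) in *. autorewrite with hm in *.
    apply tl'_beta; [exact H | apply apQ_in; [exact N | exact M | apply B_γδ; ty]].
Qed.

Lemma ana_unique g : TmIn Γ (Arr Γ h1 B St) g -> is_hom g -> g = ana.
Proof.
  intros Hg Gg. assert (HSt := St_in).
  assert (F : fam L hδ B S (fun Δ σ b => eps Δ σ (ap (lk Δ hδ) (sl hδ σ) St g b))).
  { intros Δ σ b H K. split; [ty|]. intros Θ ρ R.
    erewrite eps_sub by ty. erewrite ap_sub by ty. erewrite <- sl_cmp by ty. reflexivity. }
  set (g' := hlam L hδ B S (fun Δ σ b => eps Δ σ (ap (lk Δ hδ) (sl hδ σ) St g b))).
  assert (Hg' : TmIn L Q g') by (apply hlam_in; ty).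
  assert (G' : forall Δ σ b, SubIn Δ L σ -> TmIn (lk Δ hδ) B⌞sl hδ σ⌟ b ->
    apQ Δ σ g'⌜σ⌝ b = eps Δ σ (ap (lk Δ hδ) (sl hδ σ) St g b)).
  { intros Δ σ b H K. unfold apQ, g'. rewrite hlam_app; [reflexivity | ty ..]. }
  assert (E : g' = q).
  { assert (P := φQ_in).
    assert (Hn := Next_in Hg').
    eapply loeb_unique; [apply Q_in | exact P | exact Hg' | exact Hq | | exact Hfix].
    eapply App_ext; [| | exact Hg' | |].
    - ty.
    - ty.
    - fold Q. apply App_in; [ty | exact P | ty].
    - intros Δ σ b H K.
      change (apQ Δ σ g'⌜σ⌝ b =
        apQ Δ σ (App L h1 (Later L Q) Q φQ (Next L Q g'))⌜σ⌝ b).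
      rewrite unfold_φQ by ty. rewrite G' by ty.
      assert (W := sl_δ H). destruct (Gg _ _ _ W K) as [E0 E1].
      assert (Kg : TmIn (lk Δ hδ) St⌞sl hδ σ⌟ (ap (lk Δ hδ) (sl hδ σ) St g b)) by ty.
      assert (Ke : TmIn Δ (Prd Δ MA⌞σ⌟ MS⌞σ⌟)
        (eps Δ σ (ap (lk Δ hδ) (sl hδ σ) St g b))) by (rewrite <- (S_sub H); ty).
      (* The right side is already a pair. Expanding the left side by η exposes the two components
         of [eps], where the morphism equations [E0] and [E1] can be used. *)
      rewrite <- (Pr_eta (Tsub_in MA_in H) (Tsub_in MS_in H) Ke).
      fold (p0 Δ σ (eps Δ σ (ap (lk Δ hδ) (sl hδ σ) St g b))).
      fold (p1 Δ σ (eps Δ σ (ap (lk Δ hδ) (sl hδ σ) St g b))).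
      rewrite (p0_eps H Kg), (p1_eps H Kg), E0, E1.
      assert (K1 := c1_in W K). assert (Kn := nxt_in H HB K1).
      rewrite (G' _ _ _ (sl_ℓ H) Kn). do 3 f_equal.
      (* The remaining difference is whether [nxt] is taken before or after applying g. They agree
         because g comes from Γ and so is not affected by keys of the stage. *)
      unfold nxt. erewrite ap_sub; [| exact W | apply ky_in, le_d | ty | exact Hg | exact K1].
      rewrite (key_base (κ := hγ) h1 H le_d), <- (sl_sl hℓ hδ H), lk_lk. reflexivity. }
  apply ap_ext with (C := St); [ty | exact Hg | apply ana_in |].
  intros Ξ σ b H K. unfold ana. rewrite ap_hlam by (ty || apply ana_fam_ok).
  unfold ana_fam. rewrite <- E, G' by (ty || apply B_γδ; assumption).
  rewrite (sl_sl hγ hδ H), lk_lk, h_gd, (sl_1 H), lk_1. symmetry. apply mod_eps; ty.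
Qed.
End Solution.

Theorem final_St :
  exists f, TmIn Γ (Arr Γ h1 B St) f /\ is_hom f /\
    forall g, TmIn Γ (Arr Γ h1 B St) g -> is_hom g -> g = f.
Proof.
  destruct (loeb_ex Q_in φQ_in) as (q & Hq & E).
  exists (ana q). split; [|split].
  - apply ana_in, Hq.
  - apply ana_hom; assumption.
  - intros g. apply ana_unique; assumption.
Qed.
End Streams.

(** * The code of streams *)

Section Arrows.
Context {m : mode}.
Implicit Types (Γ : Ctx m) (A C : Ty m) (a F : Tm m) (G : ctx m) (X Y : ty m) (x f : tm m).
Lemma arr_spec Γ A C G X Y :
  G ∈ Γ -> (G, X) ∈ A -> (G, Y) ∈ C -> (G, arr X Y) ∈ Arr Γ h1 A C.
Proof. intros. ones. unfold Arr, arr. rep. Qed.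
Lemma app_nd_spec Γ A C F a G X Y f x :
  G ∈ Γ -> (G, X) ∈ A -> (G, Y) ∈ C -> (G, arr X Y, f) ∈ F -> (G, X, x) ∈ a ->
  (G, Y, app X Y f x) ∈ App Γ h1 A C F a.
Proof.
  intros. ones. eapply App_spec; [eassumption | rep | eassumption | | eassumption ..]. rep.
Qed.
End Arrows.

Lemma TU_in {m} (Γ : Ctx m) t σ Δ :
  TmIn Δ (TU Δ) t -> SubIn Γ Δ σ -> TmIn Γ (TU Γ) t⌜σ⌝.
Proof. intros H K. rewrite <- (U_sub K). ty. Qed.

Lemma tm_U {m} (Γ : Ctx m) G X (t : Tm m) r :
  G ∈ Γ -> (G, X) ∈ TU Γ -> (G, X, r) ∈ t -> (G, Univ, r) ∈ t.
Proof. intros. eapply tm_conv; [eassumption .. | rep]. Qed.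

Section StreamCode.
Context (Γ : Ctx mode_s) (α : Tm mode_s) (Hα : TmIn Γ (TU Γ) α).
Notation L := (lk Γ hγ).

(** The code of streams is specified by its equation, which has at most one solution. Its stability
    under substitution then needs no inspection of [Str']: a substituted solution solves the
    substituted equation. *)
Definition is_Str X := TmIn L (TU L) X /\ X = cprod L (cmod L hδ α) (cmod L hℓ X).

Lemma α_δ : TmIn (lk L hδ) (TU (lk L hδ)) α.
Proof. nrm. exact Hα. Qed.
Hint Resolve α_δ : ty.

Notation Λ := (ex L h1 (Later L (TU L))).
Notation w := (wk L h1 (Later L (TU L))).
Notation v := (var' L h1 (Later L (TU L))).

Definition cmod_fam : family mode_t mode_t := fun Θ _ y => cmod Θ hℓ y.
Lemma cmod_fam_ok Δ : fam Δ (h1 · hℓ) (TU (lk Δ (h1 · hℓ))) (TU Δ) cmod_fam.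
Proof.
  intros Θ τ y H K. rewrite h_1l in *. rewrite (U_sub (sl_in _ H)) in K. split.
  - rewrite (U_sub H). apply cmod_in. exact K.
  - intros Ξ ρ R. unfold cmod_fam. eapply cmod_sub; eassumption.
Qed.
Definition later_code Δ z := hlet Δ h1 hℓ (TU (lk Δ (h1 · hℓ))) (TU Δ) z cmod_fam.

Lemma Later_U : Later L (TU L) = TMod L hℓ (TU L).
Proof.
  unfold Later. rewrite (ky_base _ _ hγ le_1l), Tsub_id by ty. reflexivity.
Qed.
Lemma U_L : TyIn (lk L hℓ) (TU L).
Proof. nrm. ty. Qed.
Hint Resolve U_L : ty.
Lemma w_in : SubIn Λ L w.
Proof. ty. Qed.
Lemma Later_w : (Later L (TU L))⌞w⌟ = TMod Λ hℓ (TU (lk Λ hℓ)).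
Proof.
  rewrite Later_U. assert (W := w_in). rewrite Later_U in W. erewrite Mod_sub by ty.
  rewrite <- (lk_base Γ hγ hγ hℓ) at 4.
  rewrite (U_sub (sl_in hℓ W)). reflexivity.
Qed.
Lemma v_in : TmIn Λ (TMod Λ hℓ (TU (lk Λ hℓ))) v.
Proof.
  assert (V := var_in (ty_1 (Later_in (U_in L)))).
  rewrite lk_1, (sl_1 w_in), Later_w in V. exact V.
Qed.

Definition step_code :=
  Lam L h1 (Later L (TU L)) (TU L) (cprod Λ (cmod L hδ α)⌜w⌝ (later_code Λ v)).

Lemma v_in1 : TmIn (lk Λ h1) (TMod (lk Λ h1) hℓ (TU (lk Λ (h1 · hℓ)))) v.
Proof. rewrite lk_1, h_1l. apply v_in. Qed.
Lemma later_code_in : TmIn Λ (TU Λ) (later_code Λ v).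
Proof. apply hlet_in; [ty | ty | apply v_in1 | apply cmod_fam_ok]. Qed.
Lemma step_body_in : TmIn Λ (TU Λ) (cprod Λ (cmod L hδ α)⌜w⌝ (later_code Λ v)).
Proof. apply cprod_in; [eapply TU_in; ty | apply later_code_in]. Qed.
Lemma step_code_in : TmIn L (Arr L h1 (Later L (TU L)) (TU L)) step_code.
Proof. apply Lam_in; [ty | ty | rewrite (U_sub w_in); apply step_body_in]. Qed.

(** Over L the key in [Next] is an identity, so after β the elimination of ⟨ℓ | U⟩ meets [mod_ℓ(X)]
    itself and computes. *)
Lemma step_code_app X :
  TmIn L (TU L) X ->
  App L h1 (Later L (TU L)) (TU L) step_code (Next L (TU L) X) =
  cprod L (cmod L hδ α) (cmod L hℓ X).
Proof.
  intros H. assert (N := Next_in H). assert (W := w_in).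
  assert (I := ins_in (tm_1 N)). assert (J := wk_ins (tm_1 N)).
  unfold step_code. rewrite App_Lam; [| ty | rewrite (U_sub W); apply step_body_in | ty].
  erewrite cprod_sub; [| exact I | eapply TU_in; ty | apply later_code_in].
  erewrite Msub_cmp by ty. rewrite J. erewrite Msub_id by ty. f_equal.
  unfold later_code.
  erewrite hlet_sub; [| ty | ty | apply v_in1 | apply cmod_fam_ok | exact I].
  rewrite (U_sub I), (U_sub (sl_in _ I)), var_ins by ty.
  unfold Next. rewrite (ky_base _ _ hγ le_1l), Tsub_id by ty. erewrite Msub_id by ty.
  assert (EU : TU (lk L (h1 · hℓ)) = TU L) by (nrm; reflexivity). rewrite EU.
  replace (mod L hℓ (TU L) X) with (mod (lk L h1) hℓ (TU L) X) by (rewrite lk_1; reflexivity).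
  rewrite hlet_beta; [reflexivity | ty | nrm; exact H |].
  assert (F := @cmod_fam_ok L). rewrite EU in F. exact F.
Qed.

Lemma is_Str_unique X Y : is_Str X -> is_Str Y -> X = Y.
Proof.
  intros [HX EX] [HY EY].
  eapply loeb_unique; [apply U_in | apply step_code_in | exact HX | exact HY | |];
    rewrite step_code_app; assumption.
Qed.
End StreamCode.

Lemma is_Str_sub Γ Ξ α X σ :
  TmIn Γ (TU Γ) α -> SubIn Ξ Γ σ -> is_Str Γ α X -> is_Str Ξ α⌜σ⌝ X⌜sl hγ σ⌝.
Proof.
  intros Hα H [HX EX]. assert (K := sl_in hγ H). split; [eapply TU_in; ty |].
  assert (Xℓ : TmIn (lk (lk Γ hγ) hℓ) (TU (lk (lk Γ hγ) hℓ)) X) by (nrm; exact HX).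
  assert (αδ : TmIn (lk (lk Γ hγ) hδ) (TU (lk (lk Γ hγ) hδ)) α) by (nrm; exact Hα).
  rewrite EX at 1. erewrite cprod_sub by ty. erewrite !cmod_sub by ty.
  rewrite (sl_sl hγ hδ H), (sl_sl hγ hℓ H). nrm. rewrite (sl_1 H). reflexivity.
Qed.

(** The raw step function is shown to represent [step_code]; [loeb_spec] then yields a class that
    contains [Str' G a] and satisfies the equation. *)
Lemma Str'_spec Γ α G a :
  G ∈ Γ -> (G, Univ, a) ∈ α ->
  exists X, is_Str Γ α X /\ (lock G gam, Univ, Str' G a) ∈ X.
Proof.
  intros HG Ha. set (L := lk Γ hγ).
  assert (Hα : TmIn Γ (TU Γ) α) by (eapply TmIn_intro; rep).
  assert (HL : lock G gam ∈ L) by (unfold L; rep).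
  assert (HU : (lock G gam, Univ) ∈ TU L) by rep.
  assert (Hl := later_spec HL HU). assert (Hl1 := ty_one (ctx_ok HL) Hl).
  set (Λ := ex L h1 (Later L (TU L))). set (w := wk L h1 (Later L (TU L))).
  set (Gx := ext (lock G gam) one (later (lock G gam) Univ)).
  assert (HΛ : Gx ∈ Λ) by (unfold Gx, Λ; rep).
  assert (W : SubIn Λ L w) by apply w_in.
  assert (Kw : (Gx, lock G gam, swk) ∈ w) by (unfold w, Gx; rep).
  (* By γδ = 1 the code over G is also one over G.{γ}.{δ}, where Δ A uses it. *)
  assert (Ha' : (lock (lock G gam) del, Univ, a) ∈ α).
  { eapply tm_ctx with (Γ := Γ); [exact Ha | exact HG |]. rewrite <- (lk_1 Γ), <- h_gd, <- lk_lk.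
    rep. }
  (* The bound variable has the weakened type [later Univ]; keys and weakenings fix the universe,
     which leaves ⟨ℓ | U⟩, the type eliminated by the raw step. *)
  assert (Kv : (lock Gx one, Mod ell Univ, var) ∈ var' L h1 (Later L (TU L))).
  { eapply tm_conv with (A := (later (lock G gam) Univ)⟦slock one swk⟧)
      (T := (Later L (TU L))⌞sl h1 w⌟); [rep | rep |].
    rewrite (sl_1 W). assert (EW := Later_w Γ). fold L in EW. fold Λ w in EW. rewrite EW.
    apply ty_one; [exact (ctx_ok HΛ) | rep]. }
  assert (HUx : (lock (lock Gx one) ell, Univ) ∈ TU (lk Λ (h1 · hℓ)))
    by (apply U_spec; rewrite <- lk_lk; rep).
  assert (HUx' := ty_lk (ctx_ok HΛ) HUx).
  assert (Kb : (Gx, Univ, tlet one ell Univ Univ var (code_mod ell var)) ∈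
    later_code Λ (var' L h1 (Later L (TU L)))).
  { unfold later_code, hlet. eapply Let_spec with (Z' := Univ);
      [exact HΛ | rep | rep | exact HUx | rep | | exact Kv | |].
    - erewrite U_sub; [| apply wk_in; ty].
      apply U_spec. rep.
    - erewrite U_sub; [| apply wk_in; ty]. apply U_spec. rep.
    - unfold generic, cmod_fam. apply cmod_spec; [rep | rep |].
      assert (O : one ∘ ell ∈ hℓ) by (rewrite <- h_1l; rep).
      set (U1 := TU (lk Λ (h1 · hℓ))) in *.
      assert (KE : ext Gx (one ∘ ell) Univ ∈ ex Λ (h1 · hℓ) U1) by rep.
      assert (W1 : SubIn (ex Λ (h1 · hℓ) U1) Λ (wk Λ (h1 · hℓ) U1)) by (apply wk_in; unfold U1; ty).
      assert (V : (lock (ext Gx (one ∘ ell) Univ) (one ∘ ell), Univ⟦slock (one ∘ ell) swk⟧, var)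
        ∈ var' Λ (h1 · hℓ) U1) by rep.
      eapply tm_U; [rep | | eapply tm_ctx with (Γ := lk (ex Λ (h1 · hℓ) U1) hℓ); [exact V | rep | rep]].
      erewrite <- U_sub; [| exact (sl_in hℓ W1)].
      replace (TU (lk Λ hℓ)) with U1 by (unfold U1; rewrite h_1l; reflexivity).
      eapply ty_ctx with (Γ := lk (ex Λ (h1 · hℓ) U1) hℓ); rep. }
  assert (Kc : (Gx, Univ, (code_mod del a)⟪swk⟫) ∈ (cmod L hδ α)⌜w⌝).
  { eapply tm_U; [exact HΛ | | eapply Msub_spec; [apply cmod_spec; [exact HL | rep | exact Ha'] | exact Kw]].
    rewrite <- (U_sub W). rep. }
  assert (Ks : (lock G gam, arr (later (lock G gam) Univ) Univ, Str'_step G a)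
    ∈ step_code Γ α).
  { unfold step_code, Lam. eapply lam_spec; [exact HL | rep | exact Hl1 | rep |].
    eapply tm_conv with (T := TU Λ) (A := Univ).
    - apply cprod_spec; [exact HΛ | exact Kc | exact Kb].
    - rep.
    - rewrite <- (U_sub W). rep. }
  destruct (loeb_spec HL HU Ks) as (X & KX & EX).
  assert (HX : TmIn L (TU L) X) by (eapply TmIn_intro; eassumption).
  exists X. split; [split; [exact HX|] | exact KX].
  rewrite EX at 1. apply step_code_app; assumption.
Qed.

(** * Representatives of the raw definitions *)

Section Final.
Context (Γ : Ctx mode_s) (α : Tm mode_s) (X : Tm mode_t).
Context (Hα : TmIn Γ (TU Γ) α) (HX : is_Str Γ α X).
Notation L := (lk Γ hγ).
Notation A := (TEl α).
Notation S := (TEl X).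
Notation St := (St Γ S).

Lemma El_α_in : TyIn Γ A.
Proof. ty. Qed.
Lemma El_X_in : TyIn L S.
Proof. destruct HX. ty. Qed.
Lemma El_X_unfold : S = Prd L (TMod L hδ A) (TMod L hℓ S).
Proof.
  destruct HX as [K E]. rewrite E at 1.
  assert (X1 : TmIn (lk L hℓ) (TU (lk L hℓ)) X) by (nrm; exact K).
  assert (X2 : TmIn (lk L hδ) (TU (lk L hδ)) α) by (nrm; exact Hα).
  rewrite El_cprod, !El_cmod by ty. reflexivity.
Qed.
Lemma St_El_in : TyIn Γ St.
Proof. apply St_in, El_X_in. Qed.
Lemma El_Str : TEl (cmod Γ hγ X) = St.
Proof. destruct HX. apply El_cmod. assumption. Qed.
Hint Resolve El_α_in El_X_in St_El_in : ty.

Section Stage.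
Context (Ξ : Ctx mode_s) (σ : Sub mode_s) (Hσ : SubIn Ξ Γ σ).
Context (G : ctx mode_s) (a : tm mode_s) (HG : G ∈ Ξ) (Ha : (G, Univ, a) ∈ α⌜σ⌝).

(** The raw [uncons] forms [Str'] anew in the extended context from the weakened code. Uniqueness of
    the solution identifies the result with the substituted X. *)
Lemma Str'_stage : (lock G gam, Univ, Str' G a) ∈ X⌜sl hγ σ⌝.
Proof.
  destruct (Str'_spec HG Ha) as (Y & HY & K).
  rewrite (is_Str_unique (TU_in Hα Hσ) (is_Str_sub Hα Hσ HX) HY). exact K.
Qed.
Lemma A_stage : (G, El a) ∈ A⌞σ⌟.
Proof. erewrite El_sub; [| exact Hα | exact Hσ]. rep. Qed.
Lemma S_stage : (lock G gam, El (Str' G a)) ∈ S⌞sl hγ σ⌟.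
Proof.
  destruct HX as [K _]. erewrite El_sub; [| exact K | ty]. apply El_spec, Str'_stage.
Qed.
Lemma St_stage : (G, El (Str G a)) ∈ St⌞σ⌟.
Proof.
  destruct HX as [K _]. rewrite <- El_Str.
  erewrite El_sub; [| apply cmod_in, K | exact Hσ].
  erewrite cmod_sub; [| exact Hσ | exact K]. apply El_spec, cmod_spec; [rep | rep |].
  apply Str'_stage.
Qed.
(** The eliminations in [head] and [tail] expect a modal type, while their argument is given at
    [El (Str G a)]; both types represent the same class. *)
Lemma St_stage' : (G, Mod gam (El (Str' G a))) ∈ St⌞σ⌟.
Proof. erewrite St_sub; [| exact El_X_in | exact Hσ]. apply Mod_spec; [rep | rep | apply S_stage]. Qed.

Notation Ω := (ex Ξ hγ S⌞sl hγ σ⌟).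
Notation w := (wk Ξ hγ S⌞sl hγ σ⌟).
Notation Gx := (ext G (one ∘ gam) (El (Str' G a))).

Lemma one_gam : one ∘ gam ∈ hγ.
Proof. rewrite <- h_1l. rep. Qed.
Hint Resolve one_gam : rep.
Lemma S_stage1 : (lock G (one ∘ gam), El (Str' G a)) ∈ S⌞sl hγ σ⌟.
Proof.
  eapply ty_ctx with (Γ := lk Ξ hγ); [exact S_stage | rep | rep].
Qed.
Lemma S_stage2 : (lock (lock G one) gam, El (Str' G a)) ∈ S⌞sl hγ σ⌟.
Proof. apply ty_lk'; [exact (ctx_ok HG) | exact S_stage1]. Qed.
Lemma Gx_mem : Gx ∈ Ω.
Proof. pose proof S_stage1. rep. Qed.
Lemma w_mem : (Gx, G, swk) ∈ w.
Proof. pose proof S_stage1. rep. Qed.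
Lemma S_γ : TyIn (lk Ξ hγ) S⌞sl hγ σ⌟.
Proof. pose proof (sl_in hγ Hσ). ty. Qed.
Lemma w_sub : SubIn Ω Ξ w.
Proof. apply wk_in, S_γ. Qed.
Lemma σw : SubIn Ω Γ (σ • w).
Proof. pose proof w_sub. ty. Qed.

Lemma A_Ω : (Gx, (El a)⟦swk⟧) ∈ A⌞σ • w⌟.
Proof.
  pose proof w_sub. pose proof A_stage. pose proof w_mem.
  erewrite <- Tsub_cmp by ty. rep.
Qed.
Lemma A_Ω_γδ : (lock (lock Gx gam) del, (El a)⟦swk⟧) ∈ A⌞σ • w⌟.
Proof.
  pose proof Gx_mem. eapply ty_ctx with (Γ := Ω); [exact A_Ω | assumption |].
  rewrite <- (lk_1 Ω), <- h_gd, <- lk_lk. rep.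
Qed.
(** The key in [wk_Str'] is taken over Ξ.{γ} and hence is an identity, and its weakening under γ and
    then ℓ is weakening under γ, as γℓ = γ. *)
Lemma S_Ω : (lock (lock Gx gam) ell, wk_Str' G a) ∈ S⌞sl hγ (σ • w)⌟.
Proof.
  unfold wk_Str'. pose proof w_sub as W. pose proof S_stage as K. pose proof w_mem as V.
  assert (K1 : (lock (lock G gam) one, El (Str' G a)) ∈ S⌞sl hγ σ⌟)
    by (apply ty_one; [eapply ctx_ok; rep | exact K]).
  assert (E : S⌞sl hγ σ⌟ ⌞ky (lk Ξ hγ) h1 hℓ⌟ = S⌞sl hγ σ⌟).
  { rewrite (ky_lk _ _ le_1l). nrm. rewrite ky_id. apply Tsub_id, S_γ. }
  erewrite sl_cmp by ty. erewrite <- Tsub_cmp; [| ty | apply sl_in, W | ty].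
  assert (Le := le_1l).
  assert (P : (lock (lock G gam) ell, (El (Str' G a))⟦skey (lock G gam) one ell⟧)
    ∈ S⌞sl hγ σ⌟) by (rewrite <- E; rep).
  replace (sl hγ w) with (sl hℓ (sl hγ w)) by (rewrite (sl_sl hγ hℓ W), h_gl; reflexivity).
  eapply Tsub_spec; [exact P | rep].
Qed.

Lemma MA_Ω : (lock Gx gam, Mod del (El a)⟦swk⟧) ∈ (MA Γ A)⌞sl hγ (σ • w)⌟.
Proof.
  pose proof Gx_mem. erewrite MA_γ; [| ty | exact σw].
  apply Mod_spec; [rep | rep | apply A_Ω_γδ].
Qed.
Lemma MS_Ω : (lock Gx gam, Mod ell (wk_Str' G a)) ∈ (MS Γ S)⌞sl hγ (σ • w)⌟.
Proof.
  pose proof Gx_mem. erewrite MS_γ; [| ty | exact σw].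
  apply Mod_spec; [rep | rep | apply S_Ω].
Qed.
(** This is where the unfolding of [Str'] is used on raw syntax: it converts the variable bound in
    [head] and [tail] to the product type at which they project. *)
Lemma var_Ω :
  (lock Gx gam, prod (Mod del (El a)⟦swk⟧) (Mod ell (wk_Str' G a)), var)
  ∈ var' Ξ hγ S⌞sl hγ σ⌟.
Proof.
  pose proof Gx_mem as KG. pose proof S_stage1 as K1. pose proof w_sub as W.
  assert (V : (lock Gx (one ∘ gam), (El (Str' G a))⟦slock (one ∘ gam) swk⟧, var)
    ∈ var' Ξ hγ S⌞sl hγ σ⌟) by rep.
  eapply tm_conv with (T := S⌞sl hγ σ⌟⌞sl hγ w⌟).
  - eapply tm_ctx with (Γ := lk Ω hγ); [exact V | rep | rep].
  - eapply ty_ctx with (Γ := lk Ω hγ); [| | rep]; rep.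
  - erewrite Tsub_cmp; [| ty | apply sl_in, W | ty]. erewrite <- sl_cmp by ty.
    erewrite S_sub; [| exact El_α_in | exact El_X_in | exact El_X_unfold | apply sl_in, σw].
    apply Prd_spec; [rep | apply MA_Ω | apply MS_Ω].
Qed.

Lemma head_spec x r :
  (G, El (Str G a), r) ∈ x -> (G, El a, head G a r) ∈ hd Γ A S Ξ σ x.
Proof.
  intros Hr. unfold hd, hlet, head.
  pose proof Gx_mem as KG. pose proof σw as SW. pose proof w_sub as W.
  eapply Let_spec with (Z' := (El a)⟦swk⟧);
    [exact HG | rep | rep | exact S_stage2 | exact A_stage | | | |].
  - pose proof S_stage2. pose proof A_stage. rep.
  - apply tm_one; [exact (ctx_ok HG)|]. eapply tm_conv; [exact Hr | apply St_stage | apply St_stage'].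
  - rewrite h_1l. pose proof A_stage. pose proof w_mem. rep.
  - unfold generic. rewrite h_1l. unfold hd'.
    apply Trv_spec; [exact KG | exact A_Ω |].
    eapply tm_conv with (T := TMod Ω h1 A⌞σ • w⌟).
    + eapply Cmp_spec with (mu := gam) (nu := del);
        [exact KG | rep | rep | exact A_Ω_γδ |].
      apply mod_spec; [exact KG | rep | exact MA_Ω |].
      apply P1_spec; [rep | exact MA_Ω | exact MS_Ω | exact var_Ω].
    + rewrite <- h_gd. apply Mod_spec; [exact KG | rep |].
      apply ty_lk; [exact (ctx_ok KG) | exact A_Ω_γδ].
    + apply Mod_spec; [exact KG | rep |]. apply ty_one; [exact (ctx_ok KG) | exact A_Ω].
Qed.

Lemma tail_spec x r :
  (G, El (Str G a), r) ∈ x -> (G, El (Str G a), tail G a r) ∈ tl Γ A S Ξ σ x.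
Proof.
  intros Hr. unfold tl, hlet, tail.
  pose proof Gx_mem as KG. pose proof σw as SW. pose proof w_sub as W.
  eapply Let_spec with (Z' := Mod (gam ∘ ell) (wk_Str' G a));
    [exact HG | rep | rep | exact S_stage2 | exact St_stage | | | |].
  - pose proof S_stage2. pose proof St_stage. rep.
  - apply tm_one; [exact (ctx_ok HG)|]. eapply tm_conv; [exact Hr | apply St_stage | apply St_stage'].
  - rewrite h_1l. erewrite Tsub_cmp by ty. erewrite St_sub; [| exact El_X_in | exact SW].
    apply Mod_spec; [exact KG | rewrite <- h_gl; rep |].
    apply ty_lk; [exact (ctx_ok KG) | exact S_Ω].
  - unfold generic. rewrite h_1l. unfold tl'.
    eapply Cmp_spec with (mu := gam) (nu := ell);
      [exact KG | rep | rep | exact S_Ω |].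
    apply mod_spec; [exact KG | rep | exact MS_Ω |].
    apply P2_spec; [rep | exact MA_Ω | exact MS_Ω | exact var_Ω].
Qed.
End Stage.

Definition unc_fam : family mode_s mode_s := fun Ξ σ x =>
  Pr Ξ A⌞σ⌟ St⌞σ⌟ (hd Γ A S Ξ σ x) (tl Γ A S Ξ σ x).
Definition unc := hlam Γ h1 St (Prd Γ A St) unc_fam.

Lemma hd_St_in Ξ σ x :
  SubIn Ξ Γ σ -> TmIn Ξ St⌞σ⌟ x -> TmIn Ξ A⌞σ⌟ (hd Γ A S Ξ σ x).
Proof. apply hd_in; [exact El_α_in | exact El_X_in | exact El_X_unfold]. Qed.
Lemma tl_St_in Ξ σ x :
  SubIn Ξ Γ σ -> TmIn Ξ St⌞σ⌟ x -> TmIn Ξ St⌞σ⌟ (tl Γ A S Ξ σ x).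
Proof. apply tl_in; [exact El_α_in | exact El_X_in | exact El_X_unfold]. Qed.
Hint Resolve hd_St_in tl_St_in : ty.

Lemma unc_fam_ok : fam Γ h1 St (Prd Γ A St) unc_fam.
Proof.
  intros Ξ σ x H K. rewrite lk_1, (sl_1 H) in K. split.
  - erewrite Prd_sub by ty. apply Pr_in; ty.
  - intros Θ ρ R. unfold unc_fam. rewrite (sl_1 R). erewrite Pr_sub by ty.
    erewrite hd_sub; [| exact El_α_in | exact El_X_in | exact El_X_unfold | exact H | exact R | exact K].
    erewrite tl_sub; [| exact El_α_in | exact El_X_in | exact El_X_unfold | exact H | exact R | exact K].
    erewrite !Tsub_cmp by ty. reflexivity.
Qed.

Section Raw.
Context (G : ctx mode_s) (a : tm mode_s) (HG : G ∈ Γ) (Ha : (G, Univ, a) ∈ α).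
Notation S0 := (El (Str G a)).

Lemma A_mem : (G, El a) ∈ A.
Proof. rep. Qed.
Lemma St_mem : (G, S0) ∈ St.
Proof.
  rewrite <- (Tsub_id St_El_in). eapply St_stage; [ty | exact HG |].
  rewrite (Msub_id Hα). exact Ha.
Qed.

Lemma unc_mem : (G, arr S0 (prod (El a) S0), uncons G a) ∈ unc.
Proof.
  pose proof A_mem as KA. pose proof St_mem as KS.
  assert (KS1 := ty_one (ctx_ok HG) KS).
  set (Ξ := ex Γ h1 St). set (w := wk Γ h1 St).
  assert (W : SubIn Ξ Γ w) by (apply wk_in; rewrite lk_1; exact St_El_in).
  assert (KG : ext G one S0 ∈ Ξ) by (unfold Ξ; rep).
  assert (Kw : (ext G one S0, G, swk) ∈ w) by (unfold w; rep).
  assert (Ka : (ext G one S0, Univ, a⟪swk⟫) ∈ α⌜w⌝).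
  { eapply tm_U; [exact KG | | eapply Msub_spec; [exact Ha | exact Kw]].
    rewrite <- (U_sub W). rep. }
  assert (LA := A_stage W Ka). assert (LS := St_stage W KG Ka).
  assert (V : (ext G one S0, El (Str (ext G one S0) a⟪swk⟫), var) ∈ var' Γ h1 St).
  { eapply tm_conv with (A := S0⟦slock one swk⟧) (T := St⌞w⌟).
    - eapply tm_ctx with (Γ := lk Ξ h1); [rep | rep | rewrite lk_1; exact KG].
    - rewrite <- (sl_1 W).
      eapply ty_ctx with (Γ := lk Ξ h1); [rep | rep | rewrite lk_1; exact KG].
    - exact LS. }
  unfold unc, hlam, Lam, arr, uncons. eapply lam_spec; [exact HG | rep | exact KS1 | rep |].
  unfold generic. fold Ξ w. unfold unc_fam.
  eapply tm_conv with (T := (Prd Γ A St)⌞w⌟).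
  - apply Pr_spec; [exact KG | exact LA | exact LS | |].
    + apply head_spec; assumption.
    + apply tail_spec; assumption.
  - erewrite Prd_sub by ty. apply Prd_spec; assumption.
  - rep.
Qed.

Context (B0 : ty mode_s) (c' : tm mode_s).
Context (B : Ty mode_s) (c : Tm mode_s) (KB : (G, B0) ∈ B)
  (Kc : (G, arr B0 (prod (El a) B0), c') ∈ c).

Lemma B_in : TyIn Γ B.
Proof. eapply TyIn_intro; eassumption. Qed.
Lemma c_in : TmIn Γ (Arr Γ h1 B (Prd Γ A B)) c.
Proof.
  pose proof A_mem. eapply TmIn_intro; [exact HG | | exact Kc].
  apply arr_spec; [exact HG | exact KB | rep].
Qed.
Hint Resolve B_in c_in : ty.

Notation Ω := (ex Γ h1 B).
Notation w := (wk Γ h1 B).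
Notation b := (var' Γ h1 B).
Notation G1 := (ext G one B0).

Lemma G1_mem : G1 ∈ Ω.
Proof. pose proof (ty_one (ctx_ok HG) KB). rep. Qed.
Lemma w_mem1 : (G1, G, swk) ∈ w.
Proof. pose proof (ty_one (ctx_ok HG) KB). rep. Qed.
Lemma w_in1 : SubIn Ω Γ w.
Proof. apply wk_in. rewrite lk_1. ty. Qed.
Lemma b_in : TmIn Ω B⌞w⌟ b.
Proof.
  assert (V := var_in (ty_1 B_in)). rewrite lk_1, (sl_1 w_in1) in V. exact V.
Qed.
Lemma b_mem : (G1, B0⟦swk⟧, var) ∈ b.
Proof.
  pose proof (ty_one (ctx_ok HG) KB). pose proof G1_mem. pose proof w_in1 as W.
  pose proof w_mem1.
  eapply tm_conv with (A := B0⟦slock one swk⟧) (T := B⌞w⌟).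
  - eapply tm_ctx with (Γ := lk Ω h1); [rep | rep | rewrite lk_1; assumption].
  - rewrite <- (sl_1 W).
    eapply ty_ctx with (Γ := lk Ω h1); [rep | rep | rewrite lk_1; assumption].
  - rep.
Qed.

(** Locates both raw sides of the coalgebra equation in classes, the left one with [uncons] already
    β-reduced, so that the equation can be compared by components. *)
Lemma raw_sides f f0 :
  (G, arr B0 S0, f0) ∈ f ->
  let A' := (El a)⟦swk⟧ in let B' := B0⟦swk⟧ in let C' := S0⟦swk⟧ in
  let cx := app B' (prod A' B') c'⟪swk⟫ var in
  (G1, prod A' C',
    app C' (prod A' C') (uncons G a)⟪swk⟫ (app B' C' f0⟪swk⟫ var))
  ∈ Pr Ω A⌞w⌟ St⌞w⌟ (hd Γ A S Ω w (ap B Ω w St f b)) (tl Γ A S Ω w (ap B Ω w St f b)) /\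
  (G1, prod A' C', pair A' C' (fst A' B' cx) (app B' C' f0⟪swk⟫ (snd A' B' cx)))
  ∈ Pr Ω A⌞w⌟ St⌞w⌟ (c0 Γ A B c Ω w b) (ap B Ω w St f (c1 Γ A B c Ω w b)).
Proof.
  intros Hf A' B' C' cx.
  pose proof A_mem as KA. pose proof St_mem as KS. pose proof unc_mem as KU.
  pose proof G1_mem as KG. pose proof w_mem1 as Kw. pose proof w_in1 as W.
  pose proof b_mem as Kb. pose proof b_in as Hb.
  assert (LA : (G1, A') ∈ A⌞w⌟) by (unfold A'; rep).
  assert (LB : (G1, B') ∈ B⌞w⌟) by (unfold B'; rep).
  assert (LC : (G1, C') ∈ St⌞w⌟) by (unfold C'; rep).
  assert (HF : TmIn Γ (Arr Γ h1 B St) f).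
  { eapply TmIn_intro; [exact HG | | exact Hf]. apply arr_spec; assumption. }
  assert (Lf : (G1, arr B' C', f0⟪swk⟫) ∈ f⌜w⌝).
  { eapply tm_conv with (T := (Arr Γ h1 B St)⌞w⌟).
    - eapply Msub_spec; [exact Hf | exact Kw].
    - eapply Tsub_spec; [|exact Kw]. apply arr_spec; assumption.
    - erewrite Arr_sub by ty. rewrite (sl_1 W). apply arr_spec; assumption. }
  assert (Lc : (G1, arr B' (prod A' B'), c'⟪swk⟫) ∈ c⌜w⌝).
  { eapply tm_conv with (T := (Arr Γ h1 B (Prd Γ A B))⌞w⌟).
    - eapply Msub_spec; [exact Kc | exact Kw].
    - eapply Tsub_spec; [|exact Kw]. apply arr_spec; [assumption | assumption | rep].
    - erewrite Arr_sub by ty. rewrite (sl_1 W). erewrite Prd_sub by ty.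
      apply arr_spec; [assumption | assumption | rep]. }
  assert (Lu : (G1, arr C' (prod A' C'), (uncons G a)⟪swk⟫) ∈ unc⌜w⌝).
  { eapply tm_conv with (T := (Arr Γ h1 St (Prd Γ A St))⌞w⌟).
    - eapply Msub_spec; [exact KU | exact Kw].
    - eapply Tsub_spec; [|exact Kw]. apply arr_spec; [assumption | assumption | rep].
    - erewrite Arr_sub by ty. rewrite (sl_1 W). erewrite Prd_sub by ty.
      apply arr_spec; [assumption | assumption | rep]. }
  assert (Lx : (G1, C', app B' C' f0⟪swk⟫ var) ∈ ap B Ω w St f b)
    by (apply app_nd_spec; assumption).
  assert (Hx : TmIn Ω St⌞w⌟ (ap B Ω w St f b)) by (eapply TmIn_intro; eassumption).
  assert (Lcx : (G1, prod A' B', cx) ∈ ap B Ω w (Prd Γ A B) c b).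
  { unfold ap. erewrite Prd_sub by ty. apply app_nd_spec; [assumption | assumption | rep | assumption ..]. }
  split.
  (* The raw term is an application of [uncons]; it represents the class of the pair because β is an
     equation between classes. *)
  - assert (E := hlam_app (ty_1 St_El_in) (Prd_in El_α_in St_El_in) unc_fam_ok W (a := ap B Ω w St f b)).
    rewrite lk_1, (sl_1 W) in E. fold unc in E. unfold unc_fam in E. rewrite <- E by exact Hx.
    erewrite Prd_sub by ty. apply app_nd_spec; [assumption | assumption | rep | assumption ..].
  - apply Pr_spec; [assumption .. | apply P1_spec; assumption |].
    apply app_nd_spec; [assumption .. | apply P2_spec; assumption].
Qed.

(** [coalgebra_hom] is the instance of [is_hom] at the stage extended by x : B and its last
    variable. Conversely, both sides are natural, so substitution yields every other instance. *)
Lemma hom_iff f f0 :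
  (G, arr B0 S0, f0) ∈ f ->
  coalgebra_hom G (El a) B0 c' S0 (uncons G a) f0 <-> is_hom Γ A S B c f.
Proof.
  intros Hf. destruct (raw_sides Hf) as [E1 E2].
  assert (W := w_in1). assert (Hb := b_in).
  assert (HF : TmIn Γ (Arr Γ h1 B St) f).
  { eapply TmIn_intro; [exact HG | | exact Hf]. apply arr_spec; [exact HG | exact KB | exact St_mem]. }
  assert (Hx : TmIn Ω St⌞w⌟ (ap B Ω w St f b)) by exact (ap_in B_in W St_El_in HF Hb).
  assert (H0 := c0_in El_α_in B_in c_in W Hb).
  assert (H1 := c1_in El_α_in B_in c_in W Hb).
  assert (Hy : TmIn Ω St⌞w⌟ (ap B Ω w St f (c1 Γ A B c Ω w b))) by exact (ap_in B_in W St_El_in HF H1).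
  split.
  - intros [_ E]. cbn zeta in E.
    assert (P := mem_eq E1 E2 (Logic.conj (ctx_ok G1_mem)
      (Logic.conj (ty_mem (Prd_spec G1_mem (Tsub_spec A_mem w_mem1) (Tsub_spec St_mem w_mem1))) E))).
    assert (P0 := f_equal (P1 Ω A⌞w⌟ St⌞w⌟) P). assert (P1' := f_equal (P2 Ω A⌞w⌟ St⌞w⌟) P).
    erewrite !P1_Pr in P0 by ty. erewrite !P2_Pr in P1' by ty.
    intros Ξ σ y H K.
    assert (K1 : TmIn (lk Ξ h1) B⌞sl h1 σ⌟ y) by (rewrite lk_1, (sl_1 H); exact K).
    (* The substitution that sends the generic stage to Ξ and its variable to y. *)
    set (ρ := sx h1 σ B y).
    assert (R : SubIn Ξ Ω ρ) by (apply sx_in; [exact H | ty | exact K1]).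
    assert (Eσ : w • ρ = σ) by (eapply wk_sx; [exact H | ty | exact K1]).
    assert (Ey : b⌜ρ⌝ = y).
    { rewrite <- (sl_1 R). eapply var_sx; [exact H | ty | exact K1]. }
    apply (f_equal (fun t => t⌜ρ⌝)) in P0, P1'. revert P0 P1'.
    erewrite hd_sub; [| exact El_α_in | exact El_X_in | exact El_X_unfold | exact W | exact R | exact Hx].
    erewrite tl_sub; [| exact El_α_in | exact El_X_in | exact El_X_unfold | exact W | exact R | exact Hx].
    rewrite (ap_sub B_in W R St_El_in HF Hb), (ap_sub B_in W R St_El_in HF H1).
    erewrite c0_sub; [| exact El_α_in | exact B_in | exact c_in | exact W | exact R | exact Hb].
    erewrite c1_sub; [| exact El_α_in | exact B_in | exact c_in | exact W | exact R | exact Hb].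
    rewrite Eσ, Ey. auto.
  - intros P. destruct (P Ω w b W Hb) as [P0 P1']. rewrite P0, P1' in E1.
    split; [exact (tm_mem Hf)|]. cbn zeta. exact (tm_eq_rel E1 E2).
Qed.
End Raw.
End Final.

Theorem theorem9p7 (G : ctx mode_s) (A : tm mode_s) :
  ⊢c G ->
  G ⊢t A ∶ Univ ->
  final_coalgebra G (El A) (El (Str G A)) (uncons G A).
Proof.
  intros HG Ht.
  destruct (ex_class HG) as [Γ KG].
  destruct (ex_class (R := @rtm mode_s) (x := (G, Univ, A))) as [α Ka];
    [repeat split; [exact HG | apply eT_Univ; exact HG | exact Ht]|].
  destruct (Str'_spec KG Ka) as (X & HX & _).
  assert (Hα : TmIn Γ (TU Γ) α) by (eapply TmIn_intro; rep).
  assert (KS := St_mem Hα HX KG Ka).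
  split; [exact (ty_mem KS) | split; [exact (tm_mem (unc_mem Hα HX KG Ka))|]].
  intros B c HB Hc.
  destruct (ex_class (R := @rty mode_s) (x := (G, B))) as [β KB]; [split; assumption|].
  assert (KP : (G, arr B (prod (El A) B)) ∈ Arr Γ h1 β (Prd Γ (TEl α) β))
    by (apply arr_spec; rep).
  destruct (ex_class (R := @rtm mode_s) (x := (G, arr B (prod (El A) B), c))) as [κ Kc];
    [repeat split; [exact HG | exact (ty_mem KP) | exact Hc]|].
  assert (KA : (G, arr B (El (Str G A))) ∈ Arr Γ h1 β (St Γ (TEl X)))
    by (apply arr_spec; assumption).
  destruct (final_St (El_α_in Hα) (El_X_in HX) (El_X_unfold Hα HX) (B_in KG KB) (c_in KG Ka KB Kc))
    as (f & Hf & Ff & Uf).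
  destruct (tm_at Hf KG KA) as [f0 Kf].
  exists f0. split; [apply (hom_iff Hα HX KG Ka KB Kc Kf); exact Ff|].
  intros g Hg.
  destruct (ex_class (R := @rtm mode_s) (x := (G, arr B (El (Str G A)), g))) as [g' Kg];
    [repeat split; [exact HG | exact (ty_mem KA) | exact (proj1 Hg)]|].
  assert (E : g' = f).
  { apply Uf; [eapply TmIn_intro; eassumption |].
    apply (hom_iff Hα HX KG Ka KB Kc Kg). exact Hg. }
  (* Two members of one class with the same context and type are judgementally equal, which turns
     the equation of classes back into the required judgement. *)
  subst g'. exact (tm_eq_rel Kg Kf).
Qed.
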